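(* Let $GL(n)$ denote $GL(n,\mathbb R)$ or $GL(n,\mathbb C)$, and let $GL_*$, $\Omega$, and the functions $\varphi_1,\dots,\varphi_n$ on $GL_*$ be as in the context. The foliation of $GL_*$ by the functions $\varphi_j$ is symplectic for $\Omega$. Each leaf $\{a\in GL_*:\varphi_j(a)=c_j,\ 1\le j\le n\}$ is parametrized by $$V_*=\{(v_+,v_-)\in GL_0^-\times GL_0^+:\ v_-^{-1}v_+\in GL_*\};$$ the pullback of $\Omega$ to a leaf is generically of rank $n^2-n$; the pullback from a leaf to $V_*$ is independent of the choice of leaf and is given by $$\operatorname{tr}\Big[v_+^{-1}dv_+\wedge\{b_+^{-1}db_++b_+^{-1}(\delta^{-1}d\delta)b_+\}-v_-^{-1}dv_-\wedge\{b_-^{-1}db_--b_-^{-1}(\delta^{-1}d\delta)b_-\}\Big],$$ where $b_\pm$ and $\delta$ are determined from $(v_+,v_-)$ by the factorization $v_-^{-1}v_+=b_-^{-1}\delta b_+$, $b_\pm\in GL_0^\pm$, $\delta=\operatorname{diag}(\delta)$ (i.e. $\delta$ diagonal).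
   Context: $GL^{\pm}=\{a\in GL(n):a_{jk}=0\text{ if }\pm(j-k)>0\}$; $GL^\pm_0=\{a\in GL^\pm:\operatorname{diag}(a)=1\}$; $GL_*=(GL^+\cdot GL^-)\cap(GL^-\cdot GL^+)$. Each $a\in GL_*$ has unique factorizations $a=a_+v_+^{-1}=a_-v_-^{-1}$, $a_\pm\in GL^\pm$, $v_\pm\in GL_0^\mp$, and $$\Omega=\operatorname{tr}[v_+^{-1}dv_+\wedge a_+^{-1}da_+-v_-^{-1}dv_-\wedge a_-^{-1}da_-].$$ The pair $(v_+,v_-)$ obtained from $a$ is the parameter of $a$ in $V_*$. The upper and lower principal minors of $a$ are $d_j^+(a)=\det(a_{kl})_{1\le k,l\le j}$ and $d_j^-(a)=\det(a_{kl})_{j\le k,l\le n}$, with $d_0^+=1=d_{n+1}^-$; the foliation functions are $\varphi_j(a)=d_j^+(a)/d_{j+1}^-(a)$, $1\le j\le n$. That the foliation is symplectic for $\Omega$ means that $\Omega$ pulls back to each leaf as a closed $2$-form which is generically nondegenerate.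
   Formalization: The terms δ^{-1}dδ carry a factor 1/2 (the printed formula fails for n=2); ''parametrized by V_*'' is read as: the parameter map of a leaf is a local diffeomorphism to V_*, with image given by a square condition and fibers by diagonal sign matrices (a, -a share a parameter for n=2). *)

(* Defs.v *)
From HB Require Import structures.
From mathcomp Require Export all_boot all_order all_algebra.
From mathcomp Require Export all_classical all_reals all_analysis.
From mathcomp Require Export complex.

Set Implicit Arguments.
Unset Strict Implicit.
Unset Printing Implicit Defensive.

Export Order.TTheory GRing.Theory Num.Theory.
Export numFieldNormedType.Exports.

Local Open Scope ring_scope.
Local Open Scope classical_set_scope.

Section DifferentialForms.
Context {K : numFieldType}.

(* [C^k] on an open set [A]; for [K] complex, ['d] is the complex
   differential, so this is holomorphy as soon as [k > 0]. *)
Fixpoint Ck {E F : normedModType K} (k : nat) (A : set E) (f : E -> F) : Prop :=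
  match k with
  | 0 => forall x, A x -> {for x, continuous f}
  | k'.+1 => (forall x, A x -> differentiable f x) /\
             (forall h, Ck k' A (fun x => 'd f x h))
  end.

Definition smooth {E F : normedModType K} (A : set E) (f : E -> F) : Prop :=
  forall k, Ck k A f.

Definition form1 (E F : normedModType K) := E -> E -> F.
Definition form2 (E : normedModType K) := E -> E -> E -> K.

Definition pullback {E F : normedModType K} (f : E -> F) (w : form2 F) :
  form2 E := fun x X Y => w (f x) ('d f x X) ('d f x Y).

(* The vectors [X], [Y], [Z] are extended to constant vector fields, whose Lie
   brackets vanish. *)
Definition extd {E : normedModType K} (w : form2 E) (x X Y Z : E) : K :=
  'd (fun y => w y Y Z : K^o) x X - 'd (fun y => w y X Z : K^o) x Y
  + 'd (fun y => w y X Y : K^o) x Z.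

Definition trwedge {E : normedModType K} {n : nat}
    (al be : form1 E 'M[K]_n) : form2 E :=
  fun x X Y => \tr (al x X *m be x Y - al x Y *m be x X).

Definition logd {E : normedModType K} {n : nat} (f : E -> 'M[K]_n) :
  form1 E 'M[K]_n := fun x X => invmx (f x) *m 'd f x X.

Definition form_rank {E : vectType K} (w : E -> E -> K) (T : {vspace E}) : nat :=
  \rank (\matrix_(i < \dim T, j < \dim T) w (vbasis T)`_i (vbasis T)`_j).

Definition nondegenerate_on {E : vectType K} (w : E -> E -> K)
    (T : {vspace E}) : Prop :=
  forall X, X \in T -> (forall Y, Y \in T -> w X Y = 0) -> X = 0.

End DifferentialForms.

Section Foliation.
Context {K : numFieldType} {n : nat}.

Local Notation M := 'M[K]_n.+1.

Definition GLp : set M :=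
  [set a | a \in unitmx /\ forall j k : 'I_n.+1, (k < j)%N -> a j k = 0].
Definition GLm : set M :=
  [set a | a \in unitmx /\ forall j k : 'I_n.+1, (j < k)%N -> a j k = 0].
Definition GLp0 : set M := [set a | GLp a /\ forall j, a j j = 1].
Definition GLm0 : set M := [set a | GLm a /\ forall j, a j j = 1].

Definition GLstar : set M :=
  [set g *m h | g in GLp & h in GLm] `&` [set h *m g | h in GLm & g in GLp].

Definition plus_factors (a : M) : set (M * M) :=
  [set p : M * M | [/\ GLp p.1, GLm0 p.2 & a = p.1 *m invmx p.2]].
Definition minus_factors (a : M) : set (M * M) :=
  [set p : M * M | [/\ GLm p.1, GLp0 p.2 & a = p.1 *m invmx p.2]].

Definition a_plus (a : M) : M := (xget (1%:M, 1%:M) (plus_factors a)).1.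
Definition v_plus (a : M) : M := (xget (1%:M, 1%:M) (plus_factors a)).2.
Definition a_minus (a : M) : M := (xget (1%:M, 1%:M) (minus_factors a)).1.
Definition v_minus (a : M) : M := (xget (1%:M, 1%:M) (minus_factors a)).2.

Definition param (a : M) : M * M := (v_plus a, v_minus a).

Definition Omega : form2 M := fun a X Y =>
  trwedge (logd v_plus) (logd a_plus) a X Y
  - trwedge (logd v_minus) (logd a_minus) a X Y.

(* [j] is the 1-based index of the usual notation, with [0 <= j <= n.+1] for
   [dplus] and [1 <= j <= n.+2] for [dminus]; the matrix entries are 0-based. *)
Definition dplus (j : nat) (a : M) : K :=
  \det (\matrix_(k < j, l < j) a (inord k) (inord l)).
Definition dminus (j : nat) (a : M) : K :=
  \det (\matrix_(k < n.+2 - j, l < n.+2 - j)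
          a (inord (j.-1 + k)) (inord (j.-1 + l))).

(* The 0-based [j : 'I_n.+1] stands for the 1-based index [j.+1]. *)
Definition phi (j : 'I_n.+1) (a : M) : K^o := dplus j.+1 a / dminus j.+2 a.

Definition leaf (c : 'I_n.+1 -> K) : set M :=
  [set a | GLstar a /\ forall j, phi j a = c j].

Definition leaf_tangent (a : M) : {vspace M} :=
  (\bigcap_(j < n.+1) lker (linfun ('d (phi j) a)))%VS.

Definition Vstar : set (M * M) :=
  [set v : M * M | [/\ GLm0 v.1, GLp0 v.2 & GLstar (invmx v.2 *m v.1)]].

(* [Vstar] is an open subset of the affine space of pairs of a lower and an
   upper unitriangular matrix; this is the direction of that space. *)
Definition Vtangent : set (M * M) :=
  [set X : M * M | (forall j k : 'I_n.+1, (j <= k)%N -> X.1 j k = 0) /\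
           (forall j k : 'I_n.+1, (k <= j)%N -> X.2 j k = 0)].

(* triples [(b_plus, b_minus, delta)] *)
Definition b_factors (v : M * M) : set (M * M * M) :=
  [set t : M * M * M | [/\ GLp0 t.1.1, GLm0 t.1.2, is_diag_mx t.2 &
            invmx v.2 *m v.1 = invmx t.1.2 *m t.2 *m t.1.1]].

Definition b_plus (v : M * M) : M := (xget (1%:M, 1%:M, 1%:M) (b_factors v)).1.1.
Definition b_minus (v : M * M) : M := (xget (1%:M, 1%:M, 1%:M) (b_factors v)).1.2.
Definition delta (v : M * M) : M := (xget (1%:M, 1%:M, 1%:M) (b_factors v)).2.

(* With [a_plus = d_plus *m b_plus] and [a_minus = d_minus *m b_minus], where
   [d_plus] and [d_minus] are diagonal, [delta] is [d_minus^-1 *m d_plus], while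
   [d_plus *m d_minus] is constant on each leaf. Hence the logarithmic
   differentials of [d_plus] and [d_minus] along a leaf are plus and minus one
   half of that of [delta], which is the origin of the factors [2^-1]. *)
Definition OmegaV : form2 (M * M)%type := fun v X Y =>
  trwedge (logd (fun u => u.1))
    (fun u Z => logd b_plus u Z
       + 2^-1 *: (invmx (b_plus u) *m logd delta u Z *m b_plus u)) v X Y
  - trwedge (logd (fun u => u.2))
    (fun u Z => logd b_minus u Z
       - 2^-1 *: (invmx (b_minus u) *m logd delta u Z *m b_minus u)) v X Y.

(* Smoothness on [Vstar] is expressed through an extension to an open subset
   [U] of the ambient space; only the values on [Vstar] are constrained. *)
Definition leaf_section (c : 'I_n.+1 -> K) (U : set (M * M))
    (s : M * M -> M) : Prop :=
  [/\ open U, smooth U s &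
      forall v, U v -> Vstar v -> leaf c (s v) /\ param (s v) = v].

Definition generic_in (L : set M) (P : M -> Prop) : Prop :=
  exists G : set M,
    [/\ open G, L `<=` closure (L `&` G) & forall a, L a -> G a -> P a].

End Foliation.

(* Main.v *)
From HB Require Import structures.
From mathcomp Require Import ring lra zify.
Require Import Defs.

Set Implicit Arguments.
Unset Strict Implicit.
Unset Printing Implicit Defensive.

Local Open Scope ring_scope.
Local Open Scope classical_set_scope.

(** Write [a = a_+ v_+^-1 = a_- v_-^-1] and let [d_+], [d_-] be the diagonals of the
    triangular factors [a_+], [a_-]. The principal minors of [a] are partial products of
    these diagonals, so that fixing the functions [phi j] amounts to fixing the products
    [d_+ d_-] and the determinant ([phiE], [leaf_diag]). Since [v_-^-1 v_+ = a_-^-1 a_+],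
    the parameter of [a] determines [delta = d_-^-1 d_+], [b_+ = d_+^-1 a_+] and
    [b_- = d_-^-1 a_-] ([b_param]); on a leaf it also determines the squares of the leading
    minors ([leaf_minor_sqr]), hence [a] up to the choice of square roots. A local branch of
    the square root gives a smooth local section of [param] ([leaf_section_ex]). It is
    obtained without analysis of the real or complex square root: near [1] there is
    only one square root near [1], and it depends on its square in a Lipschitz way
    ([sqrt_dist]). This is the only place where the nature of the field matters.

    All the factors are rational functions of the matrix entries: the rows of the
    elimination matrix [elim] are given by a closed formula. What is needed about them
    (smoothness, symmetry of second derivatives, rationality along a line) is
    thus proved once, for any class of functions closed under the field operations
    ([fclass], [mc_elim]). In particular no general theorem on the symmetry of second
    derivatives is used.

    Differentiating [a v_+ = a_+] shows that the logarithmic differentials of [v_+] and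
    [a_+] are, up to sign, the strictly lower and upper parts of [a_+^-1 X v_+]; likewise
    for [v_-] and [a_-]. The differentials of the functions [phi j] are read off their
    diagonals ([diff_phi]), and are independent ([phi_submersion]). Along a leaf
    [d_+ ^ 2] and [delta] have proportional entries, so that the logarithmic differential
    of [d_+] is half that of [delta], that of [d_-] is its opposite, and the pullback of
    [Omega] is [OmegaV] ([pullback_OmegaV]). A section is only constrained on [Vstar]; the
    comparison rests on the fact that functions which agree on [Vstar] have the same
    derivatives along it ([diff_tangent]).

    Closedness: a form [al] such as [v^-1 dv] satisfies the Maurer-Cartan equation
    [d al = - al /\ al], and so does [b^-1 db + k b^-1 (delta^-1 d delta) b]
    ([flat_half_gauge]). For two such forms, [3 d tr (al /\ be)] is
    [tr be^3 - tr al^3 - tr (be - al)^3] ([extd_trwedge]). The cubes of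
    triangular forms are traceless, and the two forms [be - al] are conjugate to each other, both coming from the
    logarithmic differential of the same group element ([gauge_conj]); the two terms of
    [OmegaV] thus have the same differential.

    Nondegeneracy: at the pair of identity matrices [OmegaV] is
    [2 (tr (X_2 Y_1) - tr (X_1 Y_2))], which is nondegenerate. Its Gram determinant is
    rational along the line from any point of [Vstar] to the pair of identities, hence does
    not vanish near that point, except perhaps at the point itself ([gram_near_line]).
    Finally [param] is an immersion of each leaf ([leaf_tangent_inj]), which transports
    this to the tangent spaces of the leaf, whose dimension is given by
    [phi_submersion]. *)

(** * Classes of functions closed under the field operations *)

(** Classes [C] of functions which contain the constants, are closed under addition,
    multiplication and, where possible, inversion, and only depend on the values
    on [D]. *)
Record fclass (K : fieldType) (T : Type) (D : set T) (C : (T -> K) -> Prop) : Prop :=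
  FClass {
    fc_cst : forall k, C (fun=> k);
    fc_add : forall f g, C f -> C g -> C (fun t => f t + g t);
    fc_mul : forall f g, C f -> C g -> C (fun t => f t * g t);
    fc_inv : forall f, C f -> (forall t, D t -> f t != 0) -> C (fun t => (f t)^-1);
    fc_ext : forall f g, (forall t, D t -> f t = g t) -> C f -> C g }.

(** Matrix-valued functions with all entries in the class. *)
Definition mclass (K : fieldType) (T : Type) (C : (T -> K) -> Prop) m p
  (F : T -> 'M[K]_(m, p)) := forall i j, C (fun t => F t i j).

Section FunClass.
Context {K : fieldType} {T : Type} {D : set T} {C : (T -> K) -> Prop}.
Hypothesis CP : fclass D C.

Lemma fc_opp f : C f -> C (fun t => - f t).
Proof.
move=> Cf; apply: (fc_ext CP) (fc_mul CP (fc_cst CP (-1)) Cf) => t _.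
by rewrite mulN1r.
Qed.

Lemma fc_sub f g : C f -> C g -> C (fun t => f t - g t).
Proof. by move=> Cf Cg; apply: (fc_add CP) => //; apply: fc_opp. Qed.

Lemma fc_div f g : C f -> C g -> (forall t, D t -> g t != 0) ->
  C (fun t => f t / g t).
Proof. by move=> Cf Cg g0; apply: (fc_mul CP) => //; apply: (fc_inv CP). Qed.

Lemma fc_sum I (r : seq I) (P : pred I) (F : I -> T -> K) :
  (forall i, C (F i)) -> C (fun t => \sum_(i <- r | P i) F i t).
Proof.
move=> CF; elim: r => [|i r IH].
  by apply: (fc_ext CP) (fc_cst CP 0) => t _; rewrite big_nil.
case Pi: (P i).
  by apply: (fc_ext CP) (fc_add CP (CF i) IH) => t _; rewrite big_cons Pi.
by apply: (fc_ext CP) IH => t _; rewrite big_cons Pi.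
Qed.

Lemma fc_prod I (r : seq I) (P : pred I) (F : I -> T -> K) :
  (forall i, C (F i)) -> C (fun t => \prod_(i <- r | P i) F i t).
Proof.
move=> CF; elim: r => [|i r IH].
  by apply: (fc_ext CP) (fc_cst CP 1) => t _; rewrite big_nil.
case Pi: (P i).
  by apply: (fc_ext CP) (fc_mul CP (CF i) IH) => t _; rewrite big_cons Pi.
by apply: (fc_ext CP) IH => t _; rewrite big_cons Pi.
Qed.

Lemma mc_ext m p (F G : T -> 'M[K]_(m, p)) :
  (forall t, D t -> F t = G t) -> mclass C F -> mclass C G.
Proof. by move=> FG CF i j; apply: (fc_ext CP) (CF i j) => t /FG ->. Qed.

Lemma mc_cst m p (A : 'M[K]_(m, p)) : mclass C (fun=> A).
Proof. by move=> i j; apply: (fc_cst CP). Qed.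

Lemma mc_add m p (F G : T -> 'M[K]_(m, p)) :
  mclass C F -> mclass C G -> mclass C (fun t => F t + G t).
Proof.
move=> CF CG i j; apply: (fc_ext CP) (fc_add CP (CF i j) (CG i j)) => t _.
by rewrite mxE.
Qed.

Lemma mc_opp m p (F : T -> 'M[K]_(m, p)) : mclass C F -> mclass C (fun t => - F t).
Proof.
by move=> CF i j; apply: (fc_ext CP) (fc_opp (CF i j)) => t _; rewrite mxE.
Qed.

Lemma mc_sub m p (F G : T -> 'M[K]_(m, p)) :
  mclass C F -> mclass C G -> mclass C (fun t => F t - G t).
Proof. by move=> CF CG; apply: mc_add => //; apply: mc_opp. Qed.

Lemma mc_scale m p (f : T -> K) (F : T -> 'M[K]_(m, p)) :
  C f -> mclass C F -> mclass C (fun t => f t *: F t).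
Proof.
move=> Cf CF i j; apply: (fc_ext CP) (fc_mul CP Cf (CF i j)) => t _.
by rewrite mxE.
Qed.

Lemma mc_mul m p q (F : T -> 'M[K]_(m, p)) (G : T -> 'M[K]_(p, q)) :
  mclass C F -> mclass C G -> mclass C (fun t => F t *m G t).
Proof.
move=> CF CG i j.
apply: (@fc_ext _ _ _ _ CP (fun t => \sum_k F t i k * G t k j)).
  by move=> t _; rewrite mxE.
by apply: fc_sum => k; apply: (fc_mul CP).
Qed.

Lemma mc_trace m (F : T -> 'M[K]_m) : mclass C F -> C (fun t => \tr (F t)).
Proof. by move=> CF; apply: fc_sum => i; apply: CF. Qed.

Lemma mc_det m (F : T -> 'M[K]_m) : mclass C F -> C (fun t => \det (F t)).
Proof.
move=> CF; rewrite /determinant; apply: fc_sum => s.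
by apply: (fc_mul CP (fc_cst CP _)); apply: fc_prod => i; apply: CF.
Qed.

Lemma mc_inv m (F : T -> 'M[K]_m) : mclass C F ->
  (forall t, D t -> F t \in unitmx) -> mclass C (fun t => invmx (F t)).
Proof.
move=> CF uF.
apply: (@mc_ext _ _ (fun t => (\det (F t))^-1 *: \adj (F t))).
  by move=> t /uF uFt; rewrite /invmx uFt.
apply: mc_scale.
  apply: (fc_inv CP) => [|t /uF]; first exact: mc_det.
  by rewrite unitmxE unitfE.
move=> i j; apply: (@fc_ext _ _ _ _ CP
  (fun t => (-1) ^+ (j + i) * \det (row' j (col' i (F t))))).
  by move=> t _; rewrite mxE.
apply: (fc_mul CP (fc_cst CP _)); apply: mc_det => k l.
by apply: (fc_ext CP) (CF (lift j k) (lift i l)) => t _; rewrite !mxE.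
Qed.

(** The entries of [F] are kept where [b] holds; the other ones are constant. *)
Lemma mc_pattern m p (b : 'I_m -> 'I_p -> bool) (F : T -> 'M[K]_(m, p))
    (A : 'M[K]_(m, p)) :
  mclass C F -> mclass C (fun t => \matrix_(i, j) if b i j then F t i j else A i j).
Proof.
move=> CF i j; case bij: (b i j).
  by apply: (fc_ext CP) (CF i j) => t _; rewrite mxE bij.
by apply: (fc_ext CP) (fc_cst CP (A i j)) => t _; rewrite mxE bij.
Qed.

End FunClass.

(** * Triangular matrices *)

Section Triangular.
Context {K : fieldType} {n : nat}.
Local Notation M := 'M[K]_n.
Implicit Types A B : M.

(** Triangular, strictly triangular and diagonal matrices. *)
Definition islow A := forall i j : 'I_n, (i < j)%N -> A i j = 0.
Definition isup A := forall i j : 'I_n, (j < i)%N -> A i j = 0.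
Definition isslow A := forall i j : 'I_n, (i <= j)%N -> A i j = 0.
Definition issup A := forall i j : 'I_n, (j <= i)%N -> A i j = 0.
Definition isdg A := forall i j : 'I_n, i != j -> A i j = 0.

(** The strictly lower, strictly upper and diagonal parts of a matrix. *)
Definition slowmx A : M := \matrix_(i, j) if (j < i)%N then A i j else (0 : M) i j.
Definition supmx A : M := \matrix_(i, j) if (i < j)%N then A i j else (0 : M) i j.
Definition dgmx A : M := \matrix_(i, j) if i == j then A i j else (0 : M) i j.

Lemma islow_tr A : islow A^T <-> isup A.
Proof. by split=> h i j ij; have := h j i ij; rewrite mxE. Qed.
Lemma isup_tr A : isup A^T <-> islow A.
Proof. by split=> h i j ij; have := h j i ij; rewrite mxE. Qed.

Lemma isslowW A : isslow A -> islow A.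
Proof. by move=> h i j ij; apply: h; apply: ltnW. Qed.
Lemma issupW A : issup A -> isup A.
Proof. by move=> h i j ij; apply: h; apply: ltnW. Qed.
Lemma isdg_low A : isdg A -> islow A.
Proof. by move=> h i j ij; apply: h; apply: contraTN ij => /eqP->; rewrite ltnn. Qed.
Lemma isdg_up A : isdg A -> isup A.
Proof. by move=> h i j ij; apply: h; apply: contraTN ij => /eqP->; rewrite ltnn. Qed.
Lemma low_up_isdg A : islow A -> isup A -> isdg A.
Proof.
move=> l u i j; rewrite -val_eqE neq_ltn => /orP[] ij; [exact: l|exact: u].
Qed.
Lemma low_strict A : islow A -> (forall i, A i i = 0) -> isslow A.
Proof.
move=> l d i j; rewrite leq_eqVlt => /orP[/eqP/val_inj->//|]; exact: l.
Qed.
Lemma up_strict A : isup A -> (forall i, A i i = 0) -> issup A.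
Proof.
move=> l d i j; rewrite leq_eqVlt => /orP[/eqP/val_inj->//|]; exact: l.
Qed.

Lemma isup_add A B : isup A -> isup B -> isup (A + B).
Proof. by move=> hA hB i j ij; rewrite mxE hA ?hB ?addr0. Qed.
Lemma islow_add A B : islow A -> islow B -> islow (A + B).
Proof. by move=> hA hB i j ij; rewrite mxE hA ?hB ?addr0. Qed.
Lemma isup_opp A : isup A -> isup (- A).
Proof. by move=> hA i j ij; rewrite mxE hA ?oppr0. Qed.
Lemma isup_scale k A : isup A -> isup (k *: A).
Proof. by move=> hA i j ij; rewrite mxE hA ?mulr0. Qed.
Lemma islow_scale k A : islow A -> islow (k *: A).
Proof. by move=> hA i j ij; rewrite mxE hA ?mulr0. Qed.

Lemma isdg1 : isdg 1%:M.
Proof. by move=> i j /negPf ij; rewrite mxE ij. Qed.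

Lemma islow_mul A B : islow A -> islow B -> islow (A *m B).
Proof.
move=> hA hB i j ij; rewrite mxE big1 // => k _.
case: (ltnP i k) => [ik|ki]; first by rewrite hA ?mul0r.
by rewrite hB ?mulr0 //; apply: leq_ltn_trans ki ij.
Qed.

Lemma isup_mul A B : isup A -> isup B -> isup (A *m B).
Proof.
move=> /islow_tr hA /islow_tr hB; apply/islow_tr.
by rewrite trmx_mul; apply: islow_mul.
Qed.

Lemma low_mul_diag A B i : islow A -> islow B -> (A *m B) i i = A i i * B i i.
Proof.
move=> hA hB; rewrite mxE (bigD1 i) //= big1 ?addr0 // => k.
rewrite -val_eqE neq_ltn => /orP[] ki; first by rewrite hB ?mulr0.
by rewrite hA ?mul0r.
Qed.

Lemma up_mul_diag A B i : isup A -> isup B -> (A *m B) i i = A i i * B i i.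
Proof.
move=> /islow_tr hA /islow_tr hB.
have := low_mul_diag i hB hA; rewrite -trmx_mul !mxE => ->.
by rewrite mulrC.
Qed.

Lemma isslow_mull A B : isslow A -> islow B -> isslow (A *m B).
Proof.
move=> hA hB; apply: low_strict => [|i]; first by apply: islow_mul => //; apply: isslowW.
by rewrite low_mul_diag //; [rewrite hA ?mul0r|apply: isslowW].
Qed.
Lemma isslow_mulr A B : islow A -> isslow B -> isslow (A *m B).
Proof.
move=> hA hB; apply: low_strict => [|i]; first by apply: islow_mul => //; apply: isslowW.
by rewrite low_mul_diag //; [rewrite hB ?mulr0|apply: isslowW].
Qed.
Lemma issup_mulr A B : isup A -> issup B -> issup (A *m B).
Proof.
move=> hA hB; apply: up_strict => [|i]; first by apply: isup_mul => //; apply: issupW.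
by rewrite up_mul_diag //; [rewrite hB ?mulr0|apply: issupW].
Qed.

Lemma det_low A : islow A -> \det A = \prod_i A i i.
Proof. by move=> h; apply: det_trig; apply/is_trig_mxP => i j /h. Qed.
Lemma det_up A : isup A -> \det A = \prod_i A i i.
Proof.
move=> /islow_tr h; rewrite -det_tr det_low //.
by apply: eq_bigr => i _; rewrite mxE.
Qed.

Lemma low_unit A : islow A -> (A \in unitmx) = [forall i, A i i != 0].
Proof.
move=> h; rewrite unitmxE unitfE det_low //; apply/prodf_neq0/forallP => H i.
  by apply: H.
by move=> _; apply: H.
Qed.
Lemma up_unit A : isup A -> (A \in unitmx) = [forall i, A i i != 0].
Proof.
move=> h; rewrite unitmxE unitfE det_up //; apply/prodf_neq0/forallP => H i.
  by apply: H.
by move=> _; apply: H.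
Qed.

Lemma low_diag_neq0 A i : islow A -> A \in unitmx -> A i i != 0.
Proof. by move=> h; rewrite low_unit // => /forallP. Qed.
Lemma up_diag_neq0 A i : isup A -> A \in unitmx -> A i i != 0.
Proof. by move=> h; rewrite up_unit // => /forallP. Qed.

Lemma invmx_mul A B : A \in unitmx -> B \in unitmx ->
  invmx (A *m B) = invmx B *m invmx A.
Proof.
move=> uA uB; have uAB : A *m B \in unitmx by rewrite unitmx_mul uA.
by apply: (can_inj (mulKmx uAB)); rewrite mulmxV // mulmxA mulmxK // mulmxV.
Qed.

(* Forward substitution: the entries of the inverse vanish row after row. *)
Lemma islow_inv A : A \in unitmx -> islow A -> islow (invmx A).
Proof.
move=> uA h i; have [m] := ubnP (i : nat); elim: m i => // m IH i im j ij.
have : (A *m invmx A) i j = 0 by rewrite mulmxV // mxE -val_eqE /= ltn_eqF.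
rewrite mxE (bigD1 i) //= big1 ?addr0.
  by move/eqP; rewrite mulf_eq0 (negPf (low_diag_neq0 i h uA)) => /eqP.
move=> k; rewrite -val_eqE neq_ltn => /orP[] ki; last by rewrite h ?mul0r.
by rewrite IH ?mulr0 //; [apply: leq_trans ki _|apply: ltn_trans ki ij].
Qed.

Lemma isup_inv A : A \in unitmx -> isup A -> isup (invmx A).
Proof.
move=> uA /islow_tr h; apply/islow_tr; rewrite trmx_inv.
by apply: islow_inv => //; rewrite unitmx_tr.
Qed.

Lemma low_inv_diag A i : A \in unitmx -> islow A -> (invmx A) i i = (A i i)^-1.
Proof.
move=> uA h; apply: (mulfI (low_diag_neq0 i h uA)).
rewrite divff ?low_diag_neq0 // -low_mul_diag //; last exact: islow_inv.
by rewrite mulmxV // mxE eqxx.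
Qed.
Lemma up_inv_diag A i : A \in unitmx -> isup A -> (invmx A) i i = (A i i)^-1.
Proof.
move=> uA h; apply: (mulfI (up_diag_neq0 i h uA)).
rewrite divff ?up_diag_neq0 // -up_mul_diag //; last exact: isup_inv.
by rewrite mulmxV // mxE eqxx.
Qed.

Lemma isdg_mul A B : isdg A -> isdg B -> isdg (A *m B).
Proof.
by move=> a b; apply: low_up_isdg; [apply: islow_mul; apply: isdg_low
  |apply: isup_mul; apply: isdg_up].
Qed.
Lemma isdg_inv A : A \in unitmx -> isdg A -> isdg (invmx A).
Proof.
by move=> u a; apply: low_up_isdg; [apply: islow_inv => //; apply: isdg_low
  |apply: isup_inv => //; apply: isdg_up].
Qed.

Lemma isdg_mulE A B i j : isdg A -> (A *m B) i j = A i i * B i j.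
Proof.
move=> h; rewrite mxE (bigD1 i) //= big1 ?addr0 // => k ki.
by rewrite h 1?eq_sym // mul0r.
Qed.
Lemma isdg_mulEr A B i j : isdg B -> (A *m B) i j = A i j * B j j.
Proof.
move=> h; rewrite mxE (bigD1 j) //= big1 ?addr0 // => k ki.
by rewrite h // mulr0.
Qed.
Lemma isdg_comm A B : isdg A -> isdg B -> A *m B = B *m A.
Proof.
move=> a b; apply/matrixP => i j; rewrite isdg_mulE // isdg_mulEr //.
have [<-|ij] := eqVneq i j; first by rewrite mulrC.
by rewrite (b i j ij) mulr0 mul0r.
Qed.
Lemma isdg_eq A B : isdg A -> isdg B -> (forall i, A i i = B i i) -> A = B.
Proof.
move=> a b h; apply/matrixP => i j; have [<-//|ij] := eqVneq i j.
by rewrite a ?b.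
Qed.

Lemma dgmx_isdg A : isdg (dgmx A).
Proof. by move=> i j /negPf ij; rewrite !mxE ij. Qed.
Lemma dgmxE A i : dgmx A i i = A i i.
Proof. by rewrite mxE eqxx. Qed.
Lemma dgmx_unit A : (dgmx A \in unitmx) = [forall i, A i i != 0].
Proof.
rewrite low_unit; last exact/isdg_low/dgmx_isdg.
by apply: eq_forallb => i; rewrite dgmxE.
Qed.

Lemma slowmx_isslow A : isslow (slowmx A).
Proof. by move=> i j ij; rewrite !mxE ltnNge ij. Qed.
Lemma supmx_issup A : issup (supmx A).
Proof. by move=> i j ij; rewrite !mxE ltnNge ij. Qed.
Lemma split_slow_up L U : isslow L -> isup U -> slowmx (L + U) = L.
Proof.
move=> l u; apply/matrixP => i j; rewrite !mxE; case: ltnP => ij.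
  by rewrite u // addr0.
by rewrite l.
Qed.
Lemma split_sup_low U L : issup U -> islow L -> supmx (U + L) = U.
Proof.
move=> l u; apply/matrixP => i j; rewrite !mxE; case: ltnP => ij.
  by rewrite u // addr0.
by rewrite l.
Qed.
End Triangular.

(** * Triangular factorizations *)

Section LU.
Context {K : fieldType} {n : nat}.
Local Notation M := 'M[K]_n.
Implicit Types w l u : M.

(** The leading block of size [j], completed by the identity. *)
Definition lead (j : nat) w : M :=
  \matrix_(k, l) if (k < j)%N && (l < j)%N then w k l else (1%:M : M) k l.

Lemma lead_low j l : islow l -> islow (lead j l).
Proof.
move=> h k m km; rewrite !mxE; case: ifP => _; first exact: h.
by rewrite -val_eqE /= ltn_eqF.
Qed.
Lemma lead_up j u : isup u -> isup (lead j u).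
Proof.
move=> h k m km; rewrite !mxE; case: ifP => _; first exact: h.
by rewrite -val_eqE /= gtn_eqF.
Qed.

Lemma lead_mul j l u : islow l -> isup u -> lead j (l *m u) = lead j l *m lead j u.
Proof.
move=> hl hu; apply/matrixP => k m; rewrite [LHS]mxE [RHS]mxE.
case: (ltnP k j) => kj /=; last first.
  rewrite (bigD1 k) //= big1 ?addr0.
    by rewrite !mxE ltnNge kj /= eqxx mul1r.
  by move=> i ik; rewrite !mxE ltnNge kj /= eq_sym (negPf ik) mul0r.
case: (ltnP m j) => mj.
  rewrite mxE; apply: eq_bigr => i _; rewrite !mxE kj mj andbT /=.
  case: (ltnP i j) => ij //.
  by rewrite hl ?(leq_trans kj ij) // -val_eqE /= ltn_eqF ?mul0r // (leq_trans kj).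
rewrite (bigD1 m) //= big1 ?addr0.
  by rewrite !mxE [(m < j)%N]ltnNge mj !andbF /= eqxx mulr1.
by move=> i im; rewrite !mxE [(m < j)%N]ltnNge mj !andbF /= (negPf im) mulr0.
Qed.

Lemma lead_low_unit j l : islow l -> l \in unitmx -> lead j l \in unitmx.
Proof.
move=> h ul; rewrite low_unit; last exact: lead_low.
apply/forallP => i; rewrite !mxE; case: ifP => _; first exact: low_diag_neq0.
by rewrite eqxx oner_eq0.
Qed.
Lemma lead_up_unit j u : isup u -> u \in unitmx -> lead j u \in unitmx.
Proof.
move=> h ul; rewrite up_unit; last exact: lead_up.
apply/forallP => i; rewrite !mxE; case: ifP => _; first exact: up_diag_neq0.
by rewrite eqxx oner_eq0.
Qed.

(** Invertible matrices which are the product of a lower and an upper triangular one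
    ([LUable_mul], [LUable_ex]). *)
Definition LUable w := w \in unitmx /\ forall j : 'I_n, lead j w \in unitmx.

Lemma LUable_mul l u : l \in unitmx -> u \in unitmx -> islow l -> isup u ->
  LUable (l *m u).
Proof.
move=> ul uu hl hu; split; first by rewrite unitmx_mul ul.
by move=> j; rewrite lead_mul // unitmx_mul lead_low_unit ?lead_up_unit.
Qed.

(** The combination of the basis vectors before [i] whose product with [w] agrees with
    row [i] of [w] before column [i]. *)
Definition elimrow (i : 'I_n) w : 'rV[K]_n :=
  (\row_l if (l < i)%N then w i l else (0 : 'rV[K]_n) 0 l) *m invmx (lead i w).

(** Gaussian elimination without pivoting, each row in closed form: row [i] of
    [elim w] is the basis vector [i], minus the combination of the basis vectors before
    [i] which makes the entries before the diagonal vanish in row [i] of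
    [elim w *m w]. *)
Definition elim w : M := \matrix_(i, k) ((1%:M : M) i k - elimrow i w 0 k).

Lemma elimrow0 (i : 'I_n) w (k : 'I_n) : lead i w \in unitmx -> (i <= k)%N ->
  elimrow i w 0 k = 0.
Proof.
move=> uw ik; have : (elimrow i w *m lead i w) 0 k = 0.
  by rewrite mulmxKV // !mxE ltnNge ik.
rewrite mxE (bigD1 k) //= big1 ?addr0 => [|m mk].
  by rewrite !mxE [(k < i)%N]ltnNge ik andbF eqxx mulr1.
by rewrite !mxE [(k < i)%N]ltnNge ik andbF (negPf mk) mulr0.
Qed.

Lemma elim_low w : (forall j : 'I_n, lead j w \in unitmx) -> islow (elim w).
Proof.
move=> uw i k ik; rewrite mxE elimrow0 ?(ltnW ik) // mxE -val_eqE /= ltn_eqF //.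
by rewrite subr0.
Qed.

Lemma elim_diag w i : (forall j : 'I_n, lead j w \in unitmx) -> elim w i i = 1.
Proof. by move=> uw; rewrite mxE elimrow0 // mxE eqxx subr0. Qed.

Lemma elim_up w : (forall j : 'I_n, lead j w \in unitmx) -> isup (elim w *m w).
Proof.
move=> uw i k ki.
have : (elimrow i w *m lead i w) 0 k = w i k by rewrite mulmxKV // !mxE ki.
rewrite mxE => E.
have -> : (elim w *m w) i k = w i k - \sum_j elimrow i w 0 j * w j k.
  have -> : w i k = \sum_j (1%:M : M) i j * w j k by rewrite -{1}(mul1mx w) mxE.
  by rewrite mxE -sumrB; apply: eq_bigr => j _; rewrite mxE mulrBl.
rewrite -{1}E; apply/eqP; rewrite subr_eq0; apply/eqP/eq_bigr => j _.
case: (ltnP j i) => ji; last by rewrite elimrow0 ?mul0r.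
by rewrite [lead _ _ _ _]mxE ji ki.
Qed.

Lemma elim_unit w : (forall j : 'I_n, lead j w \in unitmx) -> elim w \in unitmx.
Proof.
move=> uw; rewrite low_unit; last exact: elim_low.
by apply/forallP => i; rewrite elim_diag // oner_eq0.
Qed.

Lemma LUable_ex w : LUable w ->
  exists l u, [/\ l \in unitmx, u \in unitmx, islow l & isup u /\ w = l *m u].
Proof.
move=> [uw lw]; exists (invmx (elim w)), (elim w *m w).
have ue := elim_unit lw; split; rewrite ?unitmx_inv ?unitmx_mul ?ue //.
- by apply: islow_inv => //; apply: elim_low.
- by rewrite mulKmx //; split => //; apply: elim_up.
Qed.

(** Two factorizations differ by a diagonal matrix. *)
Lemma LU_uniq l1 u1 l2 u2 : l1 \in unitmx -> u1 \in unitmx -> l2 \in unitmx ->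
  islow l1 -> isup u1 -> islow l2 -> isup u2 ->
  l1 *m u1 = l2 *m u2 ->
  exists2 d, isdg d & l1 = l2 *m d /\ u2 = d *m u1.
Proof.
move=> a1 b1 a2 hl1 hu1 hl2 hu2 E.
have Ed : invmx l2 *m l1 = u2 *m invmx u1.
  by apply: (canRL (mulmxK b1)); rewrite -mulmxA E mulKmx.
exists (invmx l2 *m l1); last by rewrite mulKVmx // Ed mulmxKV.
apply: low_up_isdg; first by apply: islow_mul => //; apply: islow_inv.
by rewrite Ed; apply: isup_mul => //; apply: isup_inv.
Qed.

End LU.

Section LUclass.
Context {K : fieldType} {T : Type} {D : set T} {C : (T -> K) -> Prop}.
Hypothesis CP : fclass D C.

Lemma mc_lead n j (F : T -> 'M[K]_n) : mclass C F -> mclass C (fun t => lead j (F t)).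
Proof. exact: (mc_pattern CP). Qed.

Lemma mc_slow n (F : T -> 'M[K]_n) : mclass C F -> mclass C (fun t => slowmx (F t)).
Proof. exact: (mc_pattern CP). Qed.
Lemma mc_dg n (F : T -> 'M[K]_n) : mclass C F -> mclass C (fun t => dgmx (F t)).
Proof. exact: (mc_pattern CP). Qed.

Lemma mc_elim n (F : T -> 'M[K]_n) : mclass C F ->
  (forall t, D t -> forall j : 'I_n, lead j (F t) \in unitmx) ->
  mclass C (fun t => elim (F t)).
Proof.
move=> CF uF i k.
apply: (@fc_ext _ _ _ _ CP (fun t => (1%:M : 'M[K]_n) i k - elimrow i (F t) 0 k)).
  by move=> t _; rewrite [RHS]mxE.
apply: (fc_sub CP); first exact: (fc_cst CP).
apply: (mc_mul CP); last first.
  by apply: (mc_inv CP) => [|t Dt]; [apply: mc_lead|apply: uF].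
move=> r l; have [li|li] := ltnP l i.
  by apply: (fc_ext CP) (CF i l) => t _; rewrite mxE li.
by apply: (fc_ext CP) (fc_cst CP 0) => t _; rewrite !mxE ltnNge li.
Qed.

End LUclass.

Section Factors.
Context {K : numFieldType} {n : nat}.
Local Notation M := 'M[K]_n.+1.
Implicit Types a g h : M.

Lemma GLp_inv g : GLp g -> GLp (invmx g).
Proof. by move=> [ug gp]; split; [rewrite unitmx_inv|apply: isup_inv]. Qed.
Lemma GLm_inv g : GLm g -> GLm (invmx g).
Proof. by move=> [ug gp]; split; [rewrite unitmx_inv|apply: islow_inv]. Qed.
Lemma GLp0_inv g : GLp0 g -> GLp0 (invmx g).
Proof.
by move=> [gp g1]; split=> [|i]; [apply: GLp_inv|rewrite up_inv_diag ?g1 ?invr1 //; case: gp].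
Qed.
Lemma GLm0_inv g : GLm0 g -> GLm0 (invmx g).
Proof.
by move=> [gp g1]; split=> [|i]; [apply: GLm_inv|rewrite low_inv_diag ?g1 ?invr1 //; case: gp].
Qed.
Lemma GLp0_unit g : GLp0 g -> g \in unitmx. Proof. by case=> -[]. Qed.
Lemma GLm0_unit g : GLm0 g -> g \in unitmx. Proof. by case=> -[]. Qed.
Lemma GLp0_up g : GLp0 g -> isup g. Proof. by case=> -[]. Qed.
Lemma GLm0_low g : GLm0 g -> islow g. Proof. by case=> -[]. Qed.

Lemma dgmx_up_unit g : GLp g -> dgmx g \in unitmx.
Proof. by move=> [u h]; rewrite dgmx_unit; apply/forallP => i; apply: up_diag_neq0. Qed.
Lemma dgmx_low_unit g : GLm g -> dgmx g \in unitmx.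
Proof. by move=> [u h]; rewrite dgmx_unit; apply/forallP => i; apply: low_diag_neq0. Qed.

Lemma GLp0_normalize g : GLp g -> GLp0 (invmx (dgmx g) *m g).
Proof.
move=> gp; have ud := dgmx_up_unit gp; have hd := dgmx_isdg g; case: gp => u h.
have hi := isup_inv ud (isdg_up hd).
split=> [|i]; first by split; [rewrite unitmx_mul unitmx_inv ud|apply: isup_mul].
by rewrite up_mul_diag // (up_inv_diag i ud (isdg_up hd)) dgmxE mulVf // up_diag_neq0.
Qed.
Lemma GLm0_normalize g : GLm g -> GLm0 (invmx (dgmx g) *m g).
Proof.
move=> gp; have ud := dgmx_low_unit gp; have hd := dgmx_isdg g; case: gp => u h.
have hi := islow_inv ud (isdg_low hd).
split=> [|i]; first by split; [rewrite unitmx_mul unitmx_inv ud|apply: islow_mul].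
by rewrite low_mul_diag // (low_inv_diag i ud (isdg_low hd)) dgmxE mulVf // low_diag_neq0.
Qed.

(** A product of an upper and a lower triangular matrix is the inverse of a product
    in the other order. *)
Lemma GLstarE a : GLstar a <-> LUable a /\ LUable (invmx a).
Proof.
split.
  move=> [] [g [ug gp]] [h [uh hm]] E' [l [ul lm]] [u [uu up]] E.
  split; first by rewrite -E; apply: LUable_mul.
  rewrite -E' invmx_mul //.
  by apply: LUable_mul; rewrite ?unitmx_inv //; [apply: islow_inv|apply: isup_inv].
move=> [/[dup] -[ua _] /LUable_ex[l [u [ul uu lm [up E]]]]].
move=> /LUable_ex[g [h [ug uh gm [hp E']]]]; split.
  exists (invmx h); first exact/GLp_inv.
  exists (invmx g); first exact/GLm_inv.
  apply: (can_inj (mulmxK (_ : invmx a \in unitmx))); first by rewrite unitmx_inv.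
  by rewrite mulmxV // E' mulmxA mulmxKV // mulVmx.
by exists l => //; exists u.
Qed.

Lemma GLstar_unit a : GLstar a -> a \in unitmx.
Proof. by move=> /GLstarE[[]]. Qed.

Lemma LU_uniq_low (l1 l2 u1 u2 : M) : GLm0 l1 -> GLm0 l2 -> GLp u1 -> GLp u2 ->
  l1 *m u1 = l2 *m u2 -> l1 = l2 /\ u1 = u2.
Proof.
move=> [[v1 h1] d1] [[v2 h2] d2] [w1 g1] [w2 g2] E.
have [d dd [E1 E2]] := LU_uniq v1 w1 v2 h1 g1 h2 g2 E.
suff d1' : d = 1%:M by move: E1 E2; rewrite d1' mulmx1 mul1mx.
apply: isdg_eq => // [|i]; first exact: isdg1.
have := d1 i; rewrite E1 low_mul_diag //; last exact: isdg_low.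
by rewrite d2 mul1r mxE eqxx.
Qed.

Lemma plus_factors_uniq a p q : plus_factors a p -> plus_factors a q -> p = q.
Proof.
case: p q => [p1 p2] [q1 q2] [/= gp1 gp2 E] [/= gq1 gq2 E'].
have inv (x y : M) : GLp x -> GLm0 y -> a = x *m invmx y -> y *m invmx x = invmx a.
  by move=> [ux _] /GLm0_unit uy ->; rewrite invmx_mul ?unitmx_inv // invmxK.
have F := etrans (inv _ _ gp1 gp2 E) (esym (inv _ _ gq1 gq2 E')).
have [-> /(congr1 invmx)] := LU_uniq_low gp2 gq2 (GLp_inv gp1) (GLp_inv gq1) F.
by rewrite !invmxK => ->.
Qed.

Lemma minus_factors_uniq a p q : minus_factors a p -> minus_factors a q -> p = q.
Proof.
case: p q => [p1 p2] [q1 q2] [/= [up1 hp1] [[up2 hp2] dp2] E] [/= [uq1 hq1] [[uq2 hq2] dq2] E'].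
have F : p1 *m invmx p2 = q1 *m invmx q2 by rewrite -E.
have [|||d dd [E1 E2]] := LU_uniq up1 _ uq1 hp1 _ hq1 _ F; rewrite ?unitmx_inv //;
  try exact: isup_inv.
have d1 : d = 1%:M.
  apply: isdg_eq => // [|i]; first exact: isdg1.
  have : (invmx q2) i i = 1 by rewrite up_inv_diag // dq2 invr1.
  rewrite E2 up_mul_diag //; [|exact: isdg_up|exact: isup_inv].
  by rewrite up_inv_diag // dp2 invr1 mulr1 mxE eqxx.
move: E1 E2; rewrite d1 mulmx1 mul1mx => <- /(congr1 invmx).
by rewrite !invmxK => ->.
Qed.

(** Closed formulas for [v_plus] and [v_minus]. *)
Definition vp_of a : M := invmx (elim (invmx a)).
Definition vm_of a : M := invmx (elim a *m a) *m dgmx (elim a *m a).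

Lemma plus_factors_of a : LUable (invmx a) -> plus_factors a (a *m vp_of a, vp_of a).
Proof.
move=> [uia la]; have ua : a \in unitmx by rewrite -unitmx_inv.
have ue := elim_unit la; split => /=.
- split; first by rewrite unitmx_mul ua unitmx_inv.
  have -> : a *m vp_of a = invmx (elim (invmx a) *m invmx a).
    apply: (can_inj (mulmxK (_ : elim (invmx a) *m invmx a \in unitmx))).
      by rewrite unitmx_mul ue.
    by rewrite mulVmx ?unitmx_mul ?ue // mulmxA mulmxKV // mulmxV.
  by apply: isup_inv; [rewrite unitmx_mul ue|apply: elim_up].
- apply: GLm0_inv; split=> [|i]; last exact: elim_diag.
  by split=> //; apply: elim_low.
- by rewrite mulmxK // unitmx_inv.
Qed.

Lemma minus_factors_of a : LUable a -> minus_factors a (a *m vm_of a, vm_of a).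
Proof.
move=> [ua la]; have ue := elim_unit la.
set u := elim a *m a; have uu : u \in unitmx by rewrite unitmx_mul ue.
have hu : isup u := elim_up la.
have ud : dgmx u \in unitmx.
  by rewrite dgmx_unit; apply/forallP => i; apply: up_diag_neq0.
have uv : vm_of a \in unitmx by rewrite unitmx_mul unitmx_inv uu.
split => /=.
- split; first by rewrite unitmx_mul ua.
  have -> : a *m vm_of a = invmx (elim a) *m dgmx u.
    apply: (can_inj (mulKmx ue)); rewrite mulKVmx // /vm_of -/u !mulmxA -/u.
    by rewrite mulmxV // mul1mx.
  apply: islow_mul; [apply: islow_inv => //; exact: elim_low|].
  exact/isdg_low/dgmx_isdg.
- split=> [|i].
    split=> //; apply: isup_mul; first exact: isup_inv.
    exact/isdg_up/dgmx_isdg.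
  rewrite up_mul_diag; [|exact: isup_inv|exact/isdg_up/dgmx_isdg].
  by rewrite up_inv_diag // dgmxE mulVf // up_diag_neq0.
- by rewrite mulmxK.
Qed.

Lemma xget_eq (T : choiceType) (x0 : T) (P : set T) x :
  P x -> (forall y, P y -> x = y) -> xget x0 P = x.
Proof. by move=> Px u; apply: xget_unique => // y /u ->. Qed.

Lemma xget_plus a p : plus_factors a p -> xget (1%:M, 1%:M) (plus_factors a) = p.
Proof. by move=> h; apply: xget_eq => // q; apply: plus_factors_uniq. Qed.
Lemma xget_minus a p : minus_factors a p -> xget (1%:M, 1%:M) (minus_factors a) = p.
Proof. by move=> h; apply: xget_eq => // q; apply: minus_factors_uniq. Qed.

Lemma a_plusE a p : plus_factors a p -> a_plus a = p.1.
Proof. by move=> h; rewrite /a_plus (xget_plus h). Qed.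
Lemma v_plusE a p : plus_factors a p -> v_plus a = p.2.
Proof. by move=> h; rewrite /v_plus (xget_plus h). Qed.
Lemma a_minusE a p : minus_factors a p -> a_minus a = p.1.
Proof. by move=> h; rewrite /a_minus (xget_minus h). Qed.
Lemma v_minusE a p : minus_factors a p -> v_minus a = p.2.
Proof. by move=> h; rewrite /v_minus (xget_minus h). Qed.

Lemma plus_factorsP a : GLstar a -> plus_factors a (a_plus a, v_plus a).
Proof.
move=> /GLstarE[_ /plus_factors_of h].
by rewrite (a_plusE h) (v_plusE h).
Qed.
Lemma minus_factorsP a : GLstar a -> minus_factors a (a_minus a, v_minus a).
Proof.
move=> /GLstarE[/minus_factors_of h _].
by rewrite (a_minusE h) (v_minusE h).
Qed.

Lemma v_plus_of a : GLstar a -> v_plus a = vp_of a.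
Proof. by move=> /GLstarE[_ /plus_factors_of/v_plusE]. Qed.
Lemma v_minus_of a : GLstar a -> v_minus a = vm_of a.
Proof. by move=> /GLstarE[/minus_factors_of/v_minusE]. Qed.
Lemma a_plus_of a : GLstar a -> a_plus a = a *m v_plus a.
Proof. by move=> /plus_factorsP[/= _ [[u _] _] {2}->]; rewrite mulmxKV. Qed.
Lemma a_minus_of a : GLstar a -> a_minus a = a *m v_minus a.
Proof. by move=> /minus_factorsP[/= _ [[u _] _] {2}->]; rewrite mulmxKV. Qed.

(** The matrix whose factorization defines [b_plus], [b_minus] and [delta], and its upper
    triangular factor. *)
Definition wof (v : M * M) : M := invmx v.2 *m v.1.
Definition uof (v : M * M) : M := elim (wof v) *m wof v.

Lemma b_factors_of (v : M * M) : LUable (wof v) ->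
  b_factors v (invmx (dgmx (uof v)) *m uof v, elim (wof v), dgmx (uof v)).
Proof.
move=> [uw lw]; have ue := elim_unit lw; have hu : isup (uof v) := elim_up lw.
have uu : uof v \in unitmx by rewrite unitmx_mul ue.
have gu : GLp (uof v) by [].
have ud := dgmx_up_unit gu; have hd := dgmx_isdg (uof v).
split => /=.
- exact: GLp0_normalize.
- by split=> [|i]; [split=> //; apply: elim_low|apply: elim_diag].
- by apply/is_diag_mxP => i j ij; apply: hd.
- by rewrite -mulmxA mulKVmx // /uof mulKmx.
Qed.

Lemma b_factors_uniq (v : M * M) t t' : wof v \in unitmx ->
  b_factors v t -> b_factors v t' -> t = t'.
Proof.
case: t t' => [[p m] d] [[p' m'] d'] uw.
move=> [/= [[up hp] dp] [[um hm] dm] /is_diag_mxP hd E].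
move=> [/= [[up' hp'] dp'] [[um' hm'] dm'] /is_diag_mxP hd' E'].
rewrite /wof in uw.
have F : invmx m *m (d *m p) = invmx m' *m (d' *m p') by rewrite !mulmxA -E.
have ud : d \in unitmx.
  by move: uw; rewrite E !unitmx_mul => /andP[/andP[]].
have idg (x : M) : (forall i j : 'I_n.+1, i != j :> nat -> x i j = 0) -> isdg x.
  by move=> h i j; rewrite -val_eqE; apply: h.
have ud' : d' \in unitmx by move: uw; rewrite E' !unitmx_mul => /andP[/andP[]].
have G (x y : M) : x \in unitmx -> isdg x -> y \in unitmx -> isup y -> GLp (x *m y).
  by move=> ux hx uy hy; split; [rewrite unitmx_mul ux|apply: isup_mul => //; apply: isdg_up].
have [/(congr1 invmx)] := LU_uniq_low (GLm0_inv (conj (conj um hm) dm))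
  (GLm0_inv (conj (conj um' hm') dm')) (G _ _ ud (idg _ hd) up hp) (G _ _ ud' (idg _ hd') up' hp') F.
rewrite !invmxK => -> /esym E2.
have Ed : d' = d.
  apply: isdg_eq; [exact: idg|exact: idg|move=> i].
  have := congr1 (fun x : M => x i i) E2; rewrite /= !isdg_mulE; try exact: idg.
  by rewrite dp dp' !mulr1.
by move: E2; rewrite Ed => /(can_inj (mulKmx ud)) ->.
Qed.

Lemma b_factorsE (v : M * M) t : wof v \in unitmx -> b_factors v t ->
  [/\ b_plus v = t.1.1, b_minus v = t.1.2 & delta v = t.2].
Proof.
move=> uw h; rewrite /b_plus /b_minus /delta (xget_eq _ h) // => q.
exact: b_factors_uniq.
Qed.

Lemma b_of (v : M * M) : LUable (wof v) ->
  [/\ b_plus v = invmx (dgmx (uof v)) *m uof v, b_minus v = elim (wof v)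
   & delta v = dgmx (uof v)].
Proof. by move=> h; apply: (b_factorsE _ (b_factors_of h)); case: h. Qed.

Lemma b_factorsP (v : M * M) : LUable (wof v) ->
  b_factors v (b_plus v, b_minus v, delta v).
Proof. by move=> /[dup] h /b_of[-> -> ->]; apply: b_factors_of. Qed.

Lemma Vstar_LU v : Vstar v -> LUable (@wof v).
Proof. by case=> _ _ /GLstarE[]. Qed.

Lemma param_Vstar a : GLstar a -> Vstar (param a).
Proof.
move=> ga; have [/= ap vp E] := plus_factorsP ga; have [/= am vm E'] := minus_factorsP ga.
split=> //=.
have uvm := GLp0_unit vm; have uvp := GLm0_unit vp.
have F : invmx (v_minus a) *m v_plus a = invmx (a_minus a) *m a_plus a.
  have uam : a_minus a \in unitmx by case: am.
  apply: (can_inj (mulKmx uam)); rewrite mulKVmx // mulmxA -E'.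
  by rewrite {1}E mulmxKV.
split; last first.
  rewrite F; exists (invmx (a_minus a)); first exact: GLm_inv.
  by exists (a_plus a).
exists (invmx (v_minus a)); first by case: (GLp0_inv vm).
by exists (v_plus a) => //; case: vp.
Qed.

End Factors.

(** * Differential calculus over a numeric field *)

Section Calculus.
Context {K : numFieldType}.
Implicit Types E F G : normedModType K.

(** Differentiability and the differential only depend on the function near the point. *)
Lemma near0_is_diff E F (h : E -> F) x : (\forall y \near x, h y = 0) ->
  is_diff x h (0 : E -> F).
Proof.
move=> h0.
have H : continuous (0 : E -> F) /\
    h \o shift x = cst (h x) + (0 : E -> F) +o_ 0 id.
  split; first by move=> y; apply: cst_continuous.
  apply/eqaddoP => e e0.
  have : \forall y \near (0 : E), h (y + x) = 0.
    by move: h0; rewrite (near_shift 0 x) /= subr0.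
  apply: filterS => y /= hy; rewrite !fctE /= hy (nbhs_singleton h0) !add0r oppr0 normr0.
  by rewrite mulr_ge0 // ltW.
have E0 : 'd h x = 0 :> (E -> F) by apply: diff_unique; case: H.
have dh : differentiable h x by apply/diff_locallyP; rewrite E0.
exact: DiffDef dh E0.
Qed.

Lemma is_diff_near E F (f g : E -> F) df x : (\forall y \near x, f y = g y) ->
  is_diff x f df -> is_diff x g df.
Proof.
move=> fg fx.
have h0 : is_diff x (g - f) (0 : E -> F).
  by apply: near0_is_diff; near=> y; rewrite !fctE (near fg y) ?subrr.
have -> : g = f + (g - f) by apply/funext => y; rewrite !fctE addrC subrK.
have [d1 e1] := fx; have [d2 e2] := h0.
apply: DiffDef; first exact: (differentiableD d1 d2).
apply: (etrans (diffD d1 d2)); apply/funext => X.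
exact: (etrans (congr2 (fun s t : F => s + t) (congr1 (@^~ X) e1) (congr1 (@^~ X) e2)) (addr0 _)).
Unshelve. all: by end_near. Qed.

Lemma diff_near E F (f g : E -> F) x : (\forall y \near x, f y = g y) ->
  differentiable f x -> differentiable g x /\ 'd g x = 'd f x :> (E -> F).
Proof.
move=> fg /differentiableP fx; have gx := is_diff_near fg fx.
by split; [apply: ex_diff|apply: diff_val].
Qed.

Lemma diff_on E F (A : set E) (f g : E -> F) x : open A ->
  (forall y, A y -> f y = g y) -> A x ->
  differentiable f x -> differentiable g x /\ 'd g x = 'd f x :> (E -> F).
Proof.
move=> oA fg Ax; apply: diff_near.
by apply: filterS (open_nbhs_nbhs (conj oA Ax)) => y /fg.
Qed.

Lemma is_diff_lin E F (L : {linear E -> F}) x : continuous L -> is_diff x L L.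
Proof. by move=> cL; apply: DiffDef; [exact: linear_differentiable|exact: diff_lin]. Qed.

Lemma is_diff_linc E F G (L : {linear F -> G}) (f df : E -> F) x :
  continuous L -> is_diff x f df -> is_diff x (L \o f) (L \o df).
Proof. by move=> cL fx; have := is_diff_lin (f x) cL; move=> Lx; apply: is_diff_comp. Qed.

Lemma Ck_ext E F k (A : set E) (f g : E -> F) : open A ->
  (forall x, A x -> f x = g x) -> Ck k A f -> Ck k A g.
Proof.
move=> oA; elim: k f g => [|k IH] f g fg /=.
  move=> cf x Ax; rewrite /prop_for /continuous_at -(fg x Ax).
  have nA : nbhs x A by apply: open_nbhs_nbhs.
  by apply: cvg_trans (cf x Ax); apply: near_eq_cvg; near=> y; apply: fg; near: y.
move=> [df dkf]; split=> [x Ax|h].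
  by case: (diff_on oA fg Ax (df x Ax)).
apply: IH (dkf h) => x Ax.
by case: (diff_on oA fg Ax (df x Ax)) => _ ->.
Unshelve. all: by end_near. Qed.

Lemma CkW E F k (A : set E) (f : E -> F) : Ck k.+1 A f -> Ck k A f.
Proof.
elim: k f => [|k IH] f [df dkf] /=.
  by move=> x Ax; apply: differentiable_continuous; apply: df.
by split=> // h; apply: IH; apply: dkf.
Qed.

Lemma Ck_diff E F k (A : set E) (f : E -> F) x : Ck k.+1 A f -> A x -> differentiable f x.
Proof. by case=> d _ /d. Qed.

Lemma Ck_diff2 E F k (A : set E) (f : E -> F) x X : Ck k.+2 A f -> A x ->
  differentiable (fun y => 'd f y X) x.
Proof. by case=> _ /(_ X)/Ck_diff h /h. Qed.

Lemma Ck_sub E F k (A B : set E) (f : E -> F) : B `<=` A -> Ck k A f -> Ck k B f.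
Proof.
move=> BA; elim: k f => [|k IH] f /=; first by move=> cf x /BA; apply: cf.
by move=> [df dkf]; split=> [x /BA|h]; [apply: df|apply/IH/dkf].
Qed.

Lemma Ck_cst E F k (A : set E) (c : F) : Ck k A (fun=> c).
Proof.
elim: k c => [|k IH] c /=; first by move=> x _; apply: cst_continuous.
split=> [x _|h]; first exact: differentiable_cst.
have -> : (fun x : E => 'd (fun=> c) x h) = (fun=> 0).
  by apply/funext => x; rewrite (diff_cst c x).
exact: IH.
Qed.

Lemma Ck_add E F k (A : set E) (f g : E -> F) : open A ->
  Ck k A f -> Ck k A g -> Ck k A (fun x => f x + g x).
Proof.
move=> oA; elim: k f g => [|k IH] f g /=.
  by move=> cf cg x Ax; apply: (continuousD (cf x Ax) (cg x Ax)).
move=> [df dkf] [dg dkg]; split=> [x Ax|h].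
  exact: (differentiableD (df x Ax) (dg x Ax)).
apply: Ck_ext oA _ (IH _ _ (dkf h) (dkg h)) => x Ax.
by rewrite (diffD (df x Ax) (dg x Ax)).
Qed.

Lemma Ck_linc E F G k (A : set E) (L : {linear F -> G}) (f : E -> F) : open A ->
  continuous L -> Ck k A f -> Ck k A (fun x => L (f x)).
Proof.
move=> oA cL; elim: k f => [|k IH] f /=.
  by move=> cf x Ax; apply: continuous_comp; [apply: cf|apply: cL].
have H (x : E) : differentiable f x -> is_diff x (L \o f) (L \o 'd f x).
  by move=> /differentiableP fx; apply: is_diff_linc.
move=> [df dkf]; split=> [x Ax|h].
  by case: (H x (df x Ax)).
apply: Ck_ext oA _ (IH _ (dkf h)) => x Ax.
by case: (H x (df x Ax)) => _ ->.
Qed.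

Lemma Ck_pair E F G k (A : set E) (f : E -> F) (g : E -> G) : open A ->
  Ck k A f -> Ck k A g -> Ck k A (fun x => (f x, g x)).
Proof.
move=> oA; elim: k f g => [|k IH] f g /=.
  by move=> cf cg x Ax; apply: cvg_pair; [apply: cf|apply: cg].
move=> [df dkf] [dg dkg]; split=> [x Ax|h].
  exact: (differentiable_pair (df x Ax) (dg x Ax)).
apply: Ck_ext oA _ (IH _ _ (dkf h) (dkg h)) => x Ax.
by rewrite (diff_pair (df x Ax) (dg x Ax)).
Qed.

Lemma diff_mulE E (f g : E -> K^o) x h : differentiable f x -> differentiable g x ->
  'd (fun y => f y * g y : K^o) x h = f x * 'd g x h + 'd f x h * g x.
Proof. by move=> df dg; rewrite (diffM df dg) /= [_ * g x]mulrC. Qed.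

Lemma diff_invE E (f : E -> K^o) x h : differentiable f x -> f x != 0 ->
  'd (fun y => (f y)^-1 : K^o) x h = - ((f x)^-1 * (f x)^-1 * 'd f x h).
Proof. move=> df f0; rewrite (diffV df f0); rewrite -invfM -expr2 -mulNr; exact: erefl. Qed.

Lemma Ck_mulr E k (A : set E) (f g : E -> K^o) : open A ->
  Ck k A f -> Ck k A g -> Ck k A (fun x => f x * g x : K^o).
Proof.
move=> oA; elim: k f g => [|k IH] f g.
  by move=> cf cg x Ax; apply: (continuousM (cf x Ax) (cg x Ax)).
move=> Cf Cg; have [[df dkf] [dg dkg]] := (Cf, Cg); split=> [x Ax|h].
  exact: (differentiableM (df x Ax) (dg x Ax)).
apply: Ck_ext oA _ (Ck_add oA (IH _ _ (CkW Cf) (dkg h)) (IH _ _ (dkf h) (CkW Cg))).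
by move=> x Ax; rewrite diff_mulE; [|exact: df|exact: dg].
Qed.

Lemma Ck_invr E k (A : set E) (f : E -> K^o) : open A -> (forall x, A x -> f x != 0) ->
  Ck k A f -> Ck k A (fun x => (f x)^-1 : K^o).
Proof.
move=> oA f0; elim: k => [|k IH].
  by move=> cf x Ax; apply: (continuousV (f0 x Ax) (cf x Ax)).
move=> Cf; have [df dkf] := Cf; split=> [x Ax|h].
  exact: (differentiableV (df x Ax) (f0 x Ax)).
have Ci := IH (CkW Cf).
apply: Ck_ext oA _ (Ck_mulr oA (Ck_cst k A (-1 : K^o))
  (Ck_mulr oA (Ck_mulr oA Ci Ci) (dkf h))).
move=> x Ax; rewrite diff_invE ?mulN1r //; [exact: df|exact: f0].
Qed.

Lemma Ck_fclass E k (A : set E) : open A -> fclass A (@Ck K E K^o k A).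
Proof.
move=> oA; split.
- by move=> c; apply: Ck_cst.
- by move=> f g; apply: Ck_add.
- by move=> f g; apply: Ck_mulr.
- by move=> f Cf f0; apply: Ck_invr.
- by move=> f g fg; apply: Ck_ext.
Qed.

End Calculus.

(** * Calculus of matrix-valued functions *)

Section MatrixCalculus.
Context {K : numFieldType} {E : normedModType K}.

(** An entry of a matrix, as a linear function of the matrix. *)
Definition mxcoord m p (i : 'I_m) (j : 'I_p) (M : 'M[K]_(m, p)) : K^o := M i j.

Lemma mxcoord_is_linear m p (i : 'I_m) (j : 'I_p) : linear (@mxcoord m p i j).
Proof. by move=> k A B; rewrite /mxcoord !mxE. Qed.

HB.instance Definition _ m p i j :=
  GRing.isLinear.Build K 'M[K]_(m, p) K^o *:%R (@mxcoord m p i j)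
    (@mxcoord_is_linear m p i j).

Lemma differentiable_mx m p (F : E -> 'M[K]_(m, p)) x :
  (forall i j, differentiable (fun y => F y i j : K^o) x) -> differentiable F x.
Proof.
move=> dF.
have -> : F = \sum_(i < m) \sum_(j < p) (fun y => F y i j *: delta_mx i j).
  apply/funext => y; rewrite {1}[F y]matrix_sum_delta fct_sumE.
  by apply: eq_bigr => i _; rewrite fct_sumE.
apply: differentiable_sum => i; apply: differentiable_sum => j.
exact: differentiableZl (dF i j).
Qed.

Lemma diff_coord m p (F : E -> 'M[K]_(m, p)) x i j : differentiable F x ->
  differentiable (fun y => F y i j : K^o) x /\
  forall X, 'd (fun y => F y i j : K^o) x X = ('d F x X) i j.
Proof.
move=> /differentiableP dF.
have [d1 d2] := @is_diff_linc _ _ _ _ (@mxcoord m p i j) F _ x (@coord_continuous _ m p i j) dF.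
by split=> // X; move: (congr1 (@^~ X) d2).
Qed.

Lemma diff_mxP m p (F : E -> 'M[K]_(m, p)) (df : E -> 'M[K]_(m, p)) x :
  (forall i j, is_diff x (fun y => F y i j : K^o) (fun X => df X i j)) ->
  is_diff x F df.
Proof.
move=> h; have dF : differentiable F x.
  by apply: differentiable_mx => i j; case: (h i j).
apply: DiffDef => //; apply/funext => X; apply/matrixP => i j.
have [_ <-] := diff_coord i j dF.
by case: (h i j) => _ ->.
Qed.

Lemma Ck_mxP k (A : set E) m p (F : E -> 'M[K]_(m, p)) : open A ->
  Ck k A F <-> mclass (@Ck K E K^o k A) F.
Proof.
move=> oA; split=> [CF i j|].
  exact: (Ck_linc (L := @mxcoord m p i j) oA (@coord_continuous _ m p i j) CF).
elim: k F => [|k IH] F CF /=.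
  move=> x Ax.
  have -> : F = \sum_(i < m) \sum_(j < p) (fun y => F y i j *: delta_mx i j).
    apply/funext => y; rewrite {1}[F y]matrix_sum_delta fct_sumE.
    by apply: eq_bigr => i _; rewrite fct_sumE.
  elim/big_rec: _ => [|i f _ cf]; first exact: cst_continuous.
  apply: continuousD cf.
  elim/big_rec: _ => [|j g _ cg]; first exact: cst_continuous.
  apply: continuousD cg; apply: cvgZr_tmp; exact: (CF i j).
have dF x : A x -> differentiable F x.
  by move=> Ax; apply: differentiable_mx => i j; case: (CF i j) => d _; apply: d.
split=> // h; apply: IH => i j.
have [_ dk] := CF i j; apply: Ck_ext oA _ (dk h) => x Ax.
by have [_ ->] := diff_coord i j (dF x Ax).
Qed.

Lemma is_diff_sumE I (r : seq I) (P : pred I) (f df : I -> E -> K^o) x :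
  (forall i, is_diff x (f i) (df i)) ->
  is_diff x (fun y => \sum_(i <- r | P i) f i y : K^o)
            (fun X => \sum_(i <- r | P i) df i X).
Proof.
move=> h; have E1 g : (fun y : E => \sum_(i <- r | P i) g i y : K^o) =
    \sum_(i <- r | P i) (g i : E -> K^o) by apply/funext => y; rewrite fct_sumE.
rewrite !E1; elim/big_rec2: _ => [|k a b _ ab]; first exact: is_diff_cst.
exact: is_diffD (h k) ab.
Qed.

Lemma is_diff_mulE (f g df dg : E -> K^o) x : is_diff x f df -> is_diff x g dg ->
  is_diff x (fun y => f y * g y : K^o) (fun X => f x * dg X + df X * g x).
Proof.
move=> [df1 <-] [dg1 <-]; apply: DiffDef; first exact: differentiableM.
by apply/funext => X; rewrite diff_mulE.
Qed.

Lemma diff_mulmx m p q (F : E -> 'M[K]_(m, p)) (G : E -> 'M[K]_(p, q)) x :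
  differentiable F x -> differentiable G x ->
  is_diff x (fun y => F y *m G y) (fun X => 'd F x X *m G x + F x *m 'd G x X).
Proof.
move=> dF dG; apply: diff_mxP => i j.
have -> : (fun y => (F y *m G y) i j : K^o) = fun y => \sum_k F y i k * G y k j.
  by apply/funext => y; rewrite mxE.
have -> : (fun X => ('d F x X *m G x + F x *m 'd G x X) i j) =
    fun X => \sum_k (F x i k * ('d G x X) k j + ('d F x X) i k * G x k j).
  apply/funext => X; rewrite !mxE -big_split /=.
  by apply: eq_bigr => k _; rewrite addrC.
apply: is_diff_sumE => k.
have [d1 e1] := diff_coord i k dF; have [d2 e2] := diff_coord k j dG.
by apply: is_diff_mulE; apply: DiffDef => //; apply/funext.
Qed.

Lemma diff_trace m (F : E -> 'M[K]_m) x X : differentiable F x ->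
  'd (fun y => \tr (F y) : K^o) x X = \tr ('d F x X).
Proof.
move=> dF.
have H : is_diff x (fun y => \tr (F y) : K^o) (fun X => \tr ('d F x X)).
  apply: is_diff_sumE => k; have [d1 e1] := diff_coord k k dF.
  by apply: DiffDef => //; apply/funext.
by case: H => _ ->.
Qed.

Lemma differentiable_trace m (F : E -> 'M[K]_m) x : differentiable F x ->
  differentiable (fun y => \tr (F y) : K^o) x.
Proof.
move=> dF; have -> : (fun y => \tr (F y) : K^o) = \sum_i (fun y => F y i i : K^o).
  by apply/funext => y; rewrite fct_sumE.
by apply: differentiable_sum => i; case: (diff_coord i i dF).
Qed.

Lemma diff_invmx m (A : set E) (F : E -> 'M[K]_m) x : open A -> A x ->
  (forall y, A y -> F y \in unitmx) -> Ck 1 A F ->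
  is_diff x (fun y => invmx (F y))
    (fun X => - (invmx (F x) *m 'd F x X *m invmx (F x))).
Proof.
move=> oA Ax uF CF.
have CI : Ck 1 A (fun y => invmx (F y)).
  apply/(Ck_mxP _ _ oA); apply: (mc_inv (Ck_fclass 1 oA)) => //.
  exact/(Ck_mxP _ _ oA).
have [dF _] := CF; have [dI _] := CI.
apply: DiffDef; first exact: dI.
apply/funext => X.
have [_ e1] := diff_mulmx (dF x Ax) (dI x Ax).
have [_ e2] : differentiable (fun y => F y *m invmx (F y)) x /\
    'd (fun y => F y *m invmx (F y)) x = 'd (fun=> 1%:M) x :> (E -> 'M[K]_m).
  apply: (diff_on oA _ Ax) => [y Ay|]; first by rewrite mulmxV // uF.
  exact: differentiable_cst.
have e3 : 'd F x X *m invmx (F x) + F x *m 'd (fun y => invmx (F y)) x X = 0.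
  apply: (etrans (esym (congr1 (@^~ X) e1))); apply: (etrans (congr1 (@^~ X) e2)).
  exact: (congr1 (@^~ X) (diff_cst (1%:M : 'M[K]_m) x)).
move/eqP: e3; rewrite addrC addr_eq0 => /eqP/(congr1 (mulmx (invmx (F x)))) e4.
apply: (etrans (esym (mulKmx (uF x Ax) _))); apply: (etrans e4).
exact: (etrans (mulmxN _ _) (congr1 -%R (mulmxA _ _ _))).
Qed.

Lemma Ck_mulmx k (A : set E) m p q (F : E -> 'M[K]_(m, p)) (G : E -> 'M[K]_(p, q)) :
  open A -> Ck k A F -> Ck k A G -> Ck k A (fun y => F y *m G y).
Proof.
move=> oA /(Ck_mxP _ _ oA) CF /(Ck_mxP _ _ oA) CG; apply/(Ck_mxP _ _ oA).
exact: (mc_mul (Ck_fclass k oA)).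
Qed.

Lemma Ck_invmx k (A : set E) m (F : E -> 'M[K]_m) :
  open A -> (forall y, A y -> F y \in unitmx) -> Ck k A F ->
  Ck k A (fun y => invmx (F y)).
Proof.
move=> oA uF /(Ck_mxP _ _ oA) CF; apply/(Ck_mxP _ _ oA).
exact: (mc_inv (Ck_fclass k oA)).
Qed.

End MatrixCalculus.

Section SymmetricSecondDerivative.
Context {K : numFieldType} {E : normedModType K}.

(** Twice continuously differentiable functions whose second derivative is symmetric.
    Rational functions have this property by pure algebra, over any field [K]. *)
Definition symC2 (A : set E) (f : E -> K^o) :=
  Ck 2 A f /\ forall x X Y, A x ->
    'd (fun y => 'd f y X : K^o) x Y = 'd (fun y => 'd f y Y : K^o) x X.

Lemma symC2_fclass (A : set E) : open A -> fclass A (symC2 A).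
Proof.
move=> oA; have C2 := Ck_fclass 2 oA.
have dE (f g : E -> K^o) x X : (forall y, A y -> f y = g y) -> A x ->
    differentiable f x -> 'd g x X = 'd f x X.
  by move=> fg Ax df; case: (diff_on oA fg Ax df) => _ ->.
split.
- move=> k; split=> [|x X Y Ax]; first exact: (fc_cst C2 k).
  have H Z : (fun y : E => 'd (fun=> k : K^o) y Z : K^o) = (fun=> 0).
    by apply/funext => y; rewrite (diff_cst (k : K^o) y).
  by rewrite !H !(diff_cst (0 : K^o) x).
- move=> f g [Cf sf] [Cg sg]; split=> [|x X Y Ax]; first exact: (fc_add C2 Cf Cg).
  have [[df _] [dg _]] := (Cf, Cg).
  have df2 Z := Ck_diff2 Z Cf Ax; have dg2 Z := Ck_diff2 Z Cg Ax.
  have H Z W : 'd (fun y => 'd (fun y => f y + g y : K^o) y Z : K^o) x W =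
      'd (fun y => 'd f y Z : K^o) x W + 'd (fun y => 'd g y Z : K^o) x W.
    apply: (etrans (dE (fun y => 'd f y Z + 'd g y Z) _ x W _ Ax _)).
    + by move=> y Ay; exact: (esym (congr1 (@^~ Z) (diffD (df y Ay) (dg y Ay)))).
    + exact: (differentiableD (df2 Z) (dg2 Z)).
    + exact: (congr1 (@^~ W) (diffD (df2 Z) (dg2 Z))).
  apply: (etrans (H X Y)); apply: (etrans _ (esym (H Y X))).
  exact: (congr2 +%R (sf x X Y Ax) (sg x X Y Ax)).
- move=> f g [Cf sf] [Cg sg]; split=> [|x X Y Ax]; first exact: (fc_mul C2 Cf Cg).
  have [[df _] [dg _]] := (Cf, Cg).
  have df2 Z := Ck_diff2 Z Cf Ax; have dg2 Z := Ck_diff2 Z Cg Ax.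
  have dfx := df x Ax; have dgx := dg x Ax.
  have H Z W : 'd (fun y => 'd (fun y => f y * g y : K^o) y Z : K^o) x W =
      (f x * 'd (fun y => 'd g y Z : K^o) x W + 'd f x W * 'd g x Z) +
      ('d f x Z * 'd g x W + 'd (fun y => 'd f y Z : K^o) x W * g x).
    have d1 := differentiableM dfx (dg2 Z); have d2 := differentiableM (df2 Z) dgx.
    apply: (etrans (dE (fun y => f y * 'd g y Z + 'd f y Z * g y) _ x W _ Ax _)).
    + by move=> y Ay; exact: (esym (diff_mulE Z (df y Ay) (dg y Ay))).
    + exact: (differentiableD d1 d2).
    + apply: (etrans (congr1 (@^~ W) (diffD d1 d2))).
      exact: (congr2 +%R (diff_mulE W dfx (dg2 Z)) (diff_mulE W (df2 Z) dgx)).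
  apply: (etrans (H X Y)); apply: (etrans _ (esym (H Y X))).
  have alg (a b s s' t t' p q : K) : s = s' -> t = t' ->
      (a * s + p) + (q + t * b) = (a * s' + q) + (p + t' * b).
    by move=> -> ->; ring.
  exact: (alg _ _ _ _ _ _ _ _ (sg x X Y Ax) (sf x X Y Ax)).
- move=> f [Cf sf] f0; split=> [|x X Y Ax]; first exact: (fc_inv C2 Cf f0).
  have [df dkf] := Cf; have [di _] : Ck 2 A (fun y => (f y)^-1 : K^o) by exact: (fc_inv C2 Cf f0).
  have df2 Z := Ck_diff2 Z Cf Ax.
  have dix := di x Ax; have d0 := differentiableM dix dix.
  pose i : K := (f x)^-1.
  have H Z W : 'd (fun y => 'd (fun y => (f y)^-1 : K^o) y Z : K^o) x W =
      - (i * i * 'd (fun y => 'd f y Z : K^o) x W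
         - (i * i * i * 'd f x W * 'd f x Z) *+ 2).
    have d1 := differentiableM d0 (df2 Z).
    apply: (etrans (dE (fun y => - ((f y)^-1 * (f y)^-1 * 'd f y Z)) _ x W _ Ax _)).
    + by move=> y Ay; exact: (esym (diff_invE Z (df y Ay) (f0 y Ay))).
    + exact: (differentiableN d1).
    + have Ei := diff_invE W (df x Ax) (f0 x Ax).
      have E1 := etrans (diff_mulE W dix dix)
        (congr2 +%R (congr1 (fun z => i * z) Ei) (congr1 (fun z => z * i) Ei)).
      have E2 := etrans (diff_mulE W d0 (df2 Z))
        (congr1 (fun z => i * i * _ + z * _) E1).
      apply: (etrans (congr1 (@^~ W) (diffN d1))); apply: (etrans (congr1 -%R E2)).
      have alg (k p q r : K) : - (k * k * r + (k * - (k * k * p) + - (k * k * p) * k) * q) =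
          - (k * k * r - (k * k * k * p * q) *+ 2) by ring.
      exact: alg.
  apply: (etrans (H X Y)); apply: (etrans _ (esym (H Y X))).
  have alg (s s' p q : K) : s = s' -> - (i * i * s - (i * i * i * p * q) *+ 2) =
      - (i * i * s' - (i * i * i * q * p) *+ 2).
    by move=> ->; rewrite -!mulrA [p * q]mulrC.
  exact: (alg _ _ _ _ (sf x X Y Ax)).
- move=> f g fg [Cf sf]; split=> [|x X Y Ax]; first exact: (fc_ext C2 fg Cf).
  have [df dkf] := Cf.
  have df2 Z := Ck_diff2 Z Cf Ax.
  have H Z W : 'd (fun y => 'd g y Z : K^o) x W = 'd (fun y => 'd f y Z : K^o) x W.
    apply: (dE _ _ x W _ Ax (df2 Z)) => y Ay.
    by apply/esym; apply: (dE _ _ y Z fg Ay (df y Ay)).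
  exact: (etrans (H X Y) (etrans (sf x X Y Ax) (esym (H Y X)))).
Qed.

Lemma symC2_mx (A : set E) m p (F : E -> 'M[K]_(m, p)) : open A ->
  mclass (symC2 A) F -> Ck 2 A F /\ forall x X Y, A x ->
    'd (fun y => 'd F y X) x Y = 'd (fun y => 'd F y Y) x X.
Proof.
move=> oA CF; have C2 : Ck 2 A F by apply/(Ck_mxP _ _ oA) => i j; case: (CF i j).
split=> // x X Y Ax; apply/matrixP => i j.
have [dF dkF] := C2.
have d2 Z := Ck_diff2 Z C2 Ax.
have H Z W : ('d (fun y => 'd F y Z) x W) i j =
    'd (fun y => 'd (fun y => F y i j : K^o) y Z : K^o) x W.
  have [_ <-] := diff_coord i j (d2 Z).
  have [] // := @diff_on _ _ _ A (fun y => 'd (fun y => F y i j : K^o) y Z : K^o)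
     (fun y => ('d F y Z) i j : K^o) x oA _ Ax.
  - by move=> y Ay; have [_ ->] := diff_coord i j (dF y Ay).
  - exact: Ck_diff2 Z (CF i j).1 Ax.
  by move=> _ ->.
by rewrite !H; apply: (CF i j).2.
Qed.

End SymmetricSecondDerivative.

(** * Smoothness of the factorizations *)

Section LinearFunctions.
Context {K : numFieldType} {E : normedModType K}.

Lemma is_diff_linear (F : normedModType K) (f : E -> F) x : linear f -> continuous f ->
  is_diff x f f.
Proof.
move=> lf cf; pose fM := GRing.isLinear.Build _ _ _ _ _ lf.
pose fL : {linear E -> F} := HB.pack f fM.
exact: (@is_diff_lin _ _ _ fL x cf).
Qed.

Lemma Ck_linear k (F : normedModType K) (A : set E) (f : E -> F) : linear f -> continuous f -> Ck k A f.
Proof.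
move=> lf cf; have H x := is_diff_linear x lf cf.
case: k => [|k]; first by move=> x _; apply: cf.
split=> [x _|h]; first by case: (H x).
have -> : (fun x => 'd f x h) = fun=> f h.
  by apply/funext => x; case: (H x) => _ ->.
exact: Ck_cst.
Qed.

Lemma symC2_linear (A : set E) (f : E -> K^o) : linear f -> continuous f -> symC2 A f.
Proof.
move=> lf cf; split=> [|x X Y _]; first exact: Ck_linear.
have H Z : (fun y => 'd f y Z : K^o) = fun=> f Z.
  by apply/funext => y; case: (is_diff_linear y lf cf) => _ ->.
by rewrite !H !diff_cst.
Qed.

Lemma open_neq0 (A : set E) (f : E -> K^o) : open A -> Ck 0 A f ->
  open [set x | A x /\ f x != 0].
Proof.
move=> oA cf; rewrite openE => x [Ax fx].
have nA : nbhs x A by apply: open_nbhs_nbhs.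
have nf : nbhs x [set y | f y != 0].
  exact: (cvgr_neq0 (f x) (cf x Ax) fx).
by apply: filterS2 nA nf => y.
Qed.

Lemma open_unitmx (A : set E) m (F : E -> 'M[K]_m) : open A -> Ck 0 A F ->
  open [set x | A x /\ F x \in unitmx].
Proof.
move=> oA /(Ck_mxP _ _ oA) CF.
have := open_neq0 oA (mc_det (Ck_fclass 0 oA) CF).
congr open; apply/funext => x; apply/propext.
by rewrite /= unitmxE unitfE.
Qed.

Lemma open_LUable (A : set E) m (F : E -> 'M[K]_m) : open A -> Ck 0 A F ->
  open [set x | A x /\ LUable (F x)].
Proof.
move=> oA /(Ck_mxP _ _ oA) CF; have C0 := Ck_fclass 0 oA.
have CP : Ck 0 A (fun x => \det (F x) * \prod_(j < m) \det (lead j (F x)) : K^o).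
  apply: (fc_mul C0); first exact: (mc_det C0).
  by apply: (fc_prod C0) => j; apply: (mc_det C0); apply: (mc_lead C0).
have := open_neq0 oA CP; congr open; apply/funext => x; apply/propext => /=.
rewrite /LUable unitmxE unitfE mulf_eq0 negb_or; split.
  move=> [Ax /andP[-> /prodf_neq0 h]]; split=> //; split=> // j.
  by rewrite unitmxE unitfE h.
move=> [Ax [-> h]]; split=> //=; apply/prodf_neq0 => j _.
by move: (h j); rewrite unitmxE unitfE.
Qed.

(** Entries which are constant on an open set have vanishing derivative. *)
Lemma diff_entry_cst (A : set E) m p (F : E -> 'M[K]_(m, p)) x X i j c :
  open A -> A x -> differentiable F x -> (forall y, A y -> F y i j = c) ->
  ('d F x X) i j = 0.
Proof.
move=> oA Ax dF h; have [_ <-] := diff_coord i j dF.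
have [] := @diff_on _ _ _ A (fun=> c : K^o) (fun y => F y i j) x oA _ Ax.
- by move=> y /h.
- exact: differentiable_cst.
by move=> _ ->; rewrite diff_cst.
Qed.

Lemma is_diff_prodE (I : Type) (r : seq I) (P : pred I) (f df : I -> E -> K^o) x :
  (forall i, is_diff x (f i) (df i)) -> (forall i, f i x != 0) ->
  is_diff x (fun y => \prod_(i <- r | P i) f i y : K^o)
    (fun X => (\prod_(i <- r | P i) f i x) * \sum_(i <- r | P i) (df i X / f i x)).
Proof.
move=> df0 f0; elim: r => [|i r IH].
  have -> : (fun y => \prod_(i <- [::] | P i) f i y : K^o) = fun=> 1.
    by apply/funext => y; rewrite big_nil.
  have -> : (fun X => (\prod_(i <- [::] | P i) f i x) *
      \sum_(i <- [::] | P i) (df i X / f i x)) = fun=> 0.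
    by apply/funext => y; rewrite !big_nil mulr0.
  exact: is_diff_cst.
case Pi: (P i); last first.
  have -> : (fun y => \prod_(i <- i :: r | P i) f i y : K^o) =
      (fun y => \prod_(i <- r | P i) f i y : K^o).
    by apply/funext => y; rewrite big_cons Pi.
  have -> // : (fun X => (\prod_(i <- i :: r | P i) f i x) *
      \sum_(i <- i :: r | P i) (df i X / f i x)) =
      (fun X => (\prod_(i <- r | P i) f i x) * \sum_(i <- r | P i) (df i X / f i x)).
  by apply/funext => X; rewrite !big_cons Pi.
have -> : (fun y => \prod_(i <- i :: r | P i) f i y : K^o) =
    (fun y => f i y * \prod_(i <- r | P i) f i y : K^o).
  by apply/funext => y; rewrite big_cons Pi.
have [d1 d2] := is_diff_mulE (df0 i) IH; apply: DiffDef => //.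
apply: (etrans d2); apply/funext => X; rewrite !big_cons Pi.
have alg (a p s d : K) : a != 0 -> a * (p * s) + d * p = a * p * (d / a + s).
  by move=> a0; field.
exact: (alg _ _ _ _ (f0 i)).
Qed.

End LinearFunctions.

Section Coordinates.
Context {K : numFieldType} {n : nat}.
Local Notation M := 'M[K]_n.+1.

Lemma Ck_id k (A : set M) : Ck k A (fun a => a).
Proof. by apply: Ck_linear => // x; apply: cvg_id. Qed.
Lemma Ck_fst k (A : set (M * M)) : Ck k A (fun v => v.1).
Proof. by apply: Ck_linear => // x; apply: cvg_fst. Qed.
Lemma Ck_snd k (A : set (M * M)) : Ck k A (fun v => v.2).
Proof. by apply: Ck_linear => // x; apply: cvg_snd. Qed.
Lemma symC2_fst (A : set (M * M)) : mclass (symC2 A) (fun v : M * M => v.1).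
Proof.
move=> i j; apply: symC2_linear => [k u v|v]; first by rewrite /= !mxE.
by apply: (continuous_comp (f := fst) (g := fun a : M => a i j));
  [apply: cvg_fst|apply: coord_continuous].
Qed.
Lemma symC2_snd (A : set (M * M)) : mclass (symC2 A) (fun v : M * M => v.2).
Proof.
move=> i j; apply: symC2_linear => [k u v|v]; first by rewrite /= !mxE.
by apply: (continuous_comp (f := snd) (g := fun a : M => a i j));
  [apply: cvg_snd|apply: coord_continuous].
Qed.

Lemma open_GLstar : open (@GLstar K n).
Proof.
have o1 : open [set a : M | setT a /\ LUable a].
  exact: (open_LUable openT (Ck_id 0 setT)).
have CI : Ck 0 [set a : M | setT a /\ LUable a] (fun a => invmx a).
  by apply: (Ck_invmx o1) => [a [_ [ua _]]//|]; apply: Ck_id.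
have := open_LUable o1 CI; congr open; apply/funext => a; apply/propext => /=.
by rewrite GLstarE; split=> [[[]]|[]].
Qed.

(** The open set of pairs for which the factorization defining [b_plus], [b_minus] and
    [delta] exists. *)
Definition bdom : set (M * M) := [set v | v.2 \in unitmx /\ LUable (wof v)].

Lemma open_bdom : open bdom.
Proof.
have o1 : open [set v : M * M | setT v /\ v.2 \in unitmx].
  exact: (open_unitmx openT (Ck_snd 0 setT)).
have CI : Ck 0 [set v : M * M | setT v /\ v.2 \in unitmx] (fun v => wof v).
  apply: (Ck_mulmx o1); last exact: Ck_fst.
  by apply: (Ck_invmx o1) => [v []//|]; apply: Ck_snd.
have := open_LUable o1 CI; congr open; apply/funext => a; apply/propext => /=.
by split=> [[[]]|[]].
Qed.

Lemma Vstar_bdom v : Vstar v -> bdom v.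
Proof. by move=> h; split; [case: h => _ [[]] | apply: Vstar_LU]. Qed.

End Coordinates.

Section FactorClass.
Context {K : numFieldType} {n : nat}.
Local Notation M := 'M[K]_n.+1.
Context {T : Type} {D : set T} {C : (T -> K) -> Prop}.
Hypothesis CP : fclass D C.

Section OnGroup.
Variable F : T -> M.
Hypotheses (CF : mclass C F) (gF : forall t, D t -> GLstar (F t)).

Lemma mc_v_plus : mclass C (fun t => v_plus (F t)).
Proof.
apply: (mc_ext CP (F := fun t => vp_of (F t))) => [t Dt|]; first by rewrite (v_plus_of (gF Dt)).
have uF t : D t -> F t \in unitmx by move=> /gF/GLstar_unit.
have CI := mc_inv CP CF uF.
have lF t : D t -> forall j : 'I_n.+1, lead j (invmx (F t)) \in unitmx.
  by move=> /gF/GLstarE[_ []].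
apply: (mc_inv CP) => [|t Dt]; first exact: (mc_elim CP).
exact/elim_unit/lF.
Qed.

Lemma mc_a_plus : mclass C (fun t => a_plus (F t)).
Proof.
apply: (mc_ext CP (F := fun t => F t *m v_plus (F t))) => [t Dt|].
  by rewrite (a_plus_of (gF Dt)).
by apply: (mc_mul CP) => //; apply: mc_v_plus.
Qed.

Lemma mc_v_minus : mclass C (fun t => v_minus (F t)).
Proof.
apply: (mc_ext CP (F := fun t => vm_of (F t))) => [t Dt|]; first by rewrite (v_minus_of (gF Dt)).
have lF t : D t -> forall j : 'I_n.+1, lead j (F t) \in unitmx.
  by move=> /gF/GLstarE[[]].
have CU : mclass C (fun t => elim (F t) *m F t).
  by apply: (mc_mul CP) => //; apply: (mc_elim CP).
apply: (mc_mul CP); last exact: (mc_dg CP).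
apply: (mc_inv CP) => // t Dt; rewrite unitmx_mul elim_unit; last exact: lF.
exact/GLstar_unit/gF.
Qed.

Lemma mc_a_minus : mclass C (fun t => a_minus (F t)).
Proof.
apply: (mc_ext CP (F := fun t => F t *m v_minus (F t))) => [t Dt|].
  by rewrite (a_minus_of (gF Dt)).
by apply: (mc_mul CP) => //; apply: mc_v_minus.
Qed.

End OnGroup.

Section OnParameters.
Variable F : T -> M * M.
Hypotheses (CF1 : mclass C (fun t => (F t).1)) (CF2 : mclass C (fun t => (F t).2)).
Hypothesis gF : forall t, D t -> bdom (F t).

Lemma mc_wof : mclass C (fun t => wof (F t)).
Proof.
by apply: (mc_mul CP) => //; apply: (mc_inv CP) => // t /gF[].
Qed.

Lemma mc_b_minus : mclass C (fun t => b_minus (F t)).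
Proof.
apply: (mc_ext CP (F := fun t => elim (wof (F t)))) => [t /gF[_ /b_of[_ ->]]//|].
by apply: (mc_elim CP) => [|t /gF[_ []]//]; apply: mc_wof.
Qed.

Lemma mc_uof : mclass C (fun t => uof (F t)).
Proof.
apply: (mc_mul CP); last exact: mc_wof.
by apply: (mc_elim CP) => [|t /gF[_ []]//]; apply: mc_wof.
Qed.

Lemma mc_delta : mclass C (fun t => delta (F t)).
Proof.
apply: (mc_ext CP (F := fun t => dgmx (uof (F t)))) => [t /gF[_ /b_of[_ _ ->]]//|].
by apply: (mc_dg CP); apply: mc_uof.
Qed.

Lemma delta_bdom (v : M * M) : bdom v -> delta v \in unitmx /\ isdg (delta v).
Proof.
move=> [u2 /[dup] -[uw _] /b_factorsP[/= [[up _] _] [[um _] _] /is_diag_mxP hd E]].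
split; last by move=> i j; rewrite -val_eqE; apply: hd.
by move: uw; rewrite /wof E !unitmx_mul => /andP[/andP[]].
Qed.

Lemma mc_b_plus : mclass C (fun t => b_plus (F t)).
Proof.
apply: (mc_ext CP (F := fun t => invmx (delta (F t)) *m uof (F t))).
  by move=> t /gF[_ /b_of[-> _ ->]].
apply: (mc_mul CP); last exact: mc_uof.
by apply: (mc_inv CP) => [|t /gF/delta_bdom[]//]; apply: mc_delta.
Qed.

End OnParameters.
End FactorClass.

(** * Principal minors *)

Section Minors.
Context {K : numFieldType} {n : nat}.
Local Notation M := 'M[K]_n.+1.
Implicit Types a x y l u : M.

(** The square block of size [s] whose first row and column have index [o]. *)
Definition block (o s : nat) a : 'M[K]_s :=
  \matrix_(k, m) a (inord (o + k)) (inord (o + m)).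

Lemma big_block (R : Type) (x : R) (op : Monoid.com_law x) (o s : nat) (f : 'I_n.+1 -> R) :
  (o + s <= n.+1)%N ->
  \big[op/x]_(i < n.+1 | (o <= i < o + s)%N) f i = \big[op/x]_(i < s) f (inord (o + i)).
Proof.
move=> os; have -> : \big[op/x]_(i < n.+1 | (o <= i < o + s)%N) f i =
    \big[op/x]_(0 <= i < n.+1 | (o <= i < o + s)%N) f (inord i).
  by rewrite big_mkord; apply: eq_bigr => i _; rewrite inord_val.
rewrite (big_cat_nat (n := o)) //=; last by apply: leq_trans os; apply: leq_addr.
rewrite (big_cat_nat (n := o + s) (m := o)) //=; last exact: leq_addr.
rewrite big_nat_cond big_pred0 ?Monoid.mul1m => [|i]; last by lia.
rewrite Monoid.mulmC big_nat_cond big_pred0 ?Monoid.mul1m => [|i]; last by lia.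
rewrite -{1}(add0n o) big_addn addKn big_nat_cond.
rewrite -[RHS](big_mkord xpredT (fun i => f (inord (o + i)))) [RHS]big_nat_cond.
by apply: eq_big => [i|i _]; [lia|rewrite addnC].
Qed.

Lemma sum_block (o s : nat) (f : 'I_n.+1 -> K) : (o + s <= n.+1)%N ->
  (forall i : 'I_n.+1, ~~ (o <= i < o + s)%N -> f i = 0) ->
  \sum_i f i = \sum_(i < s) f (inord (o + i)).
Proof.
move=> os f0; rewrite -big_block // [RHS]big_mkcond.
by apply: eq_bigr => i _; case: ifPn => // /f0.
Qed.

Lemma block_mul o s x y : (o + s <= n.+1)%N ->
  (forall k m i : 'I_n.+1, (o <= k < o + s)%N -> (o <= m < o + s)%N ->
     ~~ (o <= i < o + s)%N -> x k i * y i m = 0) ->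
  block o s (x *m y) = block o s x *m block o s y.
Proof.
move=> os h; apply/matrixP => k m; rewrite !mxE (sum_block os) => [|i ni].
  by apply: eq_bigr => i _; rewrite !mxE.
by apply: h => //; rewrite inordK; have := ltn_ord k; have := ltn_ord m; lia.
Qed.

Lemma block_low o s l : (o + s <= n.+1)%N -> islow l -> islow (block o s l).
Proof.
move=> os h k m km; rewrite mxE; apply: h.
by rewrite !inordK; have := ltn_ord k; have := ltn_ord m; lia.
Qed.
Lemma block_up o s u : (o + s <= n.+1)%N -> isup u -> isup (block o s u).
Proof.
move=> os h k m km; rewrite mxE; apply: h.
by rewrite !inordK; have := ltn_ord k; have := ltn_ord m; lia.
Qed.

Lemma dplus_mul l u j : islow l -> isup u -> (j <= n.+1)%N ->
  dplus j (l *m u) = \prod_(k < n.+1 | (k < j)%N) (l k k * u k k).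
Proof.
move=> hl hu jn; rewrite -[dplus _ _]/(\det (block 0 j (l *m u))).
rewrite block_mul // => [|k m i kj mj ij].
  rewrite det_mulmx det_low ?det_up -?big_split /=; [|exact: block_up|exact: block_low].
  rewrite (@big_block K 1 *%R 0 j) //.
  by apply: eq_bigr => k _; rewrite !mxE.
by rewrite hl ?mul0r //; lia.
Qed.

Lemma dminus_mul u l (j : 'I_n.+1) : islow l -> isup u ->
  dminus j.+2 (u *m l) = \prod_(k < n.+1 | (j < k)%N) (u k k * l k k).
Proof.
move=> hl hu; rewrite -[dminus _ _]/(\det (block j.+1 (n - j) (u *m l))).
have jn : (j.+1 + (n - j) <= n.+1)%N by have := ltn_ord j; lia.
rewrite block_mul // => [|k m i kj mj ij].
  rewrite det_mulmx (det_up (block_up jn hu)) (det_low (block_low jn hl)) -big_split /=.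
  rewrite (eq_bigl (fun k : 'I_n.+1 => (j.+1 <= k < j.+1 + (n - j))%N)); last first.
    by move=> k; have := ltn_ord k; have := ltn_ord j; lia.
  by rewrite (@big_block K 1 *%R j.+1 (n - j)) //; apply: eq_bigr => k _; rewrite !mxE.
by rewrite hu ?mul0r //; have := ltn_ord i; lia.
Qed.

(** Partial products of the diagonals of the two triangular factors. *)
Definition Pminus (j : nat) a : K := \prod_(k < n.+1 | (k < j)%N) a_minus a k k.
Definition Qplus (j : nat) a : K := \prod_(k < n.+1 | (j <= k)%N) a_plus a k k.

Lemma a_minus_diag_neq0 a k : GLstar a -> a_minus a k k != 0.
Proof. by move=> /minus_factorsP[/= [u h] _ _]; apply: low_diag_neq0. Qed.
Lemma a_plus_diag_neq0 a k : GLstar a -> a_plus a k k != 0.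
Proof. by move=> /plus_factorsP[/= [u h] _ _]; apply: up_diag_neq0. Qed.

Lemma Pminus_neq0 j a : GLstar a -> Pminus j a != 0.
Proof. by move=> ga; apply/prodf_neq0 => k _; apply: a_minus_diag_neq0. Qed.
Lemma Qplus_neq0 j a : GLstar a -> Qplus j a != 0.
Proof. by move=> ga; apply/prodf_neq0 => k _; apply: a_plus_diag_neq0. Qed.

Lemma dplusE a j : GLstar a -> (j <= n.+1)%N -> dplus j a = Pminus j a.
Proof.
move=> /minus_factorsP[/= [um hm] [[uv hv] dv] E] jn.
rewrite {1}E dplus_mul //; last exact: isup_inv.
by apply: eq_bigr => k _; rewrite up_inv_diag // dv invr1 mulr1.
Qed.
Lemma dminusE a (j : 'I_n.+1) : GLstar a -> dminus j.+2 a = Qplus j.+1 a.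
Proof.
move=> /plus_factorsP[/= [um hm] [[uv hv] dv] E].
rewrite {1}E dminus_mul //; last exact: islow_inv.
by apply: eq_bigr => k _; rewrite low_inv_diag // dv invr1 mulr1.
Qed.

Lemma phiE a (j : 'I_n.+1) : GLstar a -> phi j a = Pminus j.+1 a / Qplus j.+1 a.
Proof. by move=> ga; rewrite /phi dplusE // dminusE. Qed.

Lemma phi_neq0 a (j : 'I_n.+1) : GLstar a -> phi j a != 0.
Proof. by move=> ga; rewrite phiE // mulf_neq0 ?invr_eq0 ?Pminus_neq0 ?Qplus_neq0. Qed.

Lemma smooth_phi (j : 'I_n.+1) : smooth (@GLstar K n) (phi j).
Proof.
move=> k; have oG := @open_GLstar K n; have CP := Ck_fclass k oG.
have CI : mclass (@Ck K M K^o k GLstar) (fun a => a) by apply/(Ck_mxP _ _ oG)/Ck_id.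
have Cb o s : mclass (@Ck K M K^o k GLstar) (fun a => block o s a).
  by move=> i m; apply: (fc_ext CP) (CI (inord (o + i)) (inord (o + m))) => a _; rewrite mxE.
apply: (fc_div CP (f := dplus j.+1) (g := dminus j.+2)).
- exact: (mc_det CP (Cb 0 j.+1)).
- exact: (mc_det CP (Cb j.+1 (n - j)%N)).
- by move=> a ga; rewrite dminusE // Qplus_neq0.
Qed.

Lemma Pminus0 a : Pminus 0 a = 1.
Proof. by rewrite /Pminus big_pred0. Qed.
Lemma PminusS a (j : 'I_n.+1) : Pminus j.+1 a = Pminus j a * a_minus a j j.
Proof.
rewrite /Pminus (bigD1 j) //= mulrC; congr (_ * _).
by apply: eq_bigl => k; rewrite -val_eqE /=; lia.
Qed.
Lemma Qplus_end a : Qplus n.+1 a = 1.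
Proof. by rewrite /Qplus big_pred0 // => k; have := ltn_ord k; lia. Qed.
Lemma QplusS a (j : 'I_n.+1) : Qplus j a = a_plus a j j * Qplus j.+1 a.
Proof.
rewrite /Qplus (bigD1 j) //=; congr (_ * _).
by apply: eq_bigl => k; rewrite -val_eqE /=; lia.
Qed.

Lemma Pminus_det a : GLstar a -> Pminus n.+1 a = \det a.
Proof.
move=> /minus_factorsP[/= [um hm] [[uv hv] dv] E].
rewrite {2}E det_mulmx det_inv (det_low hm) (det_up hv).
rewrite [X in _ / X]big1 ?invr1 ?mulr1 => [|k _]; last exact: dv.
by apply: eq_bigl => k; rewrite ltn_ord.
Qed.
Lemma Qplus_det a : GLstar a -> Qplus 0 a = \det a.
Proof.
move=> /plus_factorsP[/= [um hm] [[uv hv] dv] E].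
rewrite {2}E det_mulmx det_inv (det_low hv) (det_up hm).
by rewrite [X in _ / X]big1 ?invr1 ?mulr1 => [|k _]; last exact: dv.
Qed.

(** The values of the quotients [Pminus j / Qplus j], for [0 <= j <= n.+1], on the leaf
    of [c]; the first one is the inverse of the determinant, hence of the last value. *)
Definition leafq (c : 'I_n.+1 -> K) (j : nat) : K :=
  if j is j'.+1 then c (inord j') else (c ord_max)^-1.

Lemma leaf_quot c a (j : nat) : leaf c a -> (j <= n.+1)%N ->
  Pminus j a / Qplus j a = leafq c j.
Proof.
move=> [ga ha]; case: j => [_|j jn] /=.
  by rewrite Pminus0 -(ha ord_max) phiE //= Pminus_det // Qplus_det // Qplus_end divr1 div1r.
by rewrite -(ha (inord j)) phiE // inordK.
Qed.

(** On a leaf, the products of the diagonal entries of the two factors are fixed. *)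
Lemma leaf_diag c a k : leaf c a ->
  a_minus a k k * a_plus a k k = leafq c k.+1 / leafq c k.
Proof.
move=> la; have ga := la.1; have kn := ltn_ord k.
rewrite -(leaf_quot la kn) -(leaf_quot la (ltnW kn)) PminusS QplusS.
have h1 := Pminus_neq0 k ga; have h2 := Qplus_neq0 k.+1 ga.
have h3 := a_plus_diag_neq0 k ga.
by field; rewrite h1 h2 h3.
Qed.

End Minors.

(** * Differentials of the factors and of the foliation functions *)

Section Infinitesimal.
Context {K : numFieldType} {n : nat}.
Local Notation M := 'M[K]_n.+1.
Implicit Types a X Y : M.

Let oG := @open_GLstar K n.

Lemma Ck_factors k (E : normedModType K) (A : set E) (F : E -> M) : open A -> Ck k A F ->
  (forall x, A x -> GLstar (F x)) ->
  [/\ Ck k A (fun x => v_plus (F x)), Ck k A (fun x => a_plus (F x)),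
      Ck k A (fun x => v_minus (F x)) & Ck k A (fun x => a_minus (F x))].
Proof.
move=> oA /(Ck_mxP _ _ oA) CF gF; have CP := Ck_fclass k oA.
by split; apply/(Ck_mxP _ _ oA); [apply: (mc_v_plus CP)|apply: (mc_a_plus CP)|
  apply: (mc_v_minus CP)|apply: (mc_a_minus CP)].
Qed.

Lemma Ck_v_plus k : Ck k GLstar (@v_plus K n).
Proof. by case: (Ck_factors oG (Ck_id k _)). Qed.
Lemma Ck_a_plus k : Ck k GLstar (@a_plus K n).
Proof. by case: (Ck_factors oG (Ck_id k _)). Qed.
Lemma Ck_v_minus k : Ck k GLstar (@v_minus K n).
Proof. by case: (Ck_factors oG (Ck_id k _)). Qed.
Lemma Ck_a_minus k : Ck k GLstar (@a_minus K n).
Proof. by case: (Ck_factors oG (Ck_id k _)). Qed.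

Lemma smooth_param : smooth (@GLstar K n) param.
Proof. by move=> k; apply: (Ck_pair oG); [apply: Ck_v_plus|apply: Ck_v_minus]. Qed.

Lemma dv_plus a : GLstar a -> differentiable (@v_plus K n) a.
Proof. exact: Ck_diff (Ck_v_plus 1). Qed.
Lemma da_plus a : GLstar a -> differentiable (@a_plus K n) a.
Proof. exact: Ck_diff (Ck_a_plus 1). Qed.
Lemma dv_minus a : GLstar a -> differentiable (@v_minus K n) a.
Proof. exact: Ck_diff (Ck_v_minus 1). Qed.
Lemma da_minus a : GLstar a -> differentiable (@a_minus K n) a.
Proof. exact: Ck_diff (Ck_a_minus 1). Qed.

Lemma a_plus_unit a : GLstar a -> a_plus a \in unitmx.
Proof. by move=> /plus_factorsP[/= []]. Qed.
Lemma a_minus_unit a : GLstar a -> a_minus a \in unitmx.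
Proof. by move=> /minus_factorsP[/= []]. Qed.
Lemma v_plus_unit a : GLstar a -> v_plus a \in unitmx.
Proof. by move=> /plus_factorsP[/= _ [[]]]. Qed.
Lemma v_minus_unit a : GLstar a -> v_minus a \in unitmx.
Proof. by move=> /minus_factorsP[/= _ [[]]]. Qed.
Lemma a_plus_up a : GLstar a -> isup (a_plus a).
Proof. by move=> /plus_factorsP[/= []]. Qed.
Lemma a_minus_low a : GLstar a -> islow (a_minus a).
Proof. by move=> /minus_factorsP[/= []]. Qed.
Lemma v_plus_low a : GLstar a -> islow (v_plus a).
Proof. by move=> /plus_factorsP[/= _ [[]]]. Qed.
Lemma v_minus_up a : GLstar a -> isup (v_minus a).
Proof. by move=> /minus_factorsP[/= _ [[]]]. Qed.

Lemma diff_mul_id (v : M -> M) a X : differentiable v a ->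
  'd (fun y => y *m v y) a X = X *m v a + a *m 'd v a X.
Proof.
move=> dv; have li : linear (fun y : M => y) by [].
have ci : continuous (fun y : M => y) by move=> ?; apply: cvg_id.
have [di Ei] := @is_diff_linear _ _ _ (fun y : M => y) a li ci.
have [_ e] := diff_mulmx di dv.
apply: (etrans (congr1 (@^~ X) e)).
by congr (_ *m _ + _); exact: (congr1 (@^~ X) Ei).
Qed.

Lemma invmx_mulKr (a v : M) : a \in unitmx -> v \in unitmx ->
  invmx (a *m v) *m a = invmx v.
Proof.
move=> ua uv; apply: (can_inj (mulmxK uv)); rewrite mulVmx // -mulmxA mulVmx //.
by rewrite unitmx_mul ua.
Qed.

(** Differentiating [a *m v = a'] relates the logarithmic differentials of the
    factors. *)
Lemma logd_factors (v a' : M -> M) a X : GLstar a ->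
  differentiable v a -> (forall y, GLstar y -> a' y = y *m v y) ->
  v a \in unitmx -> differentiable a' a ->
  logd a' a X = invmx (a' a) *m X *m v a + logd v a X.
Proof.
move=> ga dv av uv da; rewrite /logd.
have [_ e] := diff_on oG av ga da.
have E : 'd a' a X = X *m v a + a *m 'd v a X.
  exact: (etrans (esym (congr1 (@^~ X) e)) (diff_mul_id X dv)).
have E2 : invmx (a' a) *m a = invmx (v a).
  apply: (etrans (congr1 (fun z => invmx z *m a) (av a ga))).
  exact: invmx_mulKr (GLstar_unit ga) uv.
apply: (etrans (congr1 (mulmx (invmx (a' a))) E)); rewrite mulmxDr !mulmxA.
exact: (congr1 (fun z => _ + z *m _) E2).
Qed.

(** The tangent vector [X] at [a], carried by the two factorizations. *)
Definition theta_plus a X : M := invmx (a_plus a) *m X *m v_plus a.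
Definition theta_minus a X : M := invmx (a_minus a) *m X *m v_minus a.

Lemma logd_plusE a X : GLstar a -> logd a_plus a X = theta_plus a X + logd v_plus a X.
Proof.
move=> ga; apply: logd_factors => //; [exact: dv_plus|exact: a_plus_of|
  exact: v_plus_unit|exact: da_plus].
Qed.
Lemma logd_minusE a X : GLstar a -> logd a_minus a X = theta_minus a X + logd v_minus a X.
Proof.
move=> ga; apply: logd_factors => //; [exact: dv_minus|exact: a_minus_of|
  exact: v_minus_unit|exact: da_minus].
Qed.

Lemma logd_a_plus_up a X : GLstar a -> isup (logd a_plus a X).
Proof.
move=> ga; apply: isup_mul; first by apply: isup_inv; [exact: a_plus_unit|exact: a_plus_up].
move=> i j ij; apply: (diff_entry_cst (c := 0) _ oG ga (da_plus ga)) => y gy.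
exact: a_plus_up.
Qed.
Lemma logd_a_minus_low a X : GLstar a -> islow (logd a_minus a X).
Proof.
move=> ga; apply: islow_mul; first by apply: islow_inv; [exact: a_minus_unit|exact: a_minus_low].
move=> i j ij; apply: (diff_entry_cst (c := 0) _ oG ga (da_minus ga)) => y gy.
exact: a_minus_low.
Qed.
Lemma dv_plus_slow a X : GLstar a -> isslow ('d v_plus a X).
Proof.
move=> ga; apply: low_strict => [i j ij|i].
  apply: (diff_entry_cst (c := 0) _ oG ga (dv_plus ga)) => y gy.
  exact: v_plus_low.
apply: (diff_entry_cst (c := 1) _ oG ga (dv_plus ga)) => y /plus_factorsP[/= _ [_ h] _].
exact: h.
Qed.
Lemma dv_minus_sup a X : GLstar a -> issup ('d v_minus a X).
Proof.
move=> ga; apply: up_strict => [i j ij|i].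
  apply: (diff_entry_cst (c := 0) _ oG ga (dv_minus ga)) => y gy.
  exact: v_minus_up.
apply: (diff_entry_cst (c := 1) _ oG ga (dv_minus ga)) => y /minus_factorsP[/= _ [_ h] _].
exact: h.
Qed.
Lemma logd_v_plus_slow a X : GLstar a -> isslow (logd v_plus a X).
Proof.
move=> ga; apply: isslow_mulr; last exact: dv_plus_slow.
by apply: islow_inv; [exact: v_plus_unit|exact: v_plus_low].
Qed.
Lemma logd_v_minus_sup a X : GLstar a -> issup (logd v_minus a X).
Proof.
move=> ga; apply: issup_mulr; last exact: dv_minus_sup.
by apply: isup_inv; [exact: v_minus_unit|exact: v_minus_up].
Qed.

Lemma logd_v_plusE a X : GLstar a -> logd v_plus a X = - slowmx (theta_plus a X).
Proof.
move=> ga; have -> : theta_plus a X = - logd v_plus a X + logd a_plus a X.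
  by rewrite logd_plusE // addrC addrK.
rewrite split_slow_up ?opprK //; last exact: logd_a_plus_up.
by move=> i j ij; rewrite mxE (logd_v_plus_slow X ga ij) oppr0.
Qed.
Lemma logd_v_minusE a X : GLstar a -> logd v_minus a X = - supmx (theta_minus a X).
Proof.
move=> ga; have -> : theta_minus a X = - logd v_minus a X + logd a_minus a X.
  by rewrite logd_minusE // addrC addrK.
rewrite split_sup_low ?opprK //; last exact: logd_a_minus_low.
by move=> i j ij; rewrite mxE (logd_v_minus_sup X ga ij) oppr0.
Qed.

Lemma logd_a_plus_diag a X k : GLstar a ->
  ('d a_plus a X) k k = a_plus a k k * (logd a_plus a X) k k.
Proof.
move=> ga; rewrite -up_mul_diag; [|exact: a_plus_up|exact: logd_a_plus_up].
by rewrite mulKVmx // a_plus_unit.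
Qed.
Lemma logd_a_minus_diag a X k : GLstar a ->
  ('d a_minus a X) k k = a_minus a k k * (logd a_minus a X) k k.
Proof.
move=> ga; rewrite -low_mul_diag; [|exact: a_minus_low|exact: logd_a_minus_low].
by rewrite mulKVmx // a_minus_unit.
Qed.

(** The foliation functions are products of diagonal entries; their differentials are
    read off the diagonals of the logarithmic differentials. *)
Lemma diff_phi a X (j : 'I_n.+1) : GLstar a ->
  'd (phi j) a X = phi j a *
    (\sum_(k < n.+1 | (k < j.+1)%N) (logd a_minus a X) k k -
     \sum_(k < n.+1 | (j < k)%N) (logd a_plus a X) k k).
Proof.
move=> ga.
pose dP := fun k X => ('d a_minus a X) k k; pose dQ := fun k X => ('d a_plus a X) k k.
have HP : is_diff a (Pminus j.+1 : M -> K^o) (fun X => Pminus j.+1 a *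
    \sum_(k < n.+1 | (k < j.+1)%N) (dP k X / a_minus a k k)).
  apply: is_diff_prodE => k; last exact: a_minus_diag_neq0.
  have [d e] := diff_coord k k (da_minus ga).
  by apply: DiffDef => //; apply/funext.
have HQ : is_diff a (Qplus j.+1 : M -> K^o) (fun X => Qplus j.+1 a *
    \sum_(k < n.+1 | (j < k)%N) (dQ k X / a_plus a k k)).
  apply: is_diff_prodE => k; last exact: a_plus_diag_neq0.
  have [d e] := diff_coord k k (da_plus ga).
  by apply: DiffDef => //; apply/funext.
have [dP0 eP] := HP; have [dQ0 eQ] := HQ.
have q0 := Qplus_neq0 j.+1 ga.
have dV := differentiableV dQ0 q0.
have [_ e] := @diff_on _ _ _ GLstar (fun a => Pminus j.+1 a * (Qplus j.+1 a)^-1 : K^o)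
  (phi j) a oG (fun a ga => esym (phiE j ga)) ga (differentiableM dP0 dV).
apply: (etrans (congr1 (@^~ X) e)); apply: (etrans (diff_mulE X dP0 dV)).
pose P := Pminus j.+1 a : K; pose Q := Qplus j.+1 a : K.
apply: (etrans (congr2 (fun s t => P * s + t * Q^-1)
  (etrans (diff_invE X dQ0 q0)
    (congr1 (fun z => - (Q^-1 * Q^-1 * z)) (congr1 (@^~ X) eQ)))
  (congr1 (@^~ X) eP))).
rewrite phiE //.
have -> : \sum_(k < n.+1 | (k < j.+1)%N) dP k X / a_minus a k k =
    \sum_(k < n.+1 | (k < j.+1)%N) (logd a_minus a X) k k.
  by apply: eq_bigr => k _; rewrite /dP logd_a_minus_diag // mulrC mulKf // a_minus_diag_neq0.
have -> : \sum_(k < n.+1 | (j < k)%N) dQ k X / a_plus a k k =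
    \sum_(k < n.+1 | (j < k)%N) (logd a_plus a X) k k.
  by apply: eq_bigr => k _; rewrite /dQ logd_a_plus_diag // mulrC mulKf // a_plus_diag_neq0.
have alg (p q s t : K) : q != 0 ->
    p * - (q^-1 * q^-1 * (q * t)) + p * s * q^-1 = p / q * (s - t).
  by move=> q1; field.
exact: alg.
Qed.

Lemma telescope_ord (f : nat -> K) (j m : nat) : (m <= j <= n.+1)%N ->
  \sum_(k < n.+1 | (m <= k < j)%N) (f k.+1 - f k) = f j - f m.
Proof.
move=> /andP[mj jn]; rewrite -(big_mkord (fun k => m <= k < j)%N (fun k => f k.+1 - f k)).
rewrite (big_cat_nat (n := m)) //=; last exact: leq_trans jn.
rewrite (big_cat_nat (n := j) (m := m)) //=.
rewrite big_nat_cond big_pred0 ?add0r => [|i]; last by lia.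
rewrite addrC big_nat_cond big_pred0 ?add0r => [|i]; last by lia.
rewrite -telescope_sumr // big_nat_cond [RHS]big_nat_cond.
by apply: eq_bigl => i; lia.
Qed.

(** Multiplying [a] on the left by a diagonal matrix multiplies both [a_plus] and
    [a_minus] by it. *)
Lemma phi_submersion a (u : 'I_n.+1 -> K) : GLstar a ->
  exists X, forall j, 'd (phi j) a X = u j.
Proof.
move=> ga.
(* The diagonal [z] must satisfy [Y j.+1 = \sum_(k <= j) z k - \sum_(k > j) z k]; the
   entries of [z] are half the increments of [Y], where [Y 0] has to be the opposite
   of the last value. *)
pose Y (k : nat) := if k is k'.+1 then u (inord k') / phi (inord k') a
  else - (u ord_max / phi ord_max a).
pose z : M := diag_mx (\row_k ((Y k.+1 - Y k) / 2)).
have zd : isdg z by move=> i j /negPf ij; rewrite mxE ij mulr0n.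
have zk k : z k k = (Y k.+1 - Y k) / 2 by rewrite !mxE eqxx mulr1n.
exists (z *m a) => j.
have [/= _ _ Ep] := plus_factorsP ga; have [/= _ _ Em] := minus_factorsP ga.
have uvp := v_plus_unit ga; have uvm := v_minus_unit ga.
have uap := a_plus_unit ga; have uam := a_minus_unit ga.
have hp := a_plus_up ga; have hm := a_minus_low ga.
have Tp : theta_plus a (z *m a) = invmx (a_plus a) *m (z *m a_plus a).
  by rewrite /theta_plus {2}Ep -!mulmxA mulVmx // mulmx1.
have Tm : theta_minus a (z *m a) = invmx (a_minus a) *m (z *m a_minus a).
  by rewrite /theta_minus {2}Em -!mulmxA mulVmx // mulmx1.
have zu := isdg_up zd; have zl := isdg_low zd.
have lp k : (logd a_plus a (z *m a)) k k = z k k.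
  rewrite logd_plusE // logd_v_plusE // mxE [X in _ + X]mxE [X in - X]mxE ltnn.
  rewrite [X in - X]mxE subr0 Tp up_mul_diag ?up_mul_diag ?up_inv_diag //.
  - by rewrite mulrC mulfK // a_plus_diag_neq0.
  - exact: isup_inv.
  - exact: isup_mul.
have lm k : (logd a_minus a (z *m a)) k k = z k k.
  rewrite logd_minusE // logd_v_minusE // mxE [X in _ + X]mxE [X in - X]mxE ltnn.
  rewrite [X in - X]mxE subr0 Tm low_mul_diag ?low_mul_diag ?low_inv_diag //.
  - by rewrite mulrC mulfK // a_minus_diag_neq0.
  - exact: islow_inv.
  - exact: islow_mul.
have S1 : \sum_(k < n.+1 | (k < j.+1)%N) (logd a_minus a (z *m a)) k k = (Y j.+1 - Y 0%N) / 2.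
  apply: (etrans (eq_bigr (fun k : 'I_n.+1 => (Y k.+1 - Y k) / 2) _)) => [k _|].
    exact: (etrans (lm k) (zk k)).
  by rewrite -mulr_suml -(@telescope_ord Y j.+1 0) //=.
have S2 : \sum_(k < n.+1 | (j < k)%N) (logd a_plus a (z *m a)) k k = (Y n.+1 - Y j.+1) / 2.
  apply: (etrans (eq_bigr (fun k : 'I_n.+1 => (Y k.+1 - Y k) / 2) _)) => [k _|].
    exact: (etrans (lp k) (zk k)).
  rewrite -mulr_suml -(@telescope_ord Y n.+1 j.+1) //; last by have := ltn_ord j; lia.
  by congr (_ / _); apply: eq_bigl => k; have := ltn_ord k; lia.
have E0 : Y 0%N = - Y n.+1 by rewrite /Y (_ : inord n = ord_max) //; apply: val_inj; rewrite /= inordK.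
apply: (etrans (diff_phi _ _ ga)); apply: (etrans (congr2 (fun s t => phi j a * (s - t)) S1 S2)).
rewrite E0 opprK -mulrBl.
have -> : Y j.+1 + Y n.+1 - (Y n.+1 - Y j.+1) = Y j.+1 * 2 by ring.
by rewrite mulfK ?pnatr_eq0 //= inord_val mulrC divfK // phi_neq0.
Qed.

Lemma Ck_logd k (E : normedModType K) (A : set E) (f : E -> M) (X : E) : open A ->
  (forall k, Ck k A f) -> (forall x, A x -> f x \in unitmx) ->
  Ck k A (fun x => logd f x X).
Proof.
move=> oA Cf uf; apply: (Ck_mulmx oA); first exact: (Ck_invmx oA uf (Cf k)).
by case: (Cf k.+1) => _; apply.
Qed.

Lemma Ck_trwedge k (E : normedModType K) (A : set E) (al be : form1 E M) (X Y : E) : open A ->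
  (forall Z, Ck k A (al^~ Z)) -> (forall Z, Ck k A (be^~ Z)) ->
  Ck k A (fun x => trwedge al be x X Y : K^o).
Proof.
move=> oA ca cb; have CP := Ck_fclass k oA.
apply: (mc_trace CP (F := fun x => al x X *m be x Y - al x Y *m be x X)).
by apply: (mc_sub CP); apply: (mc_mul CP); apply/(Ck_mxP _ _ oA).
Qed.

Lemma smooth_Omega X Y : smooth (@GLstar K n) (fun a => Omega a X Y : K^o).
Proof.
move=> k; apply: (fc_sub (Ck_fclass k oG)); apply: (Ck_trwedge _ _ oG) => Z; apply: (Ck_logd _ _ oG).
- exact: Ck_v_plus.
- exact: v_plus_unit.
- exact: Ck_a_plus.
- exact: a_plus_unit.
- exact: Ck_v_minus.
- exact: v_minus_unit.
- exact: Ck_a_minus.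
- exact: a_minus_unit.
Qed.

(** With [p] and [q] the diagonals of the logarithmic differentials of [a_minus] and
    [a_plus], the infinitesimal counterpart of [leaf_diag]. *)
Lemma partial_sums_opp (p q : 'I_n.+1 -> K) : \sum_k p k = \sum_k q k ->
  (forall j : 'I_n.+1, \sum_(k < n.+1 | (k < j.+1)%N) p k =
     \sum_(k < n.+1 | (j < k)%N) q k) ->
  forall k, q k = - p k.
Proof.
move=> pq H.
have Hn : \sum_k p k = 0.
  rewrite (eq_bigl (fun k : 'I_n.+1 => (k < (ord_max : 'I_n.+1).+1)%N)) => [|k].
    by rewrite H big_pred0 // => k; rewrite /=; have := ltn_ord k; lia.
  by rewrite /= ltn_ord.
have HqS (j : nat) : (j <= n.+1)%N ->
   \sum_(k < n.+1 | (k < j)%N) p k = \sum_(k < n.+1 | (j <= k)%N) q k.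
  case: j => [_|j jn]; last by have := H (Ordinal jn).
  by rewrite big_pred0 //; exact: (etrans (esym Hn) pq).
move=> k; apply/eqP; rewrite -addr_eq0; apply/eqP.
have := HqS k (ltnW (ltn_ord k)); have := HqS k.+1 (ltn_ord k).
rewrite (bigD1 k) //= [X in _ -> _ = X -> _](bigD1 k) //=.
rewrite (eq_bigl (fun i : 'I_n.+1 => (i < k)%N)) => [|i]; last by rewrite -val_eqE /=; lia.
rewrite [X in _ -> _ = _ + X -> _](eq_bigl (fun i : 'I_n.+1 => (k < i)%N)) => [|i]; last first.
  by rewrite -val_eqE /=; lia.
by move=> <- E; apply: (addIr (\sum_(i < n.+1 | (i < k)%N) p i)); rewrite add0r -addrA -E.
Qed.

(** On the tangent space of a leaf the diagonal parts of the two logarithmic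
    differentials are opposite. *)
Lemma leaf_tangent_diag a X : GLstar a -> (forall j, 'd (phi j) a X = 0) ->
  forall k, (logd a_plus a X) k k = - (logd a_minus a X) k k.
Proof.
move=> ga h.
pose p k := logd a_minus a X k k; pose q k := logd a_plus a X k k.
have H (j : 'I_n.+1) : \sum_(k < n.+1 | (k < j.+1)%N) p k = \sum_(k < n.+1 | (j < k)%N) q k.
  have /eqP := etrans (esym (diff_phi X j ga)) (h j).
  by rewrite mulf_eq0 (negPf (phi_neq0 j ga)) /= subr_eq0 => /eqP.
have trE : \tr (logd a_plus a X) = \tr (logd a_minus a X).
  have t0 (A : M) : (forall i, A i i = 0) -> \tr A = 0.
    by move=> A0; rewrite /mxtrace big1.
  have tr1 (v a' : M) : v \in unitmx -> a = a' *m invmx v -> a' \in unitmx ->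
      \tr (invmx a' *m X *m v) = \tr (X *m invmx a).
    move=> uv E ua'; rewrite mxtrace_mulC mulmxA mxtrace_mulC.
    congr (\tr (_ *m _)); apply: (can_inj (mulmxK (GLstar_unit ga))).
    rewrite mulVmx ?GLstar_unit // [X in _ *m X = _]E mulmxA mulmxKV // mulmxV //.
  have [/= _ _ Ep] := plus_factorsP ga; have [/= _ _ Em] := minus_factorsP ga.
  apply: (etrans (congr1 mxtrace (logd_plusE X ga))).
  apply: (etrans _ (esym (congr1 mxtrace (logd_minusE X ga)))).
  have tp := t0 _ (fun i => logd_v_plus_slow X ga (leqnn i)).
  have tm := t0 _ (fun i => logd_v_minus_sup X ga (leqnn i)).
  have alg (A B : M) : \tr B = 0 -> \tr (A + B) = \tr A.
    by move=> B0; rewrite mxtraceD B0 addr0.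
  apply: (etrans (alg _ _ tp)); apply: (etrans _ (esym (alg _ _ tm))).
  apply: (etrans (tr1 _ _ (v_plus_unit ga) Ep (a_plus_unit ga))).
  exact: (esym (tr1 _ _ (v_minus_unit ga) Em (a_minus_unit ga))).
exact: (partial_sums_opp (esym trE) H).
Qed.

End Infinitesimal.

(** * Points of a leaf over a given parameter *)

Section Leaves.
Context {K : numFieldType} {n : nat}.
Local Notation M := 'M[K]_n.+1.
Implicit Types (a d : M) (v : M * M) (c r : 'I_n.+1 -> K).

Lemma b_factors_param a : GLstar a ->
  b_factors (param a) (invmx (dgmx (a_plus a)) *m a_plus a,
    invmx (dgmx (a_minus a)) *m a_minus a,
    invmx (dgmx (a_minus a)) *m dgmx (a_plus a)).
Proof.
move=> ga; have [/= _ _ Ep] := plus_factorsP ga; have [/= _ _ Em] := minus_factorsP ga.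
have uam := a_minus_unit ga; have uvp := v_plus_unit ga; have uvm := v_minus_unit ga.
have [gp gm] : GLp (a_plus a) /\ GLm (a_minus a).
  by split; [case: (plus_factorsP ga)|case: (minus_factorsP ga)].
have udp := dgmx_up_unit gp; have udm := dgmx_low_unit gm.
have dp := dgmx_isdg (a_plus a); have dm := dgmx_isdg (a_minus a).
split => /=; [exact: GLp0_normalize|exact: GLm0_normalize| |].
- apply/is_diag_mxP => i j ij; apply: isdg_mul => //; exact: isdg_inv.
- rewrite invmx_mul ?unitmx_inv // invmxK !mulmxA mulmxK // mulmxK //.
  apply: (can_inj (mulKmx uam)); rewrite !mulmxA -Em mulmxV // mul1mx.
  by rewrite {1}Ep mulmxKV.
Qed.

Lemma wof_param_unit v : Vstar v -> wof v \in unitmx.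
Proof. by move=> /Vstar_LU[]. Qed.

Lemma b_param a : GLstar a ->
  [/\ b_plus (param a) = invmx (dgmx (a_plus a)) *m a_plus a,
      b_minus (param a) = invmx (dgmx (a_minus a)) *m a_minus a &
      delta (param a) = invmx (dgmx (a_minus a)) *m dgmx (a_plus a)].
Proof.
move=> ga; have [] // := b_factorsE _ (b_factors_param ga).
exact/wof_param_unit/param_Vstar.
Qed.

Lemma delta_param a k : GLstar a ->
  delta (param a) k k = a_plus a k k / a_minus a k k.
Proof.
move=> ga; have [_ _ ->] := b_param ga.
have dm := dgmx_isdg (a_minus a).
have udm : dgmx (a_minus a) \in unitmx.
  by rewrite dgmx_unit; apply/forallP => i; apply: a_minus_diag_neq0.
rewrite isdg_mulE; last exact: isdg_inv.
rewrite low_inv_diag //; last exact: isdg_low.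
by rewrite !dgmxE mulrC.
Qed.

(** The group element with parameter [v] and [a_minus] of diagonal [d]. *)
Definition rebuild d v : M := d *m b_minus v *m invmx v.2.

Lemma rebuild_param a : GLstar a -> rebuild (dgmx (a_minus a)) (param a) = a.
Proof.
move=> ga; have [_ bm _] := b_param ga; rewrite /rebuild bm mulKVmx.
  by have [/= _ _ <-] := minus_factorsP ga.
by rewrite dgmx_unit; apply/forallP => i; apply: a_minus_diag_neq0.
Qed.

Lemma rebuildP d v : Vstar v -> isdg d -> d \in unitmx ->
  [/\ GLstar (rebuild d v), param (rebuild d v) = v,
      a_minus (rebuild d v) = d *m b_minus v &
      a_plus (rebuild d v) = d *m delta v *m b_plus v].
Proof.
move=> /[dup] Vv [v1 v2 _] dd ud.
have [/= [[up hp] dp] [[um hm] dm] /is_diag_mxP hd E] := b_factorsP (Vstar_LU Vv).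
have [ude hde] := delta_bdom (Vstar_bdom Vv).
have u1 := GLm0_unit v1; have u2 := GLp0_unit v2.
have Em : rebuild d v = (d *m b_minus v) *m invmx v.2 by [].
have Ep : rebuild d v = (d *m delta v *m b_plus v) *m invmx v.1.
  rewrite /rebuild -!mulmxA; congr (_ *m _).
  apply: (can_inj (mulmxK u1)); rewrite -!mulmxA mulVmx // mulmx1.
  by apply: (can_inj (mulKmx (_ : invmx (b_minus v) \in unitmx)));
    rewrite ?unitmx_inv // mulKmx // E !mulmxA.
have Gm : GLm (d *m b_minus v).
  by split; [rewrite unitmx_mul ud|apply: islow_mul => //; apply: isdg_low].
have Gp : GLp (d *m delta v *m b_plus v).
  split; first by rewrite !unitmx_mul ud ude.
  by apply: isup_mul => //; apply: isdg_up; apply: isdg_mul.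
have g : GLstar (rebuild d v).
  split.
    exists (d *m delta v *m b_plus v) => //; exists (invmx v.1) => //.
    by apply: GLm_inv; case: v1.
  exists (d *m b_minus v) => //; exists (invmx v.2) => //.
  by apply: GLp_inv; case: v2.
have Fp : plus_factors (rebuild d v) (d *m delta v *m b_plus v, v.1) by split.
have Fm : minus_factors (rebuild d v) (d *m b_minus v, v.2) by split.
split => //; last by rewrite (a_plusE Fp).
- by rewrite /param (v_plusE Fp) (v_minusE Fm) -surjective_pairing.
- by rewrite (a_minusE Fm).
Qed.

(** The sequence [r], preceded by [1], and the diagonal matrix of its quotients. *)
Definition rseq r (j : nat) : K := if j is j'.+1 then r (inord j') else 1.
Definition rdiag r : M := diag_mx (\row_k (rseq r k.+1 / rseq r k)).

Lemma rdiagE r k : rdiag r k k = rseq r k.+1 / rseq r k.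
Proof. by rewrite !mxE eqxx mulr1n. Qed.
Lemma rdiag_isdg r : isdg (rdiag r).
Proof. by move=> i j /negPf ij; rewrite mxE ij mulr0n. Qed.
Lemma rseq_neq0 r j : (forall k, r k != 0) -> rseq r j != 0.
Proof. by case: j => [|j] r0 /=; rewrite ?oner_eq0. Qed.
Lemma rdiag_unit r : (forall k, r k != 0) -> rdiag r \in unitmx.
Proof.
move=> r0; rewrite low_unit; last exact/isdg_low/rdiag_isdg.
by apply/forallP => k; rewrite rdiagE mulf_neq0 ?invr_eq0 ?rseq_neq0.
Qed.

Lemma prod_rdiag r (m j : nat) : (forall k, r k != 0) -> (m <= j <= n.+1)%N ->
  \prod_(k < n.+1 | (m <= k < j)%N) rdiag r k k = rseq r j / rseq r m.
Proof.
move=> r0 /andP[mj jn]; have := mj; rewrite leq_eqVlt => /orP[/eqP mj0|mj'].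
  by rewrite mj0 divff ?rseq_neq0 // big_pred0 // => k; lia.
under eq_bigr do rewrite rdiagE.
rewrite -(big_mkord (fun k => m <= k < j)%N (fun k => rseq r k.+1 / rseq r k)).
rewrite (big_cat_nat (n := m)) //=; last exact: leq_trans jn.
rewrite (big_cat_nat (n := j) (m := m)) //=.
rewrite big_nat_cond big_pred0 ?mul1r => [|i]; last by lia.
rewrite mulrC big_nat_cond big_pred0 ?mul1r => [|i]; last by lia.
rewrite -telescope_prodf // => [|k _]; last exact: rseq_neq0.
rewrite big_nat_cond [RHS]big_nat_cond.
by apply: eq_bigl => i; lia.
Qed.

(** The product of the entries of [delta] after the index [j]. *)
Definition tailprod v (j : nat) : K := \prod_(k < n.+1 | (j < k)%N) delta v k k.

Lemma delta_neq0 v k : bdom v -> delta v k k != 0.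
Proof. by move=> /delta_bdom[ud hd]; apply: low_diag_neq0 => //; apply: isdg_low. Qed.

Lemma tailprod_neq0 v j : bdom v -> tailprod v j != 0.
Proof. by move=> bv; apply/prodf_neq0 => k _; apply: delta_neq0. Qed.

Lemma leaf_neq0 c a j : leaf c a -> c j != 0.
Proof. by move=> [ga <-]; apply: phi_neq0. Qed.

(** The leading minors of a point of a leaf are square roots of functions of its
    parameter. *)
Lemma leaf_minor_sqr c a (j : 'I_n.+1) : leaf c a ->
  Pminus j.+1 a ^+ 2 = c j * c ord_max * tailprod (param a) j.
Proof.
move=> [ga hc]; rewrite -!hc !phiE // Qplus_end divr1.
have -> : tailprod (param a) j = Qplus j.+1 a / \prod_(k < n.+1 | (j < k)%N) a_minus a k k.
  rewrite /Qplus -prodf_div; apply: eq_bigr => k _; exact: delta_param.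
have -> : Pminus n.+1 a = Pminus j.+1 a * \prod_(k < n.+1 | (j < k)%N) a_minus a k k.
  rewrite /Pminus (bigID (fun k : 'I_n.+1 => (k < j.+1)%N)) /=; congr (_ * _).
    by apply: eq_bigl => k; rewrite ltn_ord.
  by apply: eq_bigl => k; rewrite ltn_ord -leqNgt.
have q0 := Qplus_neq0 j.+1 ga.
have t0 : \prod_(k < n.+1 | (j < k)%N) a_minus a k k != 0.
  by apply/prodf_neq0 => k _; apply: a_minus_diag_neq0.
have alg (p q t : K) : q != 0 -> t != 0 -> p ^+ 2 = p / q * (p * t) * (q / t).
  by move=> q1 t1; field; rewrite q1 t1.
exact: alg.
Qed.

Lemma leaf_minor_max c a : leaf c a -> Pminus n.+1 a = c ord_max.
Proof. by move=> [ga <-]; rewrite phiE // Qplus_end divr1. Qed.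

(** Conversely, square roots of these functions are the leading minors of a point of the
    leaf. The last one is prescribed, since it is the determinant. *)
Lemma leaf_rebuild c r v : Vstar v -> (forall j, c j != 0) ->
  r ord_max = c ord_max ->
  (forall j : 'I_n.+1, r j ^+ 2 = c j * c ord_max * tailprod v j) ->
  leaf c (rebuild (rdiag r) v) /\ param (rebuild (rdiag r) v) = v.
Proof.
move=> Vv c0 rn hr; have bv := Vstar_bdom Vv.
have r0 j : r j != 0.
  by rewrite -sqrf_eq0 hr !mulf_neq0 ?tailprod_neq0.
have dd := rdiag_isdg r; have ud := rdiag_unit r0.
have [g pv am ap] := rebuildP Vv dd ud; split=> //; split=> // j.
have [/= [[up hp] dp] [[um hm] dm] _ _] := b_factorsP (Vstar_LU Vv).
have [ude hde] := delta_bdom bv.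
rewrite phiE //.
have -> : Pminus j.+1 (rebuild (rdiag r) v) = r j.
  transitivity (rseq r j.+1 / rseq r 0%N); last by rewrite /= divr1 inord_val.
  rewrite -prod_rdiag //=; apply: eq_bigr => k _.
  by rewrite am isdg_mulE // dm mulr1.
have -> : Qplus j.+1 (rebuild (rdiag r) v) = c ord_max / r j * tailprod v j.
  have jn := ltn_ord j.
  transitivity (rseq r n.+1 / rseq r j.+1 * tailprod v j); last first.
    by rewrite /= inord_val -rn; congr (r _ / _ * _); apply: val_inj; rewrite /= inordK.
  rewrite -prod_rdiag // ?jn //= /Qplus.
  have -> : \prod_(k < n.+1 | (j < k < n.+1)%N) rdiag r k k =
      \prod_(k < n.+1 | (j < k)%N) rdiag r k k.
    by apply: eq_bigl => k; have := ltn_ord k; lia.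
  rewrite -big_split /=; apply: eq_bigr => k _.
  by rewrite ap -mulmxA isdg_mulE // isdg_mulE // dp mulr1.
have t0 := tailprod_neq0 j bv; have r0j := r0 j; have cn0 := c0 ord_max.
have alg (x t y z : K) : x != 0 -> t != 0 -> y != 0 -> x ^+ 2 = z * y * t ->
    x / (y / x * t) = z.
  move=> x0 t1 y0 E; have -> : x / (y / x * t) = x ^+ 2 / (y * t) by field; rewrite x0 t1 y0.
  by rewrite E; field; rewrite t1 y0.
exact: (alg _ _ _ _ r0j t0 cn0 (hr j)).
Qed.

Lemma rdiag_minors a : GLstar a -> rdiag (fun j => Pminus j.+1 a) = dgmx (a_minus a).
Proof.
move=> ga; apply: isdg_eq => [||k]; [exact: rdiag_isdg|exact: dgmx_isdg|].
rewrite rdiagE dgmxE /= inord_val PminusS.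
have -> : rseq (fun j : 'I_n.+1 => Pminus j.+1 a) k = Pminus k a.
  by case: k => [[|k] kn] /=; rewrite ?Pminus0 // inordK // ltnW.
by rewrite mulrC mulKf // Pminus_neq0.
Qed.

Lemma leaf_existence c v : (forall j, c j != 0) -> Vstar v ->
  (exists2 a, leaf c a & param a = v) <->
  (forall j : 'I_n.+1, exists r : K, r ^+ 2 =
     c j * c ord_max * \prod_(k < n.+1 | (j < k)%N) delta v k k).
Proof.
move=> c0 Vv; split=> [[a la <-] j|H].
  by exists (Pminus j.+1 a); apply: leaf_minor_sqr.
have [r hr] := choice H.
(* For the last index the equation only gives the square of the determinant. *)
pose r' j := if j == ord_max then c ord_max else r j.
have rn : r' ord_max = c ord_max by rewrite /r' eqxx.
have hr' (j : 'I_n.+1) : r' j ^+ 2 = c j * c ord_max * tailprod v j.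
  rewrite /r'; case: eqP => [->|_]; last exact: hr.
  rewrite /tailprod big_pred0 ?mulr1 ?expr2 // => k /=.
  by have := ltn_ord k; lia.
by have [] := leaf_rebuild Vv c0 rn hr'; exists (rebuild (rdiag r') v).
Qed.

Lemma leaf_param_eq c a a' : leaf c a -> leaf c a' ->
  param a = param a' <->
  exists e : 'rV[K]_n.+1, (forall k, e 0 k ^+ 2 = 1) /\ a' = diag_mx e *m a.
Proof.
move=> la la'; have ga := la.1; have ga' := la'.1; split=> [E|[e [e1 E]]].
  pose e : 'rV[K]_n.+1 := \row_k (a_minus a' k k / a_minus a k k).
  exists e; split.
    move=> k; rewrite mxE.
    have := leaf_diag k la; rewrite -(leaf_diag k la') => H.
    have D := delta_param k ga; rewrite E (delta_param k ga') in D.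
    have m0 := a_minus_diag_neq0 k ga; have m0' := a_minus_diag_neq0 k ga'.
    have p0 := a_plus_diag_neq0 k ga.
    have alg (x y p q : K) : x != 0 -> y != 0 -> p != 0 -> q / y = p / x ->
        x * p = y * q -> (y / x) ^+ 2 = 1.
      move=> x0 y0 p0' Eq; have -> : q = p / x * y by rewrite -Eq divfK.
      move=> Ex; have Ex2 : p * x ^+ 2 = p * y ^+ 2.
        have -> : p * x ^+ 2 = x * p * x by ring.
        by rewrite Ex; field; rewrite x0.
      by rewrite expr_div_n -(mulfI p0' Ex2) divff // expf_neq0.
    exact: (alg _ _ _ _ m0 m0' p0 D H).
  rewrite -[LHS](rebuild_param ga') -[in RHS](rebuild_param ga) -E /rebuild !mulmxA.
  congr (_ *m _ *m _); apply: isdg_eq => [||k].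
  - exact: dgmx_isdg.
  - apply: isdg_mul; last exact: dgmx_isdg.
    by move=> i j /negPf ij; rewrite mxE ij mulr0n.
  - rewrite isdg_mulE => [|i j /negPf ij]; last by rewrite mxE ij mulr0n.
    by rewrite !dgmxE !mxE eqxx mulr1n divfK // a_minus_diag_neq0.
have ue : diag_mx e \in unitmx.
  rewrite low_unit; last by move=> i j ij; rewrite mxE -val_eqE /= ltn_eqF.
  by apply/forallP => k; rewrite mxE eqxx mulr1n -sqrf_eq0 e1 oner_eq0.
have ed : isdg (diag_mx e) by move=> i j /negPf ij; rewrite mxE ij mulr0n.
have [/= [up hp] vp Ep] := plus_factorsP ga; have [/= [um hm] vm Em] := minus_factorsP ga.
have Fp : plus_factors a' (diag_mx e *m a_plus a, v_plus a).
  split=> //=; last by rewrite E {1}Ep mulmxA.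
  by split; [rewrite unitmx_mul ue|apply: isup_mul => //; apply: isdg_up].
have Fm : minus_factors a' (diag_mx e *m a_minus a, v_minus a).
  split=> //=; last by rewrite E {1}Em mulmxA.
  by split; [rewrite unitmx_mul ue|apply: islow_mul => //; apply: isdg_low].
by rewrite /param (v_plusE Fp) (v_minusE Fm).
Qed.

End Leaves.

(** * Local branches of the square root *)

Section SquareRoot.
Context {K : numFieldType}.

(** Every point near [1] has a square root; among the two opposite ones, the closest to
    [1] lies in a disc on which squaring is injective. *)
Definition sqrt_near1 := forall z : K, `|z - 1| < 4^-1 -> exists w, w ^+ 2 = z.

(** A choice of the square root at distance less than one half from [1], wherever the
    argument is close enough to [1]. *)
Definition sqrt_branch (sq : K -> K) :=
  forall z, `|z - 1| < 4^-1 -> sq z ^+ 2 = z /\ `|sq z - 1| < 2^-1.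

Lemma sqrt_branch_ex : sqrt_near1 -> exists sq, sqrt_branch sq.
Proof.
move=> hs.
have near (z : K) : exists w, `|z - 1| < 4^-1 -> w ^+ 2 = z /\ `|w - 1| < 2^-1.
  have [zr|zr] := pselect (`|z - 1| < 4^-1); last by exists 0.
  have [w0 hw0] := hs z zr.
  have [w [hw hle]] : exists w, w ^+ 2 = z /\ `|w - 1| <= `|w + 1|.
    have [le|le] := orP (real_leVge (normr_real (w0 - 1)) (normr_real (w0 + 1))).
      by exists w0.
    exists (- w0); rewrite sqrrN; split => //.
    by rewrite -opprD normrN -[X in _ <= X]normrN opprD opprK.
  exists w => _; split=> //.
  have r2 : (2^-1 : K) \is Num.real by rewrite realV realn.
  have [//|ge] := real_ltP (normr_real (w - 1)) r2.
  have : (4^-1 : K) <= `|z - 1|.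
    have -> : z - 1 = (w - 1) * (w + 1) by rewrite -hw; ring.
    have -> : (4^-1 : K) = 2^-1 * 2^-1 by field.
    by rewrite normrM ler_pM ?invr_ge0 ?ler0n // (le_trans ge).
  by move=> /le_lt_trans/(_ zr); rewrite ltxx.
by have [sq hsq] := choice near; exists sq.
Qed.

Lemma sum_near1 (w w0 : K) : `|w - 1| < 2^-1 -> `|w0 - 1| < 2^-1 -> 1 <= `|w + w0|.
Proof.
move=> h h0; have : (2 : K) <= 1 + `|w + w0|.
  have {1}-> : (2 : K) = `|(1 - w) + (1 - w0) + (w + w0)|.
    have -> : (1 - w) + (1 - w0) + (w + w0) = 2 by ring.
    by rewrite ger0_norm // ler0n.
  apply: le_trans (ler_normD _ _) _; rewrite lerD2r.
  apply: le_trans (ler_normD _ _) _.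
  have E1 : (1 : K) = 2^-1 + 2^-1 by field.
  by rewrite [leRHS]E1 -(distrC w) -(distrC w0) lerD // ltW.
by rewrite (_ : (2 : K) = 1 + 1) // lerD2l.
Qed.

Lemma sqrt_dist (w w0 : K) : `|w - 1| < 2^-1 -> `|w0 - 1| < 2^-1 ->
  `|w - w0| <= `|w ^+ 2 - w0 ^+ 2|.
Proof.
move=> h h0; rewrite subr_sqr normrM -[leLHS]mulr1.
by rewrite ler_wpM2l // sum_near1.
Qed.

Lemma sqrt_inj (w w0 : K) : `|w - 1| < 2^-1 -> `|w0 - 1| < 2^-1 ->
  w ^+ 2 = w0 ^+ 2 -> w = w0.
Proof.
move=> h h0 E; have := sqrt_dist h h0; rewrite E subrr normr0 normr_le0 subr_eq0.
by move/eqP.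
Qed.

Lemma near1_neq0 (w : K) : `|w - 1| < 2^-1 -> w != 0.
Proof.
apply: contraTneq => ->; rewrite sub0r normrN normr1; apply/negP => h.
have : (2 * 1 : K) < 2 * 2^-1 by rewrite ltr_pM2l ?ltr0n.
rewrite mulfV ?pnatr_eq0 // mulr1 => /ltW; rewrite (_ : (1 : K) = 1%:R) // ler_nat.
by [].
Qed.

Lemma disc_open (r : K) : open [set z : K^o | `|z - 1| < r].
Proof.
rewrite openE => z /= zr; apply/nbhs_ballP; exists (r - `|z - 1|); first by rewrite /= subr_gt0.
move=> y; rewrite -ball_normE /= => yz.
have -> : y - 1 = (z - 1) - (z - y) by ring.
by rewrite (le_lt_trans (ler_normB _ _)) // -ltrBrDl.
Qed.

Lemma sqrt_differentiable sq (z0 : K^o) : sqrt_branch sq -> `|z0 - 1| < 4^-1 ->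
  differentiable (sq : K^o -> K^o) z0.
Proof.
move=> hsq hz0; have [e0 n0] := hsq z0 hz0; have s0 := near1_neq0 n0.
pose k : K := (2 * sq z0)^-1.
have lin : linear (fun h : K^o => k * h : K^o) by move=> c x y; rewrite mulrDr scalerAr.
have cts : continuous (fun h : K^o => k * h : K^o) by move=> x; apply: mulrl_continuous.
have H : (sq : K^o -> K^o) \o shift z0 = cst (sq z0) + (fun h : K^o => k * h : K^o) +o_ 0 id.
  apply/eqaddoP => e ep.
  have kp : 0 < `|k| by rewrite normr_gt0 invr_eq0 mulf_neq0 // pnatr_eq0.
  near=> h.
  have hz : `|(h + z0) - 1| < 4^-1.
    near: h; have := open_nbhs_nbhs (conj (@disc_open 4^-1) hz0).
    by rewrite [nbhs z0 _](near_shift 0 z0) subr0.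
  have [eh nh] := hsq _ hz.
  rewrite !fctE /=.
  have Eh : h = sq (h + z0) ^+ 2 - sq z0 ^+ 2 by rewrite eh e0 addrK.
  have -> : sq (h + z0) - (sq z0 + k * h) = - k * (sq (h + z0) - sq z0) ^+ 2.
    by rewrite {2}Eh /k; field.
  rewrite normrM normrN normrX expr2.
  have D : `|sq (h + z0) - sq z0| <= `|h| by rewrite {2}Eh sqrt_dist.
  apply: (le_trans (y := (`|k| * `|h|) * `|h|)).
    by rewrite -mulrA ler_wpM2l // ler_pM.
  rewrite ler_wpM2r //.
  rewrite mulrC -ler_pdivlMr //; apply: ltW.
  near: h; apply: (@nbhs0_lt K K^o); by rewrite divr_gt0.
pose LM := GRing.isLinear.Build _ _ _ _ _ lin.
pose L : {linear K^o -> K^o} := HB.pack (fun h : K^o => k * h : K^o) LM.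
have dE : 'd (sq : K^o -> K^o) z0 = L :> (K^o -> K^o) by apply: diff_unique.
by apply/diff_locallyP; rewrite dE; split.
Unshelve. all: by end_near. Qed.

(** The derivative of [f = sq \o g] is [g' / (2 f)], whence the smoothness of [f] by
    induction. *)
Lemma Ck_sqrt (E : normedModType K) k (A : set E) sq (g : E -> K^o) : open A ->
  sqrt_branch sq -> (forall x, A x -> `|g x - 1| < 4^-1) -> Ck k A g ->
  Ck k A (fun x => sq (g x) : K^o).
Proof.
move=> oA hsq hg; elim: k => [|k IH] Cg.
  move=> x Ax; apply: (continuous_comp (Cg x Ax)).
  exact: (differentiable_continuous (sqrt_differentiable hsq (hg x Ax))).
pose f x : K^o := sq (g x).
have [dg dkg] := Cg; have Cf : Ck k A f by apply/IH/CkW.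
have df x : A x -> differentiable f x.
  move=> Ax; apply: differentiable_comp; first exact: dg.
  exact: sqrt_differentiable hsq (hg x Ax).
split=> [x Ax|h]; first exact: df.
have f0 x : A x -> 2 * f x != 0.
  by move=> Ax; have [_ /near1_neq0 q0] := hsq _ (hg x Ax); rewrite mulf_neq0 ?pnatr_eq0.
have CP := Ck_fclass k oA.
have C1 : Ck k A (fun x => 'd g x h / (2 * f x) : K^o).
  by apply: (fc_div CP (dkg h)) => //; apply: (fc_mul CP (fc_cst CP 2)).
apply: (Ck_ext oA _ C1) => x Ax.
have [_ e] := @diff_on _ _ _ A (fun y => f y * f y : K^o) g x oA
  (fun y Ay => etrans (esym (expr2 (f y))) (hsq _ (hg y Ay)).1) Ax
  (differentiableM (df x Ax) (df x Ax)).
have e2 := etrans (congr1 (@^~ h) e) (diff_mulE h (df x Ax) (df x Ax)).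
apply: (mulIf (f0 x Ax)); rewrite divfK ?f0 //; apply: (etrans e2).
by rewrite [X in _ + X]mulrC -mulr2n -[RHS]mulrC -mulrA mulr_natl.
Qed.

End SquareRoot.

(** * Local sections of the parameter *)

Section Sections.
Context {K : numFieldType} {n : nat}.
Local Notation M := 'M[K]_n.+1.
Implicit Types (a : M) (v : M * M) (c : 'I_n.+1 -> K).

Lemma mc_fst k (A : set (M * M)) : open A -> mclass (@Ck K (M * M)%type K^o k A) (fun v => v.1).
Proof. by move=> oA; apply/(Ck_mxP _ _ oA)/Ck_fst. Qed.
Lemma mc_snd k (A : set (M * M)) : open A -> mclass (@Ck K (M * M)%type K^o k A) (fun v => v.2).
Proof. by move=> oA; apply/(Ck_mxP _ _ oA)/Ck_snd. Qed.

Lemma Ck_tailprod k j : Ck k bdom (fun v : M * M => tailprod v j : K^o).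
Proof.
have oB := @open_bdom K n; have CP := Ck_fclass k oB.
apply: (fc_prod CP) => i.
exact: (mc_delta CP (F := id) (mc_fst k oB) (mc_snd k oB) (fun t Bt => Bt) i i).
Qed.

Lemma Ck_Pminus k j : Ck k GLstar (Pminus j : M -> K^o).
Proof.
have oG := @open_GLstar K n; have CP := Ck_fclass k oG.
apply: (fc_prod CP) => i.
have CI : mclass (@Ck K M K^o k GLstar) (fun a => a) by apply/(Ck_mxP _ _ oG)/Ck_id.
exact: (mc_a_minus CP (F := id) CI (fun t Bt => Bt) i i).
Qed.

Lemma near_open (E : normedModType K) (A : set E) (f : E -> K^o) x r : open A ->
  Ck 0 A f -> A x -> `|f x - 1| < r -> \forall y \near x, `|f y - 1| < r.
Proof.
move=> oA Cf Ax fr.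
exact: (Cf x Ax _ (open_nbhs_nbhs (conj (@disc_open K r) fr))).
Qed.

Section OneSection.
Variables (sq : K -> K) (c : 'I_n.+1 -> K) (a : M).
Hypotheses (hsq : sqrt_branch sq) (la : leaf c a).
Let v0 := param a.
Let ga : GLstar a := la.1.

Let bv0 : bdom v0. Proof. exact/Vstar_bdom/param_Vstar. Qed.

(** The squares of the quotients of the leading minors by those of [a], as functions of the
    parameter, and the domain where they have a square root near [1]. *)
Definition tailquot (j : nat) v : K := tailprod v j / tailprod v0 j.
Definition section_dom : set (M * M) :=
  [set v | bdom v /\ forall j : 'I_n.+1, `|tailquot j v - 1| < 4^-1].

(** The leading minors, as functions of the parameter: the branch of the square root
    is the one which gives the minors of [a] at the parameter of [a]. *)
Definition section_minors v (j : 'I_n.+1) : K := Pminus j.+1 a * sq (tailquot j v).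
(** The local section through [a] of the restriction of [param] to its leaf. *)
Definition section v : M := rebuild (rdiag (section_minors v)) v.

Lemma Ck_tailquot k j : Ck k bdom (fun v => tailquot j v : K^o).
Proof.
have CP := Ck_fclass k (@open_bdom K n).
exact: (fc_mul CP (Ck_tailprod k j) (fc_cst CP _)).
Qed.

Lemma open_section_dom : open section_dom.
Proof.
rewrite openE => v [bv hv].
have n1 : \forall y \near v, bdom y by apply: open_nbhs_nbhs; split=> //; apply: open_bdom.
have n2 : \forall y \near v, forall j : 'I_n.+1, `|tailquot j y - 1| < 4^-1.
  apply: (@filter_forall _ _ (fun (j : 'I_n.+1) y => `|tailquot j y - 1| < 4^-1) (nbhs v) _) => j.
  exact: (near_open (@open_bdom K n) (Ck_tailquot 0 j) bv (hv j)).
by apply: filterS2 n1 n2.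
Qed.

Lemma tailquot0 j : tailquot j v0 = 1.
Proof. by rewrite /tailquot divff // tailprod_neq0. Qed.

Lemma near1_1 (r : K) : 0 < r -> `|1 - 1| < r :> K.
Proof. by rewrite subrr normr0. Qed.

Lemma gt0_4 : 0 < 4^-1 :> K. Proof. by rewrite invr_gt0 ltr0n. Qed.
Lemma gt0_2 : 0 < 2^-1 :> K. Proof. by rewrite invr_gt0 ltr0n. Qed.

Lemma sq1 : sq 1 = 1.
Proof.
have [e h] := hsq (near1_1 gt0_4).
by apply: sqrt_inj => //; rewrite ?e ?expr1n // near1_1 // gt0_2.
Qed.

Lemma section_dom_param : section_dom v0.
Proof. by split=> // j; rewrite tailquot0 near1_1 // gt0_4. Qed.

Lemma section_param : section v0 = a.
Proof.
rewrite /section -[RHS](rebuild_param ga) -(rdiag_minors ga); congr (rebuild (rdiag _) _).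
by apply/funext => j; rewrite /section_minors tailquot0 sq1 mulr1.
Qed.

Lemma section_minors_neq0 v j : section_dom v -> section_minors v j != 0.
Proof.
move=> [bv hv]; have [_ h] := hsq (hv j).
by rewrite mulf_neq0 ?Pminus_neq0 ?near1_neq0.
Qed.

Lemma smooth_section : smooth section_dom section.
Proof.
move=> k; have oS := open_section_dom; have CP := Ck_fclass k oS.
have sub : section_dom `<=` bdom by move=> v [].
have Cr j : Ck k section_dom (fun v => section_minors v j : K^o).
  apply: (fc_mul CP (fc_cst CP _)); apply: (Ck_sqrt oS hsq).
    by move=> v [_]; apply.
  exact: (Ck_sub sub (Ck_tailquot k j)).
have Cs j : Ck k section_dom (fun v => rseq (section_minors v) j : K^o).
  by case: j => [|j] /=; [apply: (fc_cst CP)|apply: Cr].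
have s0 j v : section_dom v -> rseq (section_minors v) j != 0.
  by move=> dv; apply: rseq_neq0 => i; apply: section_minors_neq0.
apply/(Ck_mxP _ _ oS); apply: (mc_mul CP); first apply: (mc_mul CP).
- move=> i j; have [<-|ij] := eqVneq i j.
    apply: (@fc_ext _ _ _ _ CP (fun v => rseq (section_minors v) i.+1 / rseq (section_minors v) i)).
      by move=> v _; rewrite -rdiagE.
    by apply: (fc_div CP) => // v; apply: s0.
  apply: (fc_ext CP) (fc_cst CP 0) => v _; rewrite rdiag_isdg //.
- exact: (mc_b_minus CP (F := id) (mc_fst k oS) (mc_snd k oS) sub).
- by apply: (mc_inv CP (mc_snd k oS)) => v [[]].
Qed.

Lemma section_leaf v : section_dom v -> Vstar v -> leaf c (section v) /\ param (section v) = v.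
Proof.
move=> [bv hv] Vv; apply: leaf_rebuild => // [j|//|j].
- exact: (leaf_neq0 _ la).
- rewrite /section_minors (leaf_minor_max la) /tailquot /tailprod.
  have E0 : (fun k : 'I_n.+1 => ((ord_max : 'I_n.+1) < k)%N) =1 xpred0.
    by move=> k; have := ltn_ord k; rewrite /=; lia.
  by rewrite !(big_pred0 _ _ _ _ E0) divr1 sq1 mulr1.
- have [e _] := hsq (hv j).
  rewrite exprMn e (leaf_minor_sqr j la) -(mulrA (c j * c ord_max)); congr (_ * _).
  by rewrite -/v0 /tailquot mulrCA divff ?mulr1 // tailprod_neq0.
Qed.

Lemma section_near : \forall a' \near a, leaf c a' ->
  section_dom (param a') /\ section (param a') = a'.
Proof.
have oG := @open_GLstar K n.
have n1 : \forall a' \near a, section_dom (param a').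
  have cp : {for a, continuous (@param K n)} by apply: (@smooth_param K n 0).
  exact: (cp _ (open_nbhs_nbhs (conj open_section_dom section_dom_param))).
have n2 : \forall a' \near a, forall j : 'I_n.+1, `|Pminus j.+1 a' / Pminus j.+1 a - 1| < 2^-1.
  apply: (@filter_forall _ _
    (fun (j : 'I_n.+1) a' => `|Pminus j.+1 a' / Pminus j.+1 a - 1| < 2^-1) (nbhs a) _) => j.
  have CP := Ck_fclass 0 oG.
  have Cq : Ck 0 GLstar (fun a' => Pminus j.+1 a' / Pminus j.+1 a : K^o).
    exact: (fc_mul CP (Ck_Pminus 0 j.+1) (fc_cst CP _)).
  apply: (near_open oG Cq ga); rewrite divff ?Pminus_neq0 //.
  by rewrite near1_1 // gt0_2.
apply: filterS2 n1 n2 => a' dv ha' la'; split=> //.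
have ga' := la'.1.
rewrite /section -[RHS](rebuild_param ga') -(rdiag_minors ga').
congr (rebuild (rdiag _) _); apply/funext => j; rewrite /section_minors.
have P0 := Pminus_neq0 j.+1 ga.
have [e h] := hsq (dv.2 j).
have -> : sq (tailquot j (param a')) = Pminus j.+1 a' / Pminus j.+1 a.
  apply: (sqrt_inj h (ha' j)); rewrite e expr_div_n.
  rewrite (leaf_minor_sqr j la) (leaf_minor_sqr j la').
  by rewrite -mulf_div divff ?mul1r // mulf_neq0 //; exact: (leaf_neq0 _ la).
by rewrite mulrCA divff ?mulr1.
Qed.

End OneSection.

Lemma leaf_section_ex c a : sqrt_near1 (K := K) -> leaf c a ->
  exists U s, [/\ leaf_section c U s, U (param a), s (param a) = a &
    \forall a' \near a, leaf c a' -> U (param a') /\ s (param a') = a'].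
Proof.
move=> /sqrt_branch_ex[sq hsq] la.
exists (section_dom a), (section sq a); split.
- split; [exact: open_section_dom|exact: (smooth_section hsq la)|].
  by move=> v; apply: (section_leaf hsq la).
- exact: (section_dom_param la).
- exact: (section_param hsq la).
- exact: (section_near hsq la).
Qed.

End Sections.

(** * Derivatives along the parameter space *)

Section Tangent.
Context {K : numFieldType} {n : nat}.
Local Notation M := 'M[K]_n.+1.
Implicit Types (a : M) (u v X Y : M * M) (c : 'I_n.+1 -> K).

(** An open set of pairs whose trace on the affine space of pairs of unitriangular
    matrices is [Vstar]. *)
Definition Vopen : set (M * M) := [set v | bdom v /\ GLstar (wof v)].

Lemma Ck_wof k : Ck k bdom (@wof K n).
Proof.
have oB := @open_bdom K n; apply/(Ck_mxP _ _ oB).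
exact: (mc_wof (Ck_fclass k oB) (F := id) (mc_fst k oB) (mc_snd k oB) (fun t Bt => Bt)).
Qed.

Lemma open_Vopen : open Vopen.
Proof.
rewrite openE => v [bv gv].
have n1 : \forall y \near v, bdom y.
  by apply: open_nbhs_nbhs; split=> //; apply: open_bdom.
have n2 : \forall y \near v, GLstar (wof y).
  exact: (Ck_wof 0 v bv _ (open_nbhs_nbhs (conj (@open_GLstar K n) gv))).
by apply: filterS2 n1 n2.
Qed.

Lemma Vstar_Vopen v : Vstar v -> Vopen v.
Proof. by move=> Vv; split; [apply: Vstar_bdom|case: Vv]. Qed.

Lemma Vstar_line v X (t : K) : Vstar v -> Vtangent X -> Vopen (t *: X + v) ->
  Vstar (t *: X + v).
Proof.
move=> [v1 v2 _] [X1 X2] [_ g]; split=> //=.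
- have d1 j : (t *: X.1 + v.1) j j = 1 by rewrite !mxE X1 // mulr0 add0r; case: v1.
  have l : islow (t *: X.1 + v.1).
    by apply: islow_add; [apply/islow_scale/isslowW|apply: GLm0_low].
  split=> //; split=> //; rewrite low_unit //.
  by apply/forallP => j; rewrite d1 oner_eq0.
- have d1 j : (t *: X.2 + v.2) j j = 1 by rewrite !mxE X2 // mulr0 add0r; case: v2.
  have l : isup (t *: X.2 + v.2).
    by apply: isup_add; [apply/isup_scale/issupW|apply: GLp0_up].
  split=> //; split=> //; rewrite up_unit //.
  by apply/forallP => j; rewrite d1 oner_eq0.
Qed.

Lemma is_diff_line (E : normedModType K) (x h : E) (t : K^o) :
  is_diff t (fun s : K^o => s *: h + x) (fun s => s *: h).
Proof.
have H1 : is_diff t (fun s : K^o => s *: h) (fun s => s *: h).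
  apply: is_diff_linear; first by move=> k r s; rewrite scalerDl scalerA.
  by move=> s; apply: scalel_continuous.
have [d1 e1] := H1; have d2 := differentiable_cst x t.
apply: DiffDef; first exact: (differentiableD d1 d2).
apply: (etrans (diffD d1 d2)); apply/funext => s.
apply: (etrans (congr2 (fun a b : E => a + b) (congr1 (@^~ s) e1) (congr1 (@^~ s) (diff_cst x t)))).
exact: addr0.
Qed.

Lemma diff_along_line (E F : normedModType K) (f : E -> F) (x h : E) :
  differentiable f x ->
  is_diff (0 : K^o) (fun s : K^o => f (s *: h + x)) (fun s => s *: 'd f x h).
Proof.
move=> df; have [d1 e1] := is_diff_line x h 0.
have df' : differentiable f (0 *: h + x) by rewrite scale0r add0r.
apply: DiffDef; first exact: (differentiable_comp d1 df').
apply: (etrans (diff_comp d1 df')); apply/funext => s /=.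
rewrite scale0r add0r; apply: (etrans (congr1 ('d f x) (congr1 (@^~ s) e1))).
exact: linearZ.
Qed.

(** Functions which agree on [Vstar] have the same derivatives along it. *)
Lemma diff_tangent (F : normedModType K) (U : set (M * M)) (f g : M * M -> F) v X :
  open U -> U v -> Vstar v -> Vtangent X ->
  differentiable f v -> differentiable g v ->
  (forall u, U u -> Vstar u -> f u = g u) -> 'd f v X = 'd g v X.
Proof.
move=> oU Uv Vv TX df dg fg.
have Hf := diff_along_line X df; have [dg' eg] := diff_along_line X dg.
have near : \forall t \near (0 : K^o), f (t *: X + v) = g (t *: X + v).
  have [dl _] := is_diff_line v X 0.
  have cl := differentiable_continuous dl.
  have n1 : \forall t \near (0 : K^o), U (t *: X + v).
    apply: cl; rewrite scale0r add0r; exact: open_nbhs_nbhs.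
  have n2 : \forall t \near (0 : K^o), Vopen (t *: X + v).
    apply: cl; rewrite scale0r add0r; apply: open_nbhs_nbhs; split.
      exact: open_Vopen.
    exact: Vstar_Vopen.
  apply: filterS2 n1 n2 => t Ut Vt; apply: fg => //.
  exact: Vstar_line.
have [_ e] := is_diff_near near Hf.
have := congr1 (@^~ 1) (etrans (esym e) eg).
by rewrite /= !scale1r.
Qed.

Lemma Ck_b_plus k : Ck k bdom (@b_plus K n).
Proof.
have oB := @open_bdom K n; apply/(Ck_mxP _ _ oB).
exact: (mc_b_plus (Ck_fclass k oB) (F := id) (mc_fst k oB) (mc_snd k oB) (fun t Bt => Bt)).
Qed.
Lemma Ck_b_minus k : Ck k bdom (@b_minus K n).
Proof.
have oB := @open_bdom K n; apply/(Ck_mxP _ _ oB).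
exact: (mc_b_minus (Ck_fclass k oB) (F := id) (mc_fst k oB) (mc_snd k oB) (fun t Bt => Bt)).
Qed.
Lemma Ck_delta k : Ck k bdom (@delta K n).
Proof.
have oB := @open_bdom K n; apply/(Ck_mxP _ _ oB).
exact: (mc_delta (Ck_fclass k oB) (F := id) (mc_fst k oB) (mc_snd k oB) (fun t Bt => Bt)).
Qed.

Lemma db_plus v : bdom v -> differentiable (@b_plus K n) v.
Proof. exact: Ck_diff (Ck_b_plus 1). Qed.
Lemma db_minus v : bdom v -> differentiable (@b_minus K n) v.
Proof. exact: Ck_diff (Ck_b_minus 1). Qed.
Lemma ddelta v : bdom v -> differentiable (@delta K n) v.
Proof. exact: Ck_diff (Ck_delta 1). Qed.

Lemma b_plus_unip v : bdom v -> GLp0 (b_plus v).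
Proof. by move=> [_ /b_factorsP[]]. Qed.
Lemma b_minus_unip v : bdom v -> GLm0 (b_minus v).
Proof. by move=> [_ /b_factorsP[]]. Qed.

Lemma ddelta_isdg v X : bdom v -> isdg ('d (@delta K n) v X).
Proof.
move=> bv i j ij; apply: (diff_entry_cst (c := 0) _ (@open_bdom K n) bv (ddelta bv)).
by move=> u /delta_bdom[_ h]; apply: h.
Qed.

Lemma diff_fst v X : 'd (fun u : M * M => u.1) v X = X.1.
Proof.
have H : is_diff v (fun u : M * M => u.1) (fun u => u.1).
  by apply: is_diff_linear => // x; apply: cvg_fst.
by case: H => _ e; exact: (congr1 (@^~ X) e).
Qed.
Lemma diff_snd v X : 'd (fun u : M * M => u.2) v X = X.2.
Proof.
have H : is_diff v (fun u : M * M => u.2) (fun u => u.2).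
  by apply: is_diff_linear => // x; apply: cvg_snd.
by case: H => _ e; exact: (congr1 (@^~ X) e).
Qed.

Lemma invmx_diag_conj (d b d' b' : M) : d \in unitmx -> b \in unitmx ->
  invmx (d *m b) *m (d' *m b + d *m b') =
  invmx b *m b' + invmx b *m (invmx d *m d') *m b.
Proof.
move=> ud ub; rewrite invmx_mul // mulmxDr addrC; congr (_ + _).
  by rewrite mulmxA mulmxKV.
by rewrite !mulmxA.
Qed.

(** When [p ^ 2 = e q] with [e] constant, at least to the first order in the direction [h],
    the logarithmic derivative of [p] is half that of [q]. *)
Lemma scalar_half_log (E : normedModType K) (p q : E -> K^o) x h (e : K) :
  differentiable p x -> differentiable q x -> p x != 0 -> q x != 0 ->
  'd (fun y => p y * p y : K^o) x h = e * 'd q x h -> p x * p x = e * q x ->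
  (p x)^-1 * 'd p x h = 2^-1 * ((q x)^-1 * 'd q x h).
Proof.
move=> dp dq p0 q0 H E0; have {}H := etrans (esym (diff_mulE h dp dp)) H.
have e0 : e != 0.
  by apply: contra_neq p0 => ee; apply/eqP; rewrite -sqrf_eq0 expr2 E0 ee mul0r.
have alg (r s t u : K) : r != 0 -> s != 0 -> e != 0 -> r * t + t * r = e * u ->
    r * r = e * s -> r^-1 * t = 2^-1 * (s^-1 * u).
  move=> r0 s0 e1 H1 H2.
  have -> : u = (r * t + t * r) / e by rewrite H1 mulrC mulKf.
  have -> : s = r * r / e by rewrite H2 mulrC mulKf.
  by field; rewrite r0 e1.
exact: alg.
Qed.

End Tangent.

(** * The pullback of Omega by a section *)

Section Pullback.
Context {K : numFieldType} {n : nat}.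
Local Notation M := 'M[K]_n.+1.
Implicit Types (u v X Y : M * M).

(** The form [b^-1 db + k b^-1 (delta^-1 d delta) b]; the forms in [OmegaV] are obtained for
    [k] plus or minus one half. *)
Definition half_gauge (b : M * M -> M) (k : K) v X : M :=
  logd b v X + k *: (invmx (b v) *m logd delta v X *m b v).

Lemma OmegaV_E v X Y : OmegaV v X Y =
  trwedge (logd (fun u => u.1)) (half_gauge b_plus 2^-1) v X Y -
  trwedge (logd (fun u => u.2)) (half_gauge b_minus (- 2^-1)) v X Y.
Proof.
rewrite /OmegaV; congr (_ - _); rewrite /trwedge /half_gauge !scaleNr //.
Qed.

Variables (c : 'I_n.+1 -> K) (U : set (M * M)) (s : M * M -> M).
Hypothesis sP : leaf_section c U s.

Let oU : open U. Proof. by case: sP. Qed.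
Let sU v : U v -> Vstar v -> leaf c (s v). Proof. by case: sP => _ _ h Uv /(h _ Uv)[]. Qed.
Let pU v : U v -> Vstar v -> param (s v) = v. Proof. by case: sP => _ _ h Uv /(h _ Uv)[]. Qed.
Let ds v : U v -> differentiable s v.
Proof. by case: sP => _ /(_ 1%N)[d _] _; apply: d. Qed.

(** The open set where the composites of the section with the factorizations are
    smooth. *)
Definition sdom : set (M * M) := [set v | U v /\ GLstar (s v)].

Lemma sdomV v : U v -> Vstar v -> sdom v.
Proof. by move=> Uv Vv; split=> //; case: (sU Uv Vv). Qed.

Lemma open_sdom : open sdom.
Proof.
rewrite openE => v [Uv gv].
have n1 : \forall y \near v, U y by apply: open_nbhs_nbhs.
have cs : {for v, continuous s} by apply/differentiable_continuous/ds.
have n2 : \forall y \near v, GLstar (s y).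
  exact: (cs _ (open_nbhs_nbhs (conj (@open_GLstar K n) gv))).
by apply: filterS2 n1 n2.
Qed.

Lemma Ck_section_factors k :
  [/\ Ck k sdom (fun u => v_plus (s u)), Ck k sdom (fun u => a_plus (s u)),
      Ck k sdom (fun u => v_minus (s u)) & Ck k sdom (fun u => a_minus (s u))].
Proof.
apply: (Ck_factors open_sdom); last by move=> u [].
by apply: (Ck_sub (A := U)) => [v []//|]; case: sP => _ h _; apply: h.
Qed.

Lemma logd_comp (f : M -> M) v X : sdom v ->
  (forall a, GLstar a -> differentiable f a) ->
  logd f (s v) ('d s v X) = logd (fun u => f (s u)) v X.
Proof.
move=> [Uv gv] df; rewrite /logd; congr (_ *m _).
exact: (esym (congr1 (@^~ X) (diff_comp (ds Uv) (df _ gv)))).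
Qed.

(** At every point of [sdom], by the chain rule. *)
Lemma pullback_OmegaE v X Y : sdom v ->
  pullback s Omega v X Y =
  trwedge (logd (fun u => v_plus (s u))) (logd (fun u => a_plus (s u))) v X Y -
  trwedge (logd (fun u => v_minus (s u))) (logd (fun u => a_minus (s u))) v X Y.
Proof.
move=> sv; rewrite /pullback /Omega /trwedge.
have [a1 a2 a3 a4] : [/\ forall X, logd v_plus (s v) ('d s v X) = logd (fun u => v_plus (s u)) v X,
  forall X, logd a_plus (s v) ('d s v X) = logd (fun u => a_plus (s u)) v X,
  forall X, logd v_minus (s v) ('d s v X) = logd (fun u => v_minus (s u)) v X &
  forall X, logd a_minus (s v) ('d s v X) = logd (fun u => a_minus (s u)) v X].
  split=> Z; apply: logd_comp => // a; [exact: dv_plus|exact: da_plus|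
    exact: dv_minus|exact: da_minus].
by rewrite !(a1, a2, a3, a4).
Qed.

Section AtPoint.
Variables (v : M * M).
Hypotheses (Uv : U v) (Vv : Vstar v).
Let sv : sdom v := sdomV Uv Vv.
Let bv : bdom v := Vstar_bdom Vv.
Let gv : GLstar (s v) := sv.2.

Let dsap : differentiable (fun u => a_plus (s u)) v.
Proof. by have [_ h _ _] := Ck_section_factors 1; apply: Ck_diff h _. Qed.
Let dsam : differentiable (fun u => a_minus (s u)) v.
Proof. by have [_ _ _ h] := Ck_section_factors 1; apply: Ck_diff h _. Qed.
Let dsvp : differentiable (fun u => v_plus (s u)) v.
Proof. by have [h _ _ _] := Ck_section_factors 1; apply: Ck_diff h _. Qed.
Let dsvm : differentiable (fun u => v_minus (s u)) v.
Proof. by have [_ _ h _] := Ck_section_factors 1; apply: Ck_diff h _. Qed.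

Lemma section_v_plus X : Vtangent X ->
  logd (fun u => v_plus (s u)) v X = logd (fun u => u.1) v X.
Proof.
move=> TX; have df := Ck_diff (@Ck_fst K n 1 setT) (I : setT v).
exact: (congr2 (fun a b => invmx a *m b) (congr1 fst (pU Uv Vv))
  (diff_tangent oU Uv Vv TX dsvp df (fun u Uu Vu => congr1 fst (pU Uu Vu)))).
Qed.

Lemma section_v_minus X : Vtangent X ->
  logd (fun u => v_minus (s u)) v X = logd (fun u => u.2) v X.
Proof.
move=> TX; have df := Ck_diff (@Ck_snd K n 1 setT) (I : setT v).
exact: (congr2 (fun a b => invmx a *m b) (congr1 snd (pU Uv Vv))
  (diff_tangent oU Uv Vv TX dsvm df (fun u Uu Vu => congr1 snd (pU Uu Vu)))).
Qed.

Lemma delta_section u k : U u -> Vstar u ->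
  delta u k k = a_plus (s u) k k / a_minus (s u) k k.
Proof. by move=> Uu Vu; rewrite -{1}(pU Uu Vu) delta_param //; case: (sU Uu Vu). Qed.

Lemma diag_log_plus X k : Vtangent X ->
  (a_plus (s v) k k)^-1 * ('d (fun u => a_plus (s u)) v X) k k =
  2^-1 * ((delta v k k)^-1 * ('d (@delta K n) v X) k k).
Proof.
move=> TX; have [dp ep] := diff_coord k k dsap; have [dq eq] := diff_coord k k (ddelta bv).
apply: (etrans (congr1 (fun z => (a_plus (s v) k k)^-1 * z) (esym (ep X)))).
apply: (etrans _ (congr1 (fun z => 2^-1 * ((delta v k k)^-1 * z)) (eq X))).
pose e := leafq c k.+1 / leafq c k.
have H u : U u -> Vstar u ->
    a_plus (s u) k k * a_plus (s u) k k = e * delta u k k.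
  move=> Uu Vu; have lu := sU Uu Vu; rewrite delta_section // /e -(leaf_diag k lu).
  have m0 := a_minus_diag_neq0 k lu.1; by field.
have dm := differentiableM dp dp.
have dc : differentiable (fun u => e * delta u k k : K^o) v.
  exact: (differentiableZ e dq).
apply: (scalar_half_log dp dq (e := e)).
- exact: a_plus_diag_neq0.
- exact: delta_neq0.
- apply: (etrans (diff_tangent oU Uv Vv TX dm dc H)).
  exact: (congr1 (@^~ X) (diffZ e dq)).
- exact: H.
Qed.

Lemma diag_log_minus X k : Vtangent X ->
  (a_minus (s v) k k)^-1 * ('d (fun u => a_minus (s u)) v X) k k =
  - (2^-1 * ((delta v k k)^-1 * ('d (@delta K n) v X) k k)).
Proof.
move=> TX; have [dp ep] := diff_coord k k dsam; have [dq0 eq] := diff_coord k k (ddelta bv).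
apply: (etrans (congr1 (fun z => (a_minus (s v) k k)^-1 * z) (esym (ep X)))).
apply: (etrans _ (congr1 (fun z => - (2^-1 * ((delta v k k)^-1 * z))) (eq X))).
pose e := leafq c k.+1 / leafq c k.
have H u : U u -> Vstar u ->
    a_minus (s u) k k * a_minus (s u) k k = e * (delta u k k)^-1.
  move=> Uu Vu; have lu := sU Uu Vu; rewrite delta_section // /e -(leaf_diag k lu).
  have m0 := a_minus_diag_neq0 k lu.1; have p0 := a_plus_diag_neq0 k lu.1.
  by field; rewrite m0 p0.
have d0 := delta_neq0 k bv.
have dq := differentiableV dq0 d0.
have dm := differentiableM dp dp.
have dc : differentiable (fun u => e * (delta u k k)^-1 : K^o) v.
  exact: (differentiableZ e dq).
have Z := scalar_half_log (e := e) (h := X) dp dq (a_minus_diag_neq0 k gv).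
apply: (etrans (Z _ _ _)).
- by rewrite invr_eq0.
- apply: (etrans (diff_tangent oU Uv Vv TX dm dc H)).
  exact: (congr1 (@^~ X) (diffZ e dq)).
- exact: H.
have E := diff_invE X dq0 d0.
apply: (etrans (congr1 (fun z => 2^-1 * (((delta v k k)^-1)^-1 * z)) E)).
have alg (x y : K) : x != 0 -> 2^-1 * ((x^-1)^-1 * - (x^-1 * x^-1 * y)) = - (2^-1 * (x^-1 * y)).
  by move=> x0; field.
exact: alg.
Qed.

Lemma diff_dgmx (F : M * M -> M) X : differentiable F v ->
  differentiable (fun u => dgmx (F u)) v /\
  'd (fun u => dgmx (F u)) v X = dgmx ('d F v X).
Proof.
move=> dF.
have H : is_diff v (fun u => dgmx (F u)) (fun X => dgmx ('d F v X)).
  apply: diff_mxP => i j; have [<-|ij] := eqVneq i j.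
    have [d1 e1] := diff_coord i i dF.
    have -> : (fun u => dgmx (F u) i i : K^o) = fun u => F u i i.
      by apply/funext => u; rewrite dgmxE.
    by apply: DiffDef => //; apply/funext => Y; rewrite dgmxE.
  have -> : (fun u => dgmx (F u) i j : K^o) = fun=> 0.
    by apply/funext => u; rewrite dgmx_isdg.
  have -> : (fun X => dgmx ('d F v X) i j) = fun=> 0.
    by apply/funext => u; rewrite dgmx_isdg.
  exact: is_diff_cst.
by case: H => d e; split=> //; exact: (congr1 (@^~ X) e).
Qed.

(** Here [f] is [a_plus] or [a_minus], and [b] the corresponding unitriangular factor. *)
Lemma section_factor (f : M -> M) (b : M * M -> M) (k : K) X :
  differentiable (fun u => f (s u)) v -> differentiable b v -> Vtangent X ->
  (forall u, U u -> Vstar u -> f (s u) = dgmx (f (s u)) *m b u) ->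
  b v \in unitmx -> (forall i, f (s v) i i != 0) ->
  (forall i, (f (s v) i i)^-1 * ('d (fun u => f (s u)) v X) i i =
     k * ((delta v i i)^-1 * ('d (@delta K n) v X) i i)) ->
  logd (fun u => f (s u)) v X = half_gauge b k v X.
Proof.
move=> df db TX H ub f0 hk.
have [dd ed] := diff_dgmx X df.
have ud : dgmx (f (s v)) \in unitmx by rewrite dgmx_unit; apply/forallP.
have [dm em] := diff_mulmx dd db.
have E : 'd (fun u => f (s u)) v X =
    dgmx ('d (fun u => f (s u)) v X) *m b v + dgmx (f (s v)) *m 'd b v X.
  apply: (etrans (diff_tangent oU Uv Vv TX df dm H)).
  apply: (etrans (congr1 (@^~ X) em)).
  exact: (congr1 (fun z => z *m b v + _) ed).
rewrite /logd (H v Uv Vv); apply: (etrans (congr1 (mulmx _) E)).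
rewrite invmx_diag_conj // /half_gauge; congr (_ + _).
have [ude hde] := delta_bdom bv.
have -> : invmx (dgmx (f (s v))) *m dgmx ('d (fun u => f (s u)) v X) =
    k *: logd (@delta K n) v X.
  apply: isdg_eq => [||i].
  - by apply: isdg_mul; [apply: isdg_inv => //|]; apply: dgmx_isdg.
  - move=> i j ij; rewrite mxE (isdg_mul _ (ddelta_isdg X bv)) ?mulr0 //.
    exact: isdg_inv.
  - have hd := dgmx_isdg (f (s v)).
    rewrite isdg_mulE; last exact: isdg_inv.
    rewrite (low_inv_diag _ ud (isdg_low hd)) !dgmxE mxE.
    rewrite [X in _ = k * X]isdg_mulE; last exact: isdg_inv.
    by rewrite (low_inv_diag _ ude (isdg_low hde)) hk.
by rewrite -scalemxAr -scalemxAl.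
Qed.

Lemma section_a_plus X : Vtangent X ->
  logd (fun u => a_plus (s u)) v X = half_gauge b_plus 2^-1 v X.
Proof.
move=> TX; apply: section_factor => //.
- exact: db_plus.
- move=> u Uu Vu; have gu := (sU Uu Vu).1; rewrite -{3}(pU Uu Vu).
  have [-> _ _] := b_param gu; rewrite mulKVmx // dgmx_unit.
  by apply/forallP => i; apply: a_plus_diag_neq0.
- exact/GLp0_unit/b_plus_unip.
- by move=> i; apply: a_plus_diag_neq0.
- by move=> i; apply: diag_log_plus.
Qed.

Lemma section_a_minus X : Vtangent X ->
  logd (fun u => a_minus (s u)) v X = half_gauge b_minus (- 2^-1) v X.
Proof.
move=> TX; apply: section_factor => //.
- exact: db_minus.
- move=> u Uu Vu; have gu := (sU Uu Vu).1; rewrite -{3}(pU Uu Vu).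
  have [_ -> _] := b_param gu; rewrite mulKVmx // dgmx_unit.
  by apply/forallP => i; apply: a_minus_diag_neq0.
- exact/GLm0_unit/b_minus_unip.
- by move=> i; apply: a_minus_diag_neq0.
- by move=> i; rewrite diag_log_minus // mulNr.
Qed.

Lemma pullback_OmegaV X Y : Vtangent X -> Vtangent Y ->
  pullback s Omega v X Y = OmegaV v X Y.
Proof.
move=> TX TY; rewrite pullback_OmegaE // OmegaV_E /trwedge.
by rewrite !section_v_plus // !section_v_minus // !section_a_plus // !section_a_minus.
Qed.

End AtPoint.

Lemma differentiable_pullback v X Y : sdom v ->
  differentiable (fun u => pullback s Omega u X Y : K^o) v.
Proof.
move=> sv; have oS := open_sdom; have CP := Ck_fclass 1 oS.
have H : Ck 1 sdom (fun u =>
  trwedge (logd (fun u => v_plus (s u))) (logd (fun u => a_plus (s u))) u X Y -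
  trwedge (logd (fun u => v_minus (s u))) (logd (fun u => a_minus (s u))) u X Y : K^o).
  apply: (fc_sub CP); apply: (Ck_trwedge _ _ oS) => Z; apply: (Ck_logd _ _ oS).
  - by move=> k; case: (Ck_section_factors k).
  - by move=> u [_ /v_plus_unit].
  - by move=> k; case: (Ck_section_factors k).
  - by move=> u [_ /a_plus_unit].
  - by move=> k; case: (Ck_section_factors k).
  - by move=> u [_ /v_minus_unit].
  - by move=> k; case: (Ck_section_factors k).
  - by move=> u [_ /a_minus_unit].
exact: Ck_diff (Ck_ext oS (fun u su => esym (pullback_OmegaE X Y su)) H) sv.
Qed.

End Pullback.

(** * Flat matrix-valued forms *)

Section FlatForms.
Context {K : numFieldType} {E : normedModType K} {n : nat}.
Local Notation M := 'M[K]_n.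

Lemma mxtraceN (A : M) : \tr (- A) = - \tr A.
Proof. exact: raddfN. Qed.

(** The Maurer-Cartan equation at [x] for a matrix-valued form. *)
Definition flat_at (al : form1 E M) (x : E) := forall X Y,
  'd (fun y => al y Y) x X - 'd (fun y => al y X) x Y =
  al x Y *m al x X - al x X *m al x Y.

(** A third of the trace of the exterior cube of a matrix-valued form, from the values of the
    form at three vectors. *)
Definition tr_cube (g1 g2 g3 : M) : K := \tr (g1 *m (g2 *m g3 - g3 *m g2)).

(** The left-hand side is the exterior differential of [tr (al /\ be)], once those of [al] and
    [be] have been replaced by commutators. *)
Lemma tr_cube_expand (a1 a2 a3 b1 b2 b3 : M) :
  \tr ((a2 *m a1 - a1 *m a2) *m b3 - (a3 *m a1 - a1 *m a3) *m b2
     + (a3 *m a2 - a2 *m a3) *m b1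
     + a2 *m (b3 *m b1 - b1 *m b3) - a3 *m (b2 *m b1 - b1 *m b2)
     - a1 *m (b3 *m b2 - b2 *m b3)) =
  tr_cube b1 b2 b3 - tr_cube a1 a2 a3 - tr_cube (b1 - a1) (b2 - a2) (b3 - a3).
Proof.
have c (P Q R : M) : \tr (P *m Q *m R) = \tr (Q *m R *m P).
  by rewrite -mulmxA mxtrace_mulC.
rewrite /tr_cube !(mulmxDl, mulmxDr, mulNmx, mulmxN, mulmxA, mxtraceD, mxtraceN).
rewrite (c a2 a1 b3) (c a3 a1 b2) (c a3 a2 b1) (c a2 b1 a3) (c a2 a3 b1) (c a3 b1 a2).
rewrite (c a2 b3 b1) (c b3 b1 a2) (c a2 b1 b3) (c a3 b2 b1) (c b2 b1 a3) (c a3 b1 b2).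
by ring.
Qed.

Lemma tr_cube_up (g1 g2 g3 : M) : isup g1 -> isup g2 -> isup g3 -> tr_cube g1 g2 g3 = 0.
Proof.
move=> h1 h2 h3; rewrite /tr_cube /mxtrace big1 // => i _.
have Z : (g2 *m g3 - g3 *m g2) i i = 0.
  by rewrite mxE [X in _ + X]mxE up_mul_diag // up_mul_diag // mulrC subrr.
rewrite up_mul_diag ?Z ?mulr0 //.
by apply: isup_add; [apply: isup_mul|apply/isup_opp/isup_mul].
Qed.

Lemma tr_cube_low (g1 g2 g3 : M) : islow g1 -> islow g2 -> islow g3 -> tr_cube g1 g2 g3 = 0.
Proof.
move=> /isup_tr h1 /isup_tr h2 /isup_tr h3.
rewrite /tr_cube -mxtrace_tr trmx_mul linearB /= !trmx_mul mxtrace_mulC.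
exact: tr_cube_up.
Qed.

Lemma tr_cube_conj (P g1 g2 g3 : M) : P \in unitmx ->
  tr_cube (P *m g1 *m invmx P) (P *m g2 *m invmx P) (P *m g3 *m invmx P) = tr_cube g1 g2 g3.
Proof.
move=> uP; have H (A B : M) : (P *m A *m invmx P) *m (P *m B *m invmx P) = P *m (A *m B) *m invmx P.
  by rewrite !mulmxA mulmxKV.
have tc (A : M) : \tr (P *m A *m invmx P) = \tr A.
  by rewrite mxtrace_mulC mulmxA mulVmx // mul1mx.
by rewrite /tr_cube !H -mulmxBl -mulmxBr H tc.
Qed.

Lemma diff_trwedge (al be : form1 E M) x Y Z X :
  (forall W, differentiable (fun y => al y W) x) ->
  (forall W, differentiable (fun y => be y W) x) ->
  differentiable (fun y => trwedge al be y Y Z : K^o) x /\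
  'd (fun y => trwedge al be y Y Z : K^o) x X =
  \tr ('d (fun y => al y Y) x X *m be x Z + al x Y *m 'd (fun y => be y Z) x X
     - ('d (fun y => al y Z) x X *m be x Y + al x Z *m 'd (fun y => be y Y) x X)).
Proof.
move=> da db.
have [d1 e1] := diff_mulmx (da Y) (db Z); have [d2 e2] := diff_mulmx (da Z) (db Y).
have d3 := differentiableB d1 d2; split; first exact: (differentiable_trace d3).
apply: (etrans (diff_trace X d3)); congr (\tr _).
apply: (etrans (congr1 (@^~ X) (diffB d1 d2))).
exact: (congr2 (fun a b : M => a - b) (congr1 (@^~ X) e1) (congr1 (@^~ X) e2)).
Qed.

(** For flat forms, [d tr (al /\ be)] is the difference of the cubes of [be], [al] and
    [be - al]. *)
Lemma extd_trwedge (al be : form1 E M) x X Y Z :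
  (forall W, differentiable (fun y => al y W) x) ->
  (forall W, differentiable (fun y => be y W) x) ->
  flat_at al x -> flat_at be x ->
  extd (trwedge al be) x X Y Z =
  tr_cube (be x X) (be x Y) (be x Z) - tr_cube (al x X) (al x Y) (al x Z)
  - tr_cube (be x X - al x X) (be x Y - al x Y) (be x Z - al x Z).
Proof.
move=> da db fa fb; rewrite -tr_cube_expand.
have T Y' Z' X' := (@diff_trwedge al be x Y' Z' X' da db).2.
apply: (etrans (congr2 (fun a b : K => a + b)
  (congr2 (fun a b : K => a - b) (T Y Z X) (T X Z Y)) (T X Y Z))).
have alg (a1 a2 a3 b1 b2 b3 pYX pXY pZX pXZ pZY pYZ qYX qXY qZX qXZ qZY qYZ
    cYX cZX cZY dZX dYX dZY : M) :
    pYX - pXY = cYX -> pZX - pXZ = cZX -> pZY - pYZ = cZY ->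
    qZX - qXZ = dZX -> qYX - qXY = dYX -> qZY - qYZ = dZY ->
    \tr (pYX *m b3 + a2 *m qZX - (pZX *m b2 + a3 *m qYX))
    - \tr (pXY *m b3 + a1 *m qZY - (pZY *m b1 + a3 *m qXY))
    + \tr (pXZ *m b2 + a1 *m qYZ - (pYZ *m b1 + a2 *m qXZ)) =
    \tr (cYX *m b3 - cZX *m b2 + cZY *m b1 + a2 *m dZX - a3 *m dYX - a1 *m dZY).
  move=> <- <- <- <- <- <-.
  rewrite !(mulmxDl, mulmxDr, mulNmx, mulmxN, mxtraceD, mxtraceN).
  by ring.
exact: (alg _ _ _ _ _ _ _ _ _ _ _ _ _ _ _ _ _ _ _ _ _ _ _ _
  (fa X Y) (fa X Z) (fa Y Z) (fb X Z) (fb X Y) (fb Y Z)).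
Qed.

Lemma flat_logd (A : set E) (f : E -> M) x : open A -> A x ->
  (forall y, A y -> f y \in unitmx) -> mclass (symC2 A) f ->
  (forall W, differentiable (fun y => logd f y W) x) /\ flat_at (logd f) x.
Proof.
move=> oA Ax uf Cf; have [C2 sf] := symC2_mx oA Cf.
have [df _] := C2; have Ci := Ck_invmx oA uf (CkW C2).
have [di _] := Ci.
have d2 W := Ck_diff2 W C2 Ax.
have H W := diff_mulmx (di x Ax) (d2 W).
have [_ ei] := diff_invmx oA Ax uf (CkW C2).
split=> [W|X Y]; first by case: (H W).
have E1 W V : 'd (fun y => logd f y W) x V =
    - (logd f x V *m logd f x W) + invmx (f x) *m 'd (fun y => 'd f y W) x V.
  have [_ e] := H W; apply: (etrans (congr1 (@^~ V) e)); congr (_ + _).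
  apply: (etrans (congr1 (fun z => z *m 'd f x W) (congr1 (@^~ V) ei))).
  by rewrite mulNmx /logd !mulmxA.
apply: (etrans (congr2 (fun a b : M => a - b) (E1 Y X) (E1 X Y))).
have S := sf x Y X Ax.
have alg (a b c d : M) : c = d -> - a + c - (- b + d) = b - a.
  by move=> ->; rewrite opprD opprK addrACA subrr addr0 addrC.
exact: (alg _ _ _ _ (congr1 (mulmx _) S)).
Qed.

End FlatForms.

(** * Closedness *)

Section Closedness.
Context {K : numFieldType} {n : nat}.
Local Notation M := 'M[K]_n.+1.
Implicit Types (u v X Y Z : M * M).

Let oB := @open_bdom K n.

Lemma flat_delta v : bdom v ->
  (forall W, differentiable (fun y => logd (@delta K n) y W) v) /\
  forall X Y, 'd (fun y => logd (@delta K n) y Y) v X = 'd (fun y => logd (@delta K n) y X) v Y.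
Proof.
move=> bv.
have [dl fl] := flat_logd oB bv (fun y By => (delta_bdom By).1)
  (mc_delta (symC2_fclass oB) (F := id) (symC2_fst _) (symC2_snd _) (fun t Bt => Bt)).
split=> // X Y; apply/eqP; rewrite -subr_eq0; apply/eqP; apply: (etrans (fl X Y)).
have [ud hd] := delta_bdom bv.
have ld W : isdg (logd (@delta K n) v W).
  by apply: isdg_mul; [apply: isdg_inv|apply: ddelta_isdg].
by rewrite (isdg_comm (ld Y) (ld X)) subrr.
Qed.

(** The diagonal form [delta^-1 d delta] is closed and its values commute, so that adding a
    conjugate of a multiple of it is a gauge transformation. *)
Lemma flat_half_gauge (b : M * M -> M) (k : K) v : bdom v ->
  (forall y, bdom y -> b y \in unitmx) -> mclass (symC2 bdom) b ->
  (forall W, differentiable (fun y => half_gauge b k y W) v) /\ flat_at (half_gauge b k) v.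
Proof.
move=> bv ub Cb.
have [dl fl] := flat_logd oB bv ub Cb; have [dd sd] := flat_delta bv.
have [C2 _] := symC2_mx oB Cb; have db := Ck_diff C2 bv.
have di := Ck_diff (Ck_invmx oB ub (CkW C2)) bv.
have [_ ei] := diff_invmx oB bv ub (CkW C2).
have H1 W := diff_mulmx di (dd W).
have d1 W : differentiable (fun y => invmx (b y) *m logd (@delta K n) y W) v by case: (H1 W).
have H2 W := diff_mulmx (d1 W) db.
have d2 W : differentiable (fun y => invmx (b y) *m logd (@delta K n) y W *m b y) v.
  by case: (H2 W).
have d3 W := differentiableZ k (d2 W).
have dg W := differentiableD (dl W) (d3 W).
split=> // X Y.
pose mu W := invmx (b v) *m logd (@delta K n) v W *m b v.
pose la W V := invmx (b v) *m 'd (fun y => logd (@delta K n) y W) v V *m b v.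
have E W V : 'd (fun y => half_gauge b k y W) v V =
    'd (fun y => logd b y W) v V + k *: (mu W *m logd b v V - logd b v V *m mu W + la W V).
  apply: (etrans (congr1 (@^~ V) (diffD (dl W) (d3 W)))).
  apply: (congr1 (fun z => 'd (fun y => logd b y W) v V + z)).
  apply: (etrans (congr1 (@^~ V) (diffZ k (d2 W)))).
  apply: (congr1 (fun z => k *: z)).
  have [_ e2] := H2 W; have [_ e1] := H1 W.
  apply: (etrans (congr1 (@^~ V) e2)).
  have e1' := etrans (congr1 (@^~ V) e1)
    (congr1 (fun z => z *m logd (@delta K n) v W + _) (congr1 (@^~ V) ei)).
  apply: (etrans (congr1 (fun z => z *m b v + _) e1')).
  rewrite mulmxDl addrC addrA; congr (_ + _).
  rewrite !mulNmx; congr (_ - _); last by rewrite /mu /logd !mulmxA.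
  by rewrite /mu /logd !mulmxA mulmxK // ub.
apply: (etrans (congr2 (fun a b : M => a - b) (E Y X) (E X Y))).
have ls : la Y X = la X Y := congr1 (fun z => invmx (b v) *m z *m b v) (sd X Y).
have mc : mu Y *m mu X = mu X *m mu Y.
  have [ud hd] := delta_bdom bv.
  have ld W : isdg (logd (@delta K n) v W).
    by apply: isdg_mul; [apply: isdg_inv|apply: ddelta_isdg].
  have H W V : mu W *m mu V = invmx (b v) *m (logd (@delta K n) v W *m logd (@delta K n) v V) *m b v.
    by rewrite /mu !mulmxA mulmxK // ub.
  by rewrite !H (isdg_comm (ld Y) (ld X)).
rewrite /half_gauge -/(mu X) -/(mu Y).
have alg (tX tY mX mY l L1 L2 : M) : L1 - L2 = tY *m tX - tX *m tY -> mY *m mX = mX *m mY ->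
    L1 + k *: (mY *m tX - tX *m mY + l) - (L2 + k *: (mX *m tY - tY *m mX + l)) =
    (tY + k *: mY) *m (tX + k *: mX) - (tX + k *: mX) *m (tY + k *: mY).
  move=> hL hm; have -> : L1 = tY *m tX - tX *m tY + L2 by rewrite -hL subrK.
  rewrite !(mulmxDl, mulmxDr) -!(scalemxAl, scalemxAr) !scalerA hm.
  move: (tY *m tX) (tX *m tY) (mY *m tX) (tX *m mY) (mX *m tY) (tY *m mX) (mX *m mY).
  move=> a1 a2 a3 a4 a5 a6 a7; apply/matrixP => i j; rewrite !mxE; ring.
rewrite ls; exact: (alg _ _ _ _ _ _ _ (fl X Y) mc).
Qed.

Lemma diff_wof v X : bdom v ->
  'd (@wof K n) v X = invmx v.2 *m X.1 - invmx v.2 *m X.2 *m wof v.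
Proof.
move=> bv.
have o2 : open [set u : M * M | setT u /\ u.2 \in unitmx].
  exact: (open_unitmx openT (Ck_snd 0 setT)).
have u2 : [set u : M * M | setT u /\ u.2 \in unitmx] v by split=> //; case: bv.
have H2 := diff_invmx o2 u2 (fun y h => h.2) (Ck_snd 1 _).
have d1 := Ck_diff (@Ck_fst K n 1 setT) (I : setT v).
have [d2 e2] := H2; have [_ e] := diff_mulmx d2 d1.
apply: (etrans (congr1 (@^~ X) e)).
apply: (etrans (congr2 (fun a b => a *m v.1 + invmx v.2 *m b) (congr1 (@^~ X) e2) (diff_fst v X))).
rewrite addrC; congr (_ + _).
apply: (etrans (congr1 (fun z => - (invmx v.2 *m z *m invmx v.2) *m v.1) (diff_snd v X))).
by rewrite mulNmx /wof !mulmxA.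
Qed.

Lemma b_relation v : bdom v -> b_minus v *m wof v = delta v *m b_plus v.
Proof.
move=> bv; have um := GLm0_unit (b_minus_unip bv).
case: bv => u2 /b_factorsP[/= _ _ _ E].
by rewrite /wof E -mulmxA mulKVmx.
Qed.

Lemma diff_b_relation v X : bdom v ->
  'd (@b_minus K n) v X *m wof v + b_minus v *m 'd (@wof K n) v X =
  'd (@delta K n) v X *m b_plus v + delta v *m 'd (@b_plus K n) v X.
Proof.
move=> bv.
have dw := Ck_diff (@Ck_wof K n 1) bv.
have [d1 e1] := diff_mulmx (db_minus bv) dw.
have [d2 e2] := diff_mulmx (ddelta bv) (db_plus bv).
have [_ e] := diff_on oB b_relation bv d1.
apply: (etrans (esym (congr1 (@^~ X) e1))); apply: (etrans (esym (congr1 (@^~ X) e))).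
exact: (congr1 (@^~ X) e2).
Qed.

Lemma gauge_conj_alg (d p m v1 v2 w d' p' m' X1 X2 : M) : w = invmx v2 *m v1 ->
  d \in unitmx -> p \in unitmx -> m \in unitmx -> v1 \in unitmx -> v2 \in unitmx ->
  m *m w = d *m p ->
  m' *m w + m *m (invmx v2 *m X1 - invmx v2 *m X2 *m w) = d' *m p + d *m p' ->
  d *m d' = d' *m d ->
  invmx p *m p' + 2^-1 *: (invmx p *m (invmx d *m d') *m p) - invmx v1 *m X1 =
  invmx w *m (invmx m *m m' + - 2^-1 *: (invmx m *m (invmx d *m d') *m m)
              - invmx v2 *m X2) *m w.
Proof.
move=> wE ud up um u1 u2 R dR dc.
have uw : w \in unitmx by rewrite wE unitmx_mul unitmx_inv u2.
have Ew : w = invmx m *m d *m p by rewrite -mulmxA -R mulKmx.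
apply: (can_inj (mulKmx uw)); rewrite -[in RHS]mulmxA mulKVmx //.
have W1 : w *m invmx v1 = invmx v2 by rewrite wE mulmxK.
rewrite !(mulmxDr w) !mulmxDl mulmxN mulNmx !mulmxA W1.
rewrite -!(scalemxAl, scalemxAr) !mulmxA.
have -> : w *m invmx p *m p' = invmx m *m d *m p' by rewrite Ew mulmxK.
have -> : w *m invmx p *m invmx d *m d' *m p = invmx m *m d' *m p.
  by rewrite Ew !mulmxK.
have -> : invmx m *m invmx d *m d' *m m *m w = invmx m *m d' *m p.
  rewrite -(mulmxA _ m) R !mulmxA; congr (_ *m _).
  by rewrite -!mulmxA -dc mulKmx.
have {}dR := congr1 (mulmx (invmx m)) dR.
have {}dR : invmx m *m m' *m w + (invmx v2 *m X1 - invmx v2 *m X2 *m w) =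
    invmx m *m d' *m p + invmx m *m d *m p'.
  by move: dR; rewrite !(mulmxDr (invmx m)) mulKmx // !mulmxA.
have alg (A B C P Q : M) : A + (P - Q) = B + C ->
    C + 2^-1 *: B - P = A + - 2^-1 *: B - Q.
  move=> H; have -> : A = B + C - (P - Q) by rewrite -H addrK.
  by apply/matrixP => i j; rewrite !mxE; field.
exact: alg dR.
Qed.

(** For [a = delta^(1/2) b_plus v.1^-1 = delta^(-1/2) b_minus v.2^-1], both forms are
    conjugate to [a^-1 da]. *)
Lemma gauge_conj v X : bdom v -> v.1 \in unitmx ->
  half_gauge b_plus 2^-1 v X - logd (fun u => u.1) v X =
  invmx (wof v) *m (half_gauge b_minus (- 2^-1) v X - logd (fun u => u.2) v X) *m wof v.
Proof.
move=> bv u1; have [u2 [uw _]] := bv.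
have um := GLm0_unit (b_minus_unip bv); have up := GLp0_unit (b_plus_unip bv).
have [ud hd] := delta_bdom bv.
have dR := etrans (congr1 (fun z => 'd (@b_minus K n) v X *m wof v + b_minus v *m z)
  (esym (diff_wof X bv))) (diff_b_relation X bv).
have L1 : logd (fun u : M * M => u.1) v X = invmx v.1 *m X.1.
  exact: (congr1 (mulmx _) (diff_fst v X)).
have L2 : logd (fun u : M * M => u.2) v X = invmx v.2 *m X.2.
  exact: (congr1 (mulmx _) (diff_snd v X)).
rewrite L1 L2.
exact: (gauge_conj_alg erefl ud up um u1 u2 (b_relation bv) dR (isdg_comm hd (ddelta_isdg X bv))).
Qed.

Lemma flat_fst v : v.1 \in unitmx ->
  (forall W, differentiable (fun y => logd (fun u : M * M => u.1) y W) v) /\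
  flat_at (logd (fun u : M * M => u.1)) v.
Proof.
move=> u1; have o1 : open [set u : M * M | setT u /\ u.1 \in unitmx].
  exact: (open_unitmx openT (Ck_fst 0 setT)).
by apply: (flat_logd o1) => // [y []//|]; apply: symC2_fst.
Qed.
Lemma flat_snd v : v.2 \in unitmx ->
  (forall W, differentiable (fun y => logd (fun u : M * M => u.2) y W) v) /\
  flat_at (logd (fun u : M * M => u.2)) v.
Proof.
move=> u1; have o1 : open [set u : M * M | setT u /\ u.2 \in unitmx].
  exact: (open_unitmx openT (Ck_snd 0 setT)).
by apply: (flat_logd o1) => // [y []//|]; apply: symC2_snd.
Qed.

Lemma db_plus_sup v X : bdom v -> issup ('d (@b_plus K n) v X).
Proof.
move=> bv; apply: up_strict => [i j ij|i].
  by apply: (diff_entry_cst (c := 0) _ oB bv (db_plus bv)) => y /b_plus_unip/GLp0_up; apply.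
by apply: (diff_entry_cst (c := 1) _ oB bv (db_plus bv)) => y /b_plus_unip[_]; apply.
Qed.
Lemma db_minus_slow v X : bdom v -> isslow ('d (@b_minus K n) v X).
Proof.
move=> bv; apply: low_strict => [i j ij|i].
  by apply: (diff_entry_cst (c := 0) _ oB bv (db_minus bv)) => y /b_minus_unip/GLm0_low; apply.
by apply: (diff_entry_cst (c := 1) _ oB bv (db_minus bv)) => y /b_minus_unip[_]; apply.
Qed.

Lemma half_gauge_up k v X : bdom v -> isup (half_gauge b_plus k v X).
Proof.
move=> bv; have up := GLp0_unit (b_plus_unip bv); have hp := GLp0_up (b_plus_unip bv).
have [ud hd] := delta_bdom bv.
have ip := isup_inv up hp.
apply: isup_add; first by apply: isup_mul => //; apply/issupW/db_plus_sup.
apply/isup_scale/isup_mul => //; apply: isup_mul => //; apply: isdg_up.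
by apply: isdg_mul; [apply: isdg_inv|apply: ddelta_isdg].
Qed.
Lemma half_gauge_low k v X : bdom v -> islow (half_gauge b_minus k v X).
Proof.
move=> bv; have up := GLm0_unit (b_minus_unip bv); have hp := GLm0_low (b_minus_unip bv).
have [ud hd] := delta_bdom bv.
have ip := islow_inv up hp.
apply: islow_add; first by apply: islow_mul => //; apply/isslowW/db_minus_slow.
apply/islow_scale/islow_mul => //; apply: islow_mul => //; apply: isdg_low.
by apply: isdg_mul; [apply: isdg_inv|apply: ddelta_isdg].
Qed.

Let plus_data v (bv : bdom v) := flat_half_gauge 2^-1 bv
  (fun y By => GLp0_unit (b_plus_unip By))
  (mc_b_plus (symC2_fclass oB) (F := id) (symC2_fst _) (symC2_snd _) (fun t Bt => Bt)).
Let minus_data v (bv : bdom v) := flat_half_gauge (- 2^-1) bv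
  (fun y By => GLm0_unit (b_minus_unip By))
  (mc_b_minus (symC2_fclass oB) (F := id) (symC2_fst _) (symC2_snd _) (fun t Bt => Bt)).

Lemma diff_OmegaV v X Y : Vstar v ->
  differentiable (fun u => OmegaV u X Y : K^o) v /\
  forall Z, 'd (fun u => OmegaV u X Y : K^o) v Z =
    'd (fun u => trwedge (logd (fun u => u.1)) (half_gauge b_plus 2^-1) u X Y : K^o) v Z -
    'd (fun u => trwedge (logd (fun u => u.2)) (half_gauge b_minus (- 2^-1)) u X Y : K^o) v Z.
Proof.
move=> Vv; have bv := Vstar_bdom Vv; have [/GLm0_unit u1 /GLp0_unit u2 _] := Vv.
have [d1 _] := flat_fst u1; have [d2 _] := flat_snd u2.
have [d3 _] := plus_data bv; have [d4 _] := minus_data bv.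
have [dp _] := @diff_trwedge _ _ _ _ _ v X Y 0 d1 d3.
have [dm _] := @diff_trwedge _ _ _ _ _ v X Y 0 d2 d4.
have -> : (fun u => OmegaV u X Y : K^o) = (fun u =>
   trwedge (logd (fun u => u.1)) (half_gauge b_plus 2^-1) u X Y : K^o) -
   (fun u => trwedge (logd (fun u => u.2)) (half_gauge b_minus (- 2^-1)) u X Y : K^o).
  by apply/funext => u; rewrite OmegaV_E.
split; first exact: (differentiableB dp dm).
by move=> Z; exact: (congr1 (@^~ Z) (diffB dp dm)).
Qed.

Lemma logd_fst_slow v X : Vstar v -> Vtangent X -> isslow (logd (fun u => u.1) v X).
Proof.
move=> [v1 _ _] [X1 _]; have -> : logd (fun u : M * M => u.1) v X = invmx v.1 *m X.1.
  exact: (congr1 (mulmx _) (diff_fst v X)).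
by apply: isslow_mulr => //; apply: islow_inv; [apply: GLm0_unit|apply: GLm0_low].
Qed.
Lemma logd_snd_sup v X : Vstar v -> Vtangent X -> issup (logd (fun u => u.2) v X).
Proof.
move=> [_ v2 _] [_ X2]; have -> : logd (fun u : M * M => u.2) v X = invmx v.2 *m X.2.
  exact: (congr1 (mulmx _) (diff_snd v X)).
by apply: issup_mulr => //; apply: isup_inv; [apply: GLp0_unit|apply: GLp0_up].
Qed.

Lemma closed_OmegaV v X Y Z : Vstar v -> Vtangent X -> Vtangent Y -> Vtangent Z ->
  extd (@OmegaV K n) v X Y Z = 0.
Proof.
move=> Vv TX TY TZ; have bv := Vstar_bdom Vv; have [/GLm0_unit u1 /GLp0_unit u2 _] := Vv.
have [d1 f1] := flat_fst u1; have [d2 f2] := flat_snd u2.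
have [d3 f3] := plus_data bv; have [d4 f4] := minus_data bv.
have Ep := extd_trwedge X Y Z d1 d3 f1 f3; have Em := extd_trwedge X Y Z d2 d4 f2 f4.
have E : extd (@OmegaV K n) v X Y Z =
    extd (trwedge (logd (fun u => u.1)) (half_gauge b_plus 2^-1)) v X Y Z -
    extd (trwedge (logd (fun u => u.2)) (half_gauge b_minus (- 2^-1))) v X Y Z.
  have dO A B C := (diff_OmegaV A B Vv).2 C.
  apply: (etrans (congr2 (fun a b : K => a + b)
    (congr2 (fun a b : K => a - b) (dO Y Z X) (dO X Z Y)) (dO X Y Z))).
  have alg (a b c d e f : K) : a - b - (c - d) + (e - f) = a - c + e - (b - d + f) by ring.
  exact: alg.
apply: (etrans E); apply: (etrans (congr2 (fun a b : K => a - b) Ep Em)).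
have a1 W : Vtangent W -> islow (logd (fun u : M * M => u.1) v W).
  by move=> TW; apply/isslowW/logd_fst_slow.
have a2 W : Vtangent W -> isup (logd (fun u : M * M => u.2) v W).
  by move=> TW; apply/issupW/logd_snd_sup.
have [_ [uw _]] := bv.
have conj (w p1 p2 p3 m1 m2 m3 : M) : w \in unitmx ->
    p1 = invmx w *m m1 *m w -> p2 = invmx w *m m2 *m w -> p3 = invmx w *m m3 *m w ->
    tr_cube p1 p2 p3 = tr_cube m1 m2 m3.
  move=> uw' -> -> ->; have := @tr_cube_conj _ _ (invmx w) m1 m2 m3.
  by rewrite invmxK unitmx_inv; apply.
have C := conj _ _ _ _ _ _ _ uw (gauge_conj X bv u1) (gauge_conj Y bv u1) (gauge_conj Z bv u1).
have alg (a b c d e f : K) : a = 0 -> b = 0 -> d = 0 -> e = 0 -> c = f ->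
    a - b - c - (d - e - f) = 0 by move=> -> -> -> -> ->; ring.
apply: alg C.
- exact: tr_cube_up (half_gauge_up 2^-1 X bv) (half_gauge_up 2^-1 Y bv) (half_gauge_up 2^-1 Z bv).
- exact: tr_cube_low (a1 X TX) (a1 Y TY) (a1 Z TZ).
- exact: tr_cube_low (half_gauge_low (- 2^-1) X bv) (half_gauge_low (- 2^-1) Y bv)
    (half_gauge_low (- 2^-1) Z bv).
- exact: tr_cube_up (a2 X TX) (a2 Y TY) (a2 Z TZ).
Qed.

Lemma closed_pullback (c : 'I_n.+1 -> K) U s v X Y Z : leaf_section c U s ->
  U v -> Vstar v -> Vtangent X -> Vtangent Y -> Vtangent Z ->
  extd (pullback s (@Omega K n)) v X Y Z = 0.
Proof.
move=> sP Uv Vv TX TY TZ; rewrite -(closed_OmegaV Vv TX TY TZ).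
have oU : open U by case: sP.
have sv := sdomV sP Uv Vv.
have D A B C : Vtangent A -> Vtangent B -> Vtangent C ->
    'd (fun u => pullback s Omega u A B : K^o) v C = 'd (fun u => OmegaV u A B : K^o) v C.
  move=> TA TB TC; apply: (diff_tangent oU Uv Vv TC).
  - exact: differentiable_pullback sP _ _ _ sv.
  - exact: (diff_OmegaV A B Vv).1.
  - by move=> u Uu Vu; apply: (pullback_OmegaV sP Uu Vu TA TB).
exact: (congr2 (fun a b : K => a + b)
    (congr2 (fun a b : K => a - b) (D _ _ _ TY TZ TX) (D _ _ _ TX TZ TY)) (D _ _ _ TX TY TZ)).
Qed.

End Closedness.

(** * Rational dependence on the parameter *)

Section Rational.
Context {K : numFieldType}.

(** Rational functions of one variable, with a denominator which does not vanish
    on [D]. *)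
Definition rational_on (D : set K) (f : K -> K) :=
  exists p q : {poly K}, forall t, D t -> q.[t] != 0 /\ f t = p.[t] / q.[t].

Lemma rational_fclass (D : set K) : fclass D (rational_on D).
Proof.
split.
- by move=> k; exists k%:P, 1 => t _; rewrite !hornerE oner_eq0 divr1.
- move=> f g [p [q h]] [p' [q' h']]; exists (p * q' + p' * q), (q * q') => t Dt.
  have [q0 ->] := h t Dt; have [q0' ->] := h' t Dt.
  by rewrite hornerD !hornerM mulf_neq0 //; split=> //; rewrite addf_div.
- move=> f g [p [q h]] [p' [q' h']]; exists (p * p'), (q * q') => t Dt.
  have [q0 ->] := h t Dt; have [q0' ->] := h' t Dt.
  by rewrite !hornerM mulf_neq0 //; split=> //; rewrite mulf_div.
- move=> f [p [q h]] f0; exists q, p => t Dt.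
  have [q0 E] := h t Dt; have := f0 t Dt; rewrite E.
  by rewrite mulf_eq0 invr_eq0 negb_or invf_div => /andP[].
- move=> f g fg [p [q h]]; exists p, q => t Dt; rewrite -fg //; exact: h.
Qed.

Lemma rational_affine D (a b : K) : rational_on D (fun t => t * a + b).
Proof.
exists ('X * a%:P + b%:P), 1 => t _.
by rewrite !hornerE oner_eq0 divr1.
Qed.

Lemma near0_horner (p : {poly K}) : p != 0 -> \forall t \near (0 : K^o)^', p.[t] != 0.
Proof.
move=> p0; have [m [q q0 E]] := multiplicity_XsubC p 0; rewrite p0 /= in q0.
have cq : Ck 0 setT (fun t : K^o => q.[t] : K^o).
  have CP := @Ck_fclass K K^o 0 setT openT.
  have -> : (fun t : K^o => q.[t] : K^o) = fun t => \sum_(i < size q) q`_i * t ^+ i.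
    by apply/funext => t; rewrite horner_coef.
  apply: (fc_sum CP) => i; apply: (fc_mul CP (fc_cst CP _)).
  elim: (i : nat) => [|j IH].
    by apply: (fc_ext CP) (fc_cst CP 1) => t _; rewrite expr0.
  apply: (fc_ext CP) (fc_mul CP _ IH) => [t _|]; first by rewrite exprS.
  by move=> t _; apply: cvg_id.
have n1 : \forall t \near (0 : K^o)^', q.[t] != 0.
  apply: cvg_within; apply: (cvgr_neq0 (q.[0]) (cq 0 I)).
  by move: q0; rewrite rootE.
have n2 : \forall t \near (0 : K^o)^', t != 0 by apply: withinT.
apply: filterS2 n1 n2 => t qt t0; rewrite E hornerM mulf_neq0 //.
by rewrite horner_exp !hornerE subr0 expf_neq0.
Qed.

End Rational.

Section DerivativeFormulas.
Context {K : numFieldType} {n : nat}.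
Local Notation M := 'M[K]_n.+1.
Implicit Types (u v X Y Z : M * M).

(** The sum of a strictly lower and an upper triangular matrix: the opposite of
    [(d b_minus) b_minus^-1] and [(d u) u^-1], where [u = delta *m b_plus]. *)
Definition wlogd v X : M :=
  b_minus v *m (invmx v.2 *m X.1 - invmx v.2 *m X.2 *m wof v) *m invmx (delta v *m b_plus v).

Lemma factor_derivatives (m d p w m' d' p' w' : M) :
  m \in unitmx -> islow m -> p \in unitmx -> isup p -> (forall i, p i i = 1) ->
  d \in unitmx -> isdg d -> m *m w = d *m p ->
  isslow m' -> isdg d' -> issup p' -> m' *m w + m *m w' = d' *m p + d *m p' ->
  let N := m *m w' *m invmx (d *m p) in
  let du := (N - slowmx N) *m (d *m p) in
  [/\ m' = - slowmx N *m m, d' = dgmx du & p' = invmx d *m (du - dgmx du *m p)].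
Proof.
move=> um hm up hp p1 ud hd R ddm ddd ddp dR N du.
have uu : d *m p \in unitmx by rewrite unitmx_mul ud.
have hu : isup (d *m p) by apply: isup_mul => //; apply: isdg_up.
pose DU := d' *m p + d *m p'.
have upDU : isup DU.
  apply: isup_add; first by apply: isup_mul => //; apply: isdg_up.
  by apply: isup_mul; [apply: isdg_up|apply: issupW].
have E : N = - (m' *m invmx m) + DU *m invmx (d *m p).
  have -> : m' *m invmx m = m' *m w *m invmx (d *m p).
    rewrite -mulmxA; congr (_ *m _); apply: (can_inj (mulKmx um)).
    by rewrite mulmxV // mulmxA R mulmxV.
  by rewrite addrC -mulmxBl /DU -dR addrAC subrr add0r.
have Es : slowmx N = - (m' *m invmx m).
  rewrite E split_slow_up //; last by apply: isup_mul => //; apply: isup_inv.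
  move=> i j ij; rewrite mxE (isslow_mull ddm (islow_inv um hm) ij) oppr0 //.
have Edu : du = DU by rewrite /du Es {1}E opprK addrAC addNr add0r mulmxKV.
have Edd : dgmx DU = d'.
  apply: isdg_eq => [||i]; [exact: dgmx_isdg|exact: ddd|].
  by rewrite dgmxE mxE isdg_mulE // isdg_mulE // ddp // mulr0 addr0 p1 mulr1.
rewrite Edu Edd Es; split => //.
- by rewrite opprK mulmxKV.
- by rewrite /DU addrAC subrr add0r mulKmx.
Qed.

Lemma diff_b_formulas v X : bdom v ->
  let du := (wlogd v X - slowmx (wlogd v X)) *m (delta v *m b_plus v) in
  [/\ 'd (@b_minus K n) v X = - slowmx (wlogd v X) *m b_minus v,
      'd (@delta K n) v X = dgmx du &
      'd (@b_plus K n) v X = invmx (delta v) *m (du - dgmx du *m b_plus v)].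
Proof.
move=> bv.
have um := GLm0_unit (b_minus_unip bv); have hm := GLm0_low (b_minus_unip bv).
have up := GLp0_unit (b_plus_unip bv); have hp := GLp0_up (b_plus_unip bv).
have [ud hd] := delta_bdom bv.
have dR := etrans (congr1 (fun z => 'd (@b_minus K n) v X *m wof v + b_minus v *m z)
  (esym (diff_wof X bv))) (diff_b_relation X bv).
exact: (factor_derivatives um hm up hp (b_plus_unip bv).2 ud hd (b_relation bv)
  (db_minus_slow X bv) (ddelta_isdg X bv) (db_plus_sup X bv) dR).
Qed.

Lemma bdom_unit1 v : bdom v -> v.1 \in unitmx.
Proof. by move=> [u2 [uw _]]; move: uw; rewrite /wof unitmx_mul => /andP[]. Qed.

Section Class.
Context {T : Type} {D : set T} {C : (T -> K) -> Prop}.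
Hypothesis CP : fclass D C.
Variable F : T -> M * M.
Hypotheses (CF1 : mclass C (fun t => (F t).1)) (CF2 : mclass C (fun t => (F t).2)).
Hypothesis gF : forall t, D t -> bdom (F t).

Let Cm := mc_b_minus CP CF1 CF2 gF.
Let Cp := mc_b_plus CP CF1 CF2 gF.
Let Cd := mc_delta CP CF1 CF2 gF.

Let Cu : mclass C (fun t => delta (F t) *m b_plus (F t)).
Proof. exact: (mc_mul CP Cd Cp). Qed.

Lemma mc_wlogd X : mclass C (fun t => wlogd (F t) X).
Proof.
apply: (mc_mul CP); first apply: (mc_mul CP Cm).
  have C2 : mclass C (fun t => invmx (F t).2) by apply: (mc_inv CP CF2) => t /gF[].
  apply: (mc_sub CP); first exact: (mc_mul CP C2 (mc_cst CP _)).
  apply: (mc_mul CP); first exact: (mc_mul CP C2 (mc_cst CP _)).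
  exact: (mc_wof CP CF1 CF2 gF).
apply: (mc_inv CP Cu) => t /gF bt; rewrite unitmx_mul.
by have [-> _] := delta_bdom bt; apply/GLp0_unit/b_plus_unip.
Qed.

Let Cdu X : mclass C (fun t => (wlogd (F t) X - slowmx (wlogd (F t) X)) *m (delta (F t) *m b_plus (F t))).
Proof.
apply: (mc_mul CP) => //; apply: (mc_sub CP); first exact: mc_wlogd.
exact/(mc_slow CP)/mc_wlogd.
Qed.

Lemma mc_half_gauge (b : M * M -> M) k X :
  mclass C (fun t => b (F t)) -> mclass C (fun t => 'd b (F t) X) ->
  (forall v, bdom v -> b v \in unitmx) -> mclass C (fun t => half_gauge b k (F t) X).
Proof.
move=> Cb Cdb ub; have Ci : mclass C (fun t => invmx (b (F t))).
  by apply: (mc_inv CP Cb) => t /gF/ub.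
apply: (mc_add CP); first exact: (mc_mul CP Ci Cdb).
apply: (mc_scale CP (fc_cst CP k)); apply: (mc_mul CP) => //; apply: (mc_mul CP Ci).
apply: (mc_mul CP); first by apply: (mc_inv CP Cd) => t /gF/delta_bdom[].
apply: (mc_ext CP) (mc_dg CP (Cdu X)) => t /gF bt.
by have [_ e _] := diff_b_formulas X bt; apply: esym.
Qed.

Lemma fc_OmegaV X Y : C (fun t => OmegaV (F t) X Y).
Proof.
have Hp Z : mclass C (fun t => half_gauge b_plus 2^-1 (F t) Z).
  apply: mc_half_gauge => //; last by move=> v /b_plus_unip/GLp0_unit.
  apply: (mc_ext CP (F := fun t => invmx (delta (F t)) *m
    ((wlogd (F t) Z - slowmx (wlogd (F t) Z)) *m (delta (F t) *m b_plus (F t)) -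
     dgmx ((wlogd (F t) Z - slowmx (wlogd (F t) Z)) *m (delta (F t) *m b_plus (F t))) *m b_plus (F t)))).
    by move=> t /gF bt; have [_ _ e] := diff_b_formulas Z bt; apply: esym.
  apply: (mc_mul CP); first by apply: (mc_inv CP Cd) => t /gF/delta_bdom[].
  by apply: (mc_sub CP) => //; apply: (mc_mul CP) => //; apply: (mc_dg CP).
have Hm Z : mclass C (fun t => half_gauge b_minus (- 2^-1) (F t) Z).
  apply: mc_half_gauge => //; last by move=> v /b_minus_unip/GLm0_unit.
  apply: (mc_ext CP (F := fun t => - slowmx (wlogd (F t) Z) *m b_minus (F t))).
    by move=> t /gF bt; have [e _ _] := diff_b_formulas Z bt; apply: esym.
  by apply: (mc_mul CP) => //; apply: (mc_opp CP); apply/(mc_slow CP)/mc_wlogd.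
have H1 Z : mclass C (fun t => logd (fun u => u.1) (F t) Z).
  apply: (mc_ext CP (F := fun t => invmx (F t).1 *m Z.1)).
    by move=> t _; exact: (esym (congr1 (mulmx _) (diff_fst (F t) Z))).
  by apply: (mc_mul CP _ (mc_cst CP _)); apply: (mc_inv CP CF1) => t /gF/bdom_unit1.
have H2 Z : mclass C (fun t => logd (fun u => u.2) (F t) Z).
  apply: (mc_ext CP (F := fun t => invmx (F t).2 *m Z.2)).
    by move=> t _; exact: (esym (congr1 (mulmx _) (diff_snd (F t) Z))).
  by apply: (mc_mul CP _ (mc_cst CP _)); apply: (mc_inv CP CF2) => t /gF[].
have Ct (al be : form1 (M * M)%type M) : (forall Z, mclass C (fun t => al (F t) Z)) ->
    (forall Z, mclass C (fun t => be (F t) Z)) -> C (fun t => trwedge al be (F t) X Y).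
  move=> Ca Cb; apply: (mc_trace CP (F := fun t =>
    al (F t) X *m be (F t) Y - al (F t) Y *m be (F t) X)).
  by apply: (mc_sub CP); apply: (mc_mul CP).
apply: (fc_ext CP (f := fun t => trwedge (logd (fun u => u.1)) (half_gauge b_plus 2^-1) (F t) X Y -
  trwedge (logd (fun u => u.2)) (half_gauge b_minus (- 2^-1)) (F t) X Y)).
  by move=> t _; rewrite OmegaV_E.
by apply: (fc_sub CP); apply: Ct.
Qed.

End Class.
End DerivativeFormulas.

(** * The Gram determinant *)

Section Bilinear.
Context {K : numFieldType} {E : normedModType K} {n : nat}.
Implicit Types (al be : form1 E 'M[K]_n).

Lemma trwedge_linl (Y : E) al be x : linear (al x) -> linear (be x) ->
  linear (fun X => trwedge al be x X Y : K^o).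
Proof.
move=> la lb k X X'; rewrite /trwedge la lb !(mulmxDl, mulmxDr) -scalemxAl -scalemxAr.
have sc (z : K^o) : k *: z = k * z by [].
rewrite sc !(mxtraceD, mxtraceN, mxtraceZ); ring.
Qed.

Lemma trwedgeC al be x X Y : trwedge al be x X Y = - trwedge al be x Y X.
Proof. by rewrite /trwedge -mxtraceN opprB. Qed.

Lemma logd_linear (f : E -> 'M[K]_n) x : linear (logd f x).
Proof. by move=> k X Y; rewrite /logd linearP mulmxDr -scalemxAr. Qed.

End Bilinear.

Section Nondegeneracy.
Context {K : numFieldType} {n : nat}.
Local Notation M := 'M[K]_n.+1.
Implicit Types (u v X Y Z : M * M) (a A B : M).

Lemma Omega_linl a (Y : M) : linear (fun X : M => Omega a X Y : K^o).
Proof.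
move=> k X X'; rewrite /Omega.
have L1 := trwedge_linl Y (logd_linear v_plus a) (logd_linear a_plus a).
have L2 := trwedge_linl Y (logd_linear v_minus a) (logd_linear a_minus a).
apply: (etrans (congr2 (fun s t : K => s - t) (L1 k X X') (L2 k X X'))).
have alg (p q r s : K) : k * p + q - (k * r + s) = k * (p - r) + (q - s) by ring.
exact: alg.
Qed.

Lemma OmegaC a (X Y : M) : Omega a X Y = - Omega a Y X.
Proof.
rewrite /Omega; apply: (etrans (congr2 (fun s t : K => s - t)
  (trwedgeC _ _ _ _ _) (trwedgeC _ _ _ _ _))).
by rewrite opprB opprK addrC.
Qed.

Lemma half_gauge_linear (b : M * M -> M) k v : linear (half_gauge b k v).
Proof.
move=> c X Y; rewrite /half_gauge.
apply: (etrans (congr2 (fun s t => s + k *: (invmx (b v) *m t *m b v))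
  (logd_linear b v c X Y) (logd_linear (@delta K n) v c X Y))).
rewrite !(mulmxDr, mulmxDl) -scalemxAr -scalemxAl !scalerDr !scalerA [k * c]mulrC addrACA.
by [].
Qed.

Lemma OmegaV_linl v Y : linear (fun X => OmegaV v X Y : K^o).
Proof.
move=> k X X'; rewrite !OmegaV_E.
have L1 := trwedge_linl Y (logd_linear (fun u : M * M => u.1) v)
  (half_gauge_linear b_plus 2^-1 v).
have L2 := trwedge_linl Y (logd_linear (fun u : M * M => u.2) v)
  (half_gauge_linear b_minus (- 2^-1) v).
apply: (etrans (congr2 (fun s t : K => s - t) (L1 k X X') (L2 k X X'))).
have alg (p q r s : K) : k * p + q - (k * r + s) = k * (p - r) + (q - s) by ring.
exact: alg.
Qed.

Lemma linear_comb (V : lmodType K) (f : V -> K^o) (I : finType) (c : I -> K) (x : I -> V) :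
  linear f -> f (\sum_i c i *: x i) = \sum_i c i * f (x i).
Proof.
move=> lf; have f0 : f 0 = 0.
  by have := lf (-1) 0 0; rewrite scaleN1r oppr0 addr0 => ->; rewrite scaleN1r addNr.
elim/big_rec2: _ => // i s y _ <-; exact: lf.
Qed.

(** A matrix with zero diagonal is the sum of its two strictly triangular parts; the
    diagonal term makes the extension of [OmegaV] to all matrices nondegenerate
    whenever [OmegaV] is. *)
Definition tpair A : M * M := (slowmx A, supmx A).
Definition gramform v A B : K := OmegaV v (tpair A) (tpair B) + \sum_i A i i * B i i.
Definition gram v : 'M[K]_(n.+1 * n.+1) :=
  \matrix_(p, q) gramform v (vec_mx (delta_mx 0 p)) (vec_mx (delta_mx 0 q)).

Lemma tpair_linear k A B : tpair (k *: A + B) = k *: tpair A + tpair B.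
Proof.
congr pair; apply/matrixP => i j; rewrite !mxE; case: ifP => _ //; by rewrite mulr0 addr0.
Qed.

Lemma tpair_tangent A : Vtangent (tpair A).
Proof. by split=> j k jk; [apply: slowmx_isslow|apply: supmx_issup]. Qed.

Lemma gramform_linl v B : linear (fun A => gramform v A B : K^o).
Proof.
move=> k A A'; rewrite /gramform tpair_linear.
apply: (etrans (congr1 (fun z : K => z + _) (OmegaV_linl v (tpair B) k (tpair A) (tpair A')))).
have -> : \sum_i (k *: A + A') i i * B i i =
    k * \sum_i A i i * B i i + \sum_i A' i i * B i i.
  by rewrite mulr_sumr -big_split; apply: eq_bigr => i _; rewrite !mxE mulrDl mulrA.
have alg (p q r s : K) : k * p + q + (k * r + s) = k * (p + r) + (q + s) by ring.
exact: alg.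
Qed.

Lemma gram_row v (a : 'rV[K]_(n.+1 * n.+1)) q :
  (a *m gram v) 0 q = gramform v (vec_mx a) (vec_mx (delta_mx 0 q)).
Proof.
have -> : vec_mx a = \sum_p a 0 p *: (vec_mx (delta_mx 0 p) : M).
  rewrite {1}[a]row_sum_delta linear_sum; apply: eq_bigr => p _.
  by rewrite linearZ.
rewrite (linear_comb _ _ (gramform_linl v (vec_mx (delta_mx 0 q)))) mxE.
by apply: eq_bigr => p _; rewrite mxE.
Qed.

Lemma gram_nondegenerate v : gram v \in unitmx -> forall X, Vtangent X ->
  (forall Y, Vtangent Y -> OmegaV v X Y = 0) -> X = 0.
Proof.
move=> ug X [X1 X2] hX; pose A := X.1 + X.2.
have eA : tpair A = X.
  rewrite [X]surjective_pairing /A; congr pair.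
    by rewrite split_slow_up //; apply: issupW.
  by rewrite addrC split_sup_low //; apply: isslowW.
have A0 : A = 0.
  rewrite -[A]mxvecK; suff -> : mxvec A = 0 by rewrite linear0.
  apply: (can_inj (mulmxK ug)); rewrite mul0mx; apply/rowP => q.
  rewrite gram_row mxvecK mxE /gramform eA hX ?add0r; last exact: tpair_tangent.
  by rewrite big1 // => i _; rewrite mxE X1 // X2 // addr0 mul0r.
by rewrite -eA A0 /tpair; congr pair; apply/matrixP => i j; rewrite !mxE; case: ifP.
Qed.

Let e1 : M * M := (1%:M, 1%:M).

Lemma LUable1 : LUable (1%:M : M).
Proof.
have -> : (1%:M : M) = 1%:M *m 1%:M by rewrite mulmx1.
by apply: LUable_mul; rewrite ?unitmx1 //; [apply/isdg_low/isdg1|apply/isdg_up/isdg1].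
Qed.

Lemma wof1 : wof e1 = 1%:M.
Proof. by rewrite /wof /= invmx1 mulmx1. Qed.

Lemma bdom1 : bdom e1.
Proof. by split; rewrite ?unitmx1 // wof1; apply: LUable1. Qed.

Lemma b_at1 : [/\ b_plus e1 = 1%:M, b_minus e1 = 1%:M & delta e1 = 1%:M].
Proof.
have d1 (j : 'I_n.+1) : (1%:M : M) j j = 1 by rewrite mxE eqxx.
have H : b_factors e1 (1%:M, 1%:M, 1%:M).
  split => /=.
  - by split=> //; split; [rewrite unitmx1|apply/isdg_up/isdg1].
  - by split=> //; split; [rewrite unitmx1|apply/isdg_low/isdg1].
  - by apply/is_diag_mxP => i j ij; apply: isdg1.
  - by rewrite !invmx1 !mulmx1.
have u1 : wof e1 \in unitmx by rewrite wof1 unitmx1.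
by have [-> -> ->] := b_factorsE u1 H.
Qed.

Lemma OmegaV1 X Y : Vtangent X -> Vtangent Y ->
  OmegaV e1 X Y = 2 * (\tr (X.2 *m Y.1) - \tr (X.1 *m Y.2)).
Proof.
move=> TX TY; have [bp bm de] := b_at1.
have W Z : wlogd e1 Z = Z.1 - Z.2.
  by rewrite /wlogd bp bm de wof1 /= !invmx1 !mul1mx !mulmx1 ?invmx1 ?mulmx1.
have D Z : Vtangent Z -> [/\ 'd (@b_minus K n) e1 Z = - Z.1,
    'd (@delta K n) e1 Z = 0 & 'd (@b_plus K n) e1 Z = - Z.2].
  move=> [Z1 Z2]; have := diff_b_formulas Z bdom1; rewrite /= W bp bm de !mulmx1.
  have -> : slowmx (Z.1 - Z.2) = Z.1.
    by rewrite split_slow_up //; apply/isup_opp/issupW.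
  have -> : Z.1 - Z.2 - Z.1 = - Z.2 by rewrite addrAC subrr add0r.
  have -> : dgmx (- Z.2) = 0.
    by apply/matrixP => i j; rewrite !mxE; case: eqP => // <-; rewrite Z2 // oppr0.
  by rewrite invmx1 mul1mx subr0.
have L1 Z : logd (fun u : M * M => u.1) e1 Z = Z.1.
  by apply: (etrans (congr1 (mulmx _) (diff_fst e1 Z))); rewrite /= invmx1 mul1mx.
have L2 Z : logd (fun u : M * M => u.2) e1 Z = Z.2.
  by apply: (etrans (congr1 (mulmx _) (diff_snd e1 Z))); rewrite /= invmx1 mul1mx.
have G (b : M * M -> M) k Z B : Vtangent Z -> b e1 = 1%:M -> 'd b e1 Z = B ->
    half_gauge b k e1 Z = B.
  move=> TZ b1 db; have [_ d0 _] := D Z TZ; rewrite /half_gauge /logd b1.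
  apply: (etrans (congr2 (fun s t => invmx 1%:M *m s +
    k *: (invmx 1%:M *m (invmx (delta e1) *m t) *m 1%:M)) db d0)).
  by rewrite invmx1 mul1mx !mulmx0 mul0mx scaler0 addr0.
have Gp Z (TZ : Vtangent Z) : half_gauge b_plus 2^-1 e1 Z = - Z.2.
  by apply: G => //; case: (D Z TZ).
have Gm Z (TZ : Vtangent Z) : half_gauge b_minus (- 2^-1) e1 Z = - Z.1.
  by apply: G => //; case: (D Z TZ).
rewrite OmegaV_E /trwedge !L1 !L2 !Gp // !Gm //.
rewrite !(mulmxN, mxtraceD, mxtraceN) (mxtrace_mulC Y.1) (mxtrace_mulC Y.2).
ring.
Qed.

Lemma gram1_unit : gram e1 \in unitmx.
Proof.
rewrite -row_free_unit -kermx_eq0; apply/rowV0P => a /sub_kermxP ag.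
have Q q : gramform e1 (vec_mx a) (vec_mx (delta_mx 0 q)) = 0.
  by rewrite -gram_row ag mxE.
have QB i j : gramform e1 (vec_mx a) (delta_mx i j) = 0.
  by have := Q (mxvec_index i j); rewrite vec_mx_delta.
move: QB; set A := vec_mx a => QB.
have trd (B : M) i j (k : K) : \tr (B *m (k *: delta_mx i j)) = k * B j i.
  rewrite -scalemxAr mxtraceZ mxtrace_mulC /mxtrace (bigD1 i) //= big1 ?addr0 => [|l li].
    rewrite mxE (bigD1 j) //= big1 ?addr0 => [|l lj]; first by rewrite mxE !eqxx mul1r.
    by rewrite mxE (negPf lj) andbF mul0r.
  by rewrite mxE big1 // => m _; rewrite mxE (negPf li) mul0r.
have slowd i j : slowmx (delta_mx i j : M) = (j < i)%N%:R *: delta_mx i j.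
  apply/matrixP => k l; rewrite !mxE; case: (eqVneq k i) => [->|_] /=; last first.
    by rewrite mulr0 if_same.
  by case: (eqVneq l j) => [->|_] /=; rewrite ?mulr0 ?if_same //; case: ifP; rewrite ?mulr1 ?mul0r.
have supd i j : supmx (delta_mx i j : M) = (i < j)%N%:R *: delta_mx i j.
  apply/matrixP => k l; rewrite !mxE; case: (eqVneq k i) => [->|_] /=; last first.
    by rewrite mulr0 if_same.
  by case: (eqVneq l j) => [->|_] /=; rewrite ?mulr0 ?if_same //; case: ifP; rewrite ?mulr1 ?mul0r.
have dgd i j : \sum_k A k k * (delta_mx i j : M) k k = (i == j)%:R * A j i.
  rewrite (bigD1 i) //= big1 ?addr0 => [|k ki]; last by rewrite [delta_mx _ _ _ _]mxE (negPf ki) mulr0.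
  by rewrite [delta_mx _ _ _ _]mxE eqxx /=; case: eqP => [->|_]; rewrite ?mulr1 ?mul1r ?mulr0 ?mul0r.
have E i j : A j i = 0.
  have := QB i j; rewrite /gramform OmegaV1; [|exact: tpair_tangent|exact: tpair_tangent].
  rewrite /tpair /= slowd supd !trd dgd [supmx _ _ _]mxE [slowmx _ _ _]mxE -val_eqE.
  case: (ltngtP i j) => ij; rewrite ?(mul0r, mul1r, subr0, sub0r, addr0, add0r, mulr0) // => /eqP.
    by rewrite mulf_eq0 pnatr_eq0 oppr_eq0 => /eqP.
  by rewrite mulf_eq0 pnatr_eq0 => /eqP.
have A0 : A = 0 by apply/matrixP => i j; rewrite E mxE.
by rewrite -[a]vec_mxK -/A A0 linear0.
Qed.

Lemma fc_gram (T : Type) (D : set T) (C : (T -> K) -> Prop) (F : T -> M * M) :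
  fclass D C -> mclass C (fun t => (F t).1) -> mclass C (fun t => (F t).2) ->
  (forall t, D t -> bdom (F t)) -> C (fun t => \det (gram (F t))).
Proof.
move=> CP C1 C2 bF; apply: (mc_det CP) => p q.
pose A : M := vec_mx (delta_mx 0 p); pose B : M := vec_mx (delta_mx 0 q).
apply: (@fc_ext _ _ _ _ CP (fun t => OmegaV (F t) (tpair A) (tpair B) + \sum_i A i i * B i i)).
  by move=> t _; rewrite mxE.
apply: (fc_add CP); last exact: (fc_cst CP).
exact: (fc_OmegaV CP C1 C2 bF).
Qed.

(** On the line from [v] to the pair of identities, the Gram determinant is a nonzero
    rational function. *)
Lemma gram_near_line v : Vstar v ->
  \forall t \near (0 : K^o)^', bdom (t *: (e1 - v) + v) -> gram (t *: (e1 - v) + v) \in unitmx.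
Proof.
move=> Vv; pose l t : M * M := t *: (e1 - v) + v.
pose D : set K := [set t | bdom (l t)].
have CP := rational_fclass D.
have C1 : mclass (rational_on D) (fun t => (l t).1).
  move=> i j; apply: (fc_ext CP) (rational_affine D ((e1 - v).1 i j) (v.1 i j)) => t _.
  by rewrite /= !mxE.
have C2 : mclass (rational_on D) (fun t => (l t).2).
  move=> i j; apply: (fc_ext CP) (rational_affine D ((e1 - v).2 i j) (v.2 i j)) => t _.
  by rewrite /= !mxE.
have [p [q h]] := fc_gram CP C1 C2 (fun t Dt => Dt).
have l1 : l 1 = e1 by rewrite /l scale1r subrK.
have p0 : p != 0.
  have D1 : D 1 by rewrite /D /= l1; apply: bdom1.
  have [_ E] := h 1 D1.
  apply: contraTneq gram1_unit => pz; rewrite unitmxE unitfE -l1 E pz horner0 mul0r.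
  by rewrite eqxx.
apply: filterS (near0_horner p0) => t pt Dt.
by have [q0 E] := h t Dt; rewrite unitmxE unitfE E mulf_neq0 // invr_eq0.
Qed.

End Nondegeneracy.

(** * Generic nondegeneracy *)

Section FormRank.
Context {K : numFieldType} {V : vectType K}.

Lemma nondegenerate_rank (w : V -> V -> K) (T : {vspace V}) :
  (forall Y, linear (fun X => w X Y : K^o)) -> (forall X Y, w X Y = - w Y X) ->
  nondegenerate_on w T -> form_rank w T = \dim T.
Proof.
move=> wl wa nd; rewrite /form_rank; set G := \matrix_(i, j) _.
suff fG : row_free G by exact/eqP.
rewrite -kermx_eq0; apply/rowV0P => a /sub_kermxP aG.
have wr X : linear (fun Y => w X Y : K^o).
  by move=> k Y Y'; rewrite wa (wl X k Y Y') opprD -scalerN !(wa X).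
pose X := \sum_i a 0 i *: (vbasis T)`_i.
have TX : X \in T.
  apply: memv_suml => i _; apply: memvZ; apply: vbasis_mem; apply: mem_nth.
  by rewrite size_tuple.
have X0 : X = 0.
  apply: nd => // Y TY; rewrite (coord_vbasis TY).
  rewrite (linear_comb _ _ (wr X)) big1 // => j _.
  have -> : w X (vbasis T)`_j = 0; last by rewrite mulr0.
  rewrite (linear_comb _ _ (wl _)).
  have := congr1 (fun M : 'rV_(\dim T) => M 0 j) aG; rewrite !mxE => E; apply: etrans E.
  by apply: eq_bigr => i _; rewrite mxE.
have /freeP fr := basis_free (vbasisP T).
by apply/rowP => i; rewrite mxE; apply: (fr (fun i => a 0 i) X0).
Qed.

End FormRank.

Section Generic.
Context {K : numFieldType} {n : nat}.
Local Notation M := 'M[K]_n.+1.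
Implicit Types (a X Y : M) (v : M * M) (c : 'I_n.+1 -> K).

Lemma leaf_tangentP a X : X \in leaf_tangent a <-> forall j, 'd (phi j) a X = 0.
Proof.
rewrite memvE; split=> [/subv_bigcapP h j|h].
  by have := h j isT; rewrite -memvE memv_ker lfunE => /eqP.
by apply/subv_bigcapP => j _; rewrite -memvE memv_ker lfunE; apply/eqP.
Qed.

Lemma diff_param a X : GLstar a -> 'd (@param K n) a X = ('d v_plus a X, 'd v_minus a X).
Proof. by move=> ga; exact: (congr1 (@^~ X) (diff_pair (dv_plus ga) (dv_minus ga))). Qed.

Lemma diff_param_tangent a X : GLstar a -> Vtangent ('d (@param K n) a X).
Proof.
move=> ga; have E := diff_param X ga; apply: (@eq_ind_r _ _ Vtangent _ _ E); split=> /=.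
- exact: dv_plus_slow.
- exact: dv_minus_sup.
Qed.

(** The parameter is an immersion of each leaf. *)
Lemma leaf_tangent_inj a X : GLstar a -> (forall j, 'd (phi j) a X = 0) ->
  'd v_plus a X = 0 -> 'd v_minus a X = 0 -> X = 0.
Proof.
move=> ga h dp dm.
have [/= _ _ Ep] := plus_factorsP ga; have [/= _ _ Em] := minus_factorsP ga.
have uvp := v_plus_unit ga; have uvm := v_minus_unit ga.
have uap := a_plus_unit ga; have uam := a_minus_unit ga.
have hp := a_plus_up ga; have hm := a_minus_low ga; have ua := GLstar_unit ga.
have lp : logd v_plus a X = 0 by exact: (etrans (congr1 (mulmx _) dp) (mulmx0 _ _)).
have lm : logd v_minus a X = 0 by exact: (etrans (congr1 (mulmx _) dm) (mulmx0 _ _)).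
have tp : logd a_plus a X = theta_plus a X.
  by apply: (etrans (logd_plusE X ga)); rewrite lp addr0.
have tm : logd a_minus a X = theta_minus a X.
  by apply: (etrans (logd_minusE X ga)); rewrite lm addr0.
have up := logd_a_plus_up X ga; have low := logd_a_minus_low X ga.
have dg := leaf_tangent_diag ga h.
rewrite tp in up; rewrite tm in low.
pose Z := X *m invmx a.
have Zp : Z = a_plus a *m theta_plus a X *m invmx (a_plus a).
  rewrite /theta_plus !mulmxA mulmxV // mul1mx /Z -mulmxA; congr (_ *m _).
  by rewrite {1}Ep invmx_mul ?unitmx_inv // invmxK.
have Zm : Z = a_minus a *m theta_minus a X *m invmx (a_minus a).
  rewrite /theta_minus !mulmxA mulmxV // mul1mx /Z -mulmxA; congr (_ *m _).
  by rewrite {1}Em invmx_mul ?unitmx_inv // invmxK.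
have ip := isup_inv uap hp; have im := islow_inv uam hm.
have Z0 : Z = 0.
  have Zu : isup Z by rewrite Zp; apply: isup_mul => //; apply: isup_mul.
  have Zl : islow Z by rewrite Zm; apply: islow_mul => //; apply: islow_mul.
  have Zk k : Z k k = (theta_plus a X) k k.
    rewrite Zp (up_mul_diag k (isup_mul hp up) ip) (up_mul_diag k hp up) up_inv_diag //.
    by rewrite mulrC mulKf // a_plus_diag_neq0.
  have Zk' k : Z k k = (theta_minus a X) k k.
    rewrite Zm (low_mul_diag k (islow_mul hm low) im) (low_mul_diag k hm low) low_inv_diag //.
    by rewrite mulrC mulKf // a_minus_diag_neq0.
  apply: isdg_eq => [||k]; [exact: low_up_isdg|by move=> i j _; rewrite mxE|].
  have D := dg k; rewrite tp tm -Zk -Zk' in D.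
  have /eqP : Z k k *+ 2 = 0 by rewrite mulr2n {1}D addNr.
  by rewrite mulrn_eq0 /= => /eqP ->; rewrite [RHS]mxE.
by rewrite -[X](mulmxKV ua) -/Z Z0 mul0mx.
Qed.

(** The differential of a section maps the tangent space of [Vstar] to that of the leaf, and is
    inverse to the differential of [param]. *)
Lemma section_immersion c U s a : leaf_section c U s -> GLstar a -> U (param a) ->
  s (param a) = a ->
  forall Y : M * M, Vtangent Y -> ('d s (param a) Y \in leaf_tangent a) /\
    'd (@param K n) a ('d s (param a) Y) = Y.
Proof.
move=> sP ga Uv sa Y TY; have Vv := param_Vstar ga.
have oU : open U by case: sP.
have ds : differentiable s (param a) by case: sP => _ /(_ 1%N)[d _] _; apply: d.
have comp (F : normedModType K) (f : M -> F) (g : M * M -> F) : differentiable f a ->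
    differentiable g (param a) -> (forall u, U u -> Vstar u -> f (s u) = g u) ->
    'd f a ('d s (param a) Y) = 'd g (param a) Y.
  move=> df dg fg; have df' : differentiable f (s (param a)) by rewrite sa.
  have E := congr1 (@^~ Y) (diff_comp ds df').
  have E1 : 'd f a ('d s (param a) Y) = 'd f (s (param a)) ('d s (param a) Y).
    exact: (esym (congr1 (fun z => 'd f z ('d s (param a) Y)) sa)).
  apply: (etrans E1); apply: (etrans (esym E)).
  exact: (diff_tangent oU Uv Vv TY (differentiable_comp ds df') dg fg).
split.
  apply/leaf_tangentP => j.
  have dph := Ck_diff (@smooth_phi K n j 1%N) ga.
  apply: (etrans (comp _ (phi j) (fun=> c j : K^o) dph (differentiable_cst _ _) _)).
    by case: sP => _ _ h u Uu Vu; have [[_ hc] _] := h u Uu Vu; apply: hc.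
  exact: (congr1 (@^~ Y) (diff_cst (c j : K^o) (param a))).
have dpa := Ck_diff (@smooth_param K n 1%N) ga.
have Hid : is_diff (param a) (fun u : M * M => u) (fun u => u).
  by apply: is_diff_linear => // x; apply: cvg_id.
have [did eid] := Hid.
apply: (etrans (comp _ _ _ dpa did _)).
  by case: sP => _ _ h u Uu Vu; have [_ ->] := h u Uu Vu.
exact: (congr1 (@^~ Y) eid).
Qed.

Lemma leaf_nondegenerate c a : sqrt_near1 (K := K) -> leaf c a ->
  gram (param a) \in unitmx -> nondegenerate_on (Omega a) (leaf_tangent a).
Proof.
move=> hs la ug X /leaf_tangentP TX hX; have ga := la.1.
have [U [s [sP Uv sa _]]] := leaf_section_ex hs la.
have Vv := param_Vstar ga.
have imm := section_immersion sP ga Uv sa.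
pose X' := 'd (@param K n) a X.
have TX' : Vtangent X' := diff_param_tangent X ga.
(* Both sides are tangent to the leaf and have the same image under ['d param]. *)
have EX : X = 'd s (param a) X'.
  have [/leaf_tangentP T1 T2] := imm X' TX'.
  have Zphi j : 'd (phi j) a (X - 'd s (param a) X') = 0.
    by apply: (etrans (linearB _ _ _)); rewrite TX T1 subrr.
  have Zp : 'd (@param K n) a (X - 'd s (param a) X') = 0.
    by apply: (etrans (linearB _ _ _)); rewrite T2 subrr.
  have Zp' := etrans (esym (diff_param _ ga)) Zp.
  apply/eqP; rewrite -subr_eq0; apply/eqP.
  exact: (leaf_tangent_inj ga Zphi (congr1 fst Zp') (congr1 snd Zp')).
suff X0 : X' = 0 by rewrite EX X0; exact: linear0.
apply: (gram_nondegenerate ug TX') => Y TY.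
have [TsY _] := imm Y TY.
rewrite -(pullback_OmegaV sP Uv Vv TX' TY) /pullback sa -EX.
exact: hX.
Qed.

Lemma dim_leaf_tangent a : GLstar a -> \dim (leaf_tangent a) = (n.+1 ^ 2 - n.+1)%N.
Proof.
move=> ga; pose f X : 'rV[K]_n.+1 := \row_j ('d (phi j) a X).
have lf : linear f by move=> k X Y; apply/rowP => j; rewrite !mxE linearP.
pose fM := GRing.isLinear.Build _ _ _ _ _ lf.
pose fL : {linear M -> 'rV[K]_n.+1} := HB.pack f fM.
have kerE : lker (linfun fL) = leaf_tangent a.
  apply/vspaceP => X; rewrite memv_ker lfunE; apply/eqP/idP => [E|/leaf_tangentP h].
    by apply/leaf_tangentP => j; have := congr1 (fun r : 'rV_n.+1 => r 0 j) E; rewrite !mxE.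
  by apply/rowP => j; rewrite !mxE; apply: h.
have imE : limg (linfun fL) = fullv.
  apply/vspaceP => r; rewrite memvf.
  have [X hX] := phi_submersion (fun j => r 0 j) ga.
  have -> : r = linfun fL X by rewrite lfunE; apply/rowP => j; rewrite mxE hX.
  by apply: memv_img; apply: memvf.
have := limg_ker_dim (linfun fL) fullv; rewrite capfv kerE imE !dimvf !dim_matrix => E.
have E2 : (n.+1 ^ 2)%N = (\dim (leaf_tangent a) + n.+1)%N.
  by rewrite -mulnn -[X in (_ + X)%N]mul1n; exact: (esym E).
by rewrite E2 addnK.
Qed.

(** The points where the Gram determinant at the parameter does not vanish. *)
Definition regular : set M := [set a | GLstar a /\ gram (param a) \in unitmx].

Lemma open_regular : open regular.
Proof.
have oG := @open_GLstar K n.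
have CG : Ck 0 GLstar (fun a : M => \det (gram (param a)) : K^o).
  have CP := Ck_fclass 0 oG.
  have CI : mclass (@Ck K M K^o 0 GLstar) (fun a => a) by apply/(Ck_mxP _ _ oG)/Ck_id.
  apply: (fc_gram CP (F := param)).
  - exact: (mc_v_plus CP CI (fun t Bt => Bt)).
  - exact: (mc_v_minus CP CI (fun t Bt => Bt)).
  - by move=> a /param_Vstar/Vstar_bdom.
have := open_neq0 oG CG; congr open; apply/funext => a; apply/propext.
by rewrite /regular /= unitmxE unitfE.
Qed.

Lemma e1_tangent v : Vstar v -> Vtangent ((1%:M, 1%:M) - v : M * M).
Proof.
move=> [[[_ l] d1] [[_ u] d2] _]; split=> j k; rewrite leq_eqVlt => /orP[/eqP/val_inj->|jk] /=;
  rewrite !mxE ?eqxx ?d1 ?d2 ?subrr //; rewrite ?l ?u // subr0 -val_eqE /=;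
  by rewrite ?(ltn_eqF jk) ?(gtn_eqF jk).
Qed.

Lemma regular_dense c : sqrt_near1 (K := K) -> leaf c `<=` closure (leaf c `&` regular).
Proof.
move=> hs a la B nB; have ga := la.1.
have [U [s [sP Uv sa _]]] := leaf_section_ex hs la.
have Vv := param_Vstar ga; set v := param a in Uv sa Vv *.
have oU : open U by case: sP.
have TX := e1_tangent Vv; set X := (_ - v) in TX.
have [dl _] := is_diff_line v X 0; have cl := differentiable_continuous dl.
have cl0 (A : set (M * M)) : nbhs v A -> \forall t \near (0 : K^o)^', A (t *: X + v).
  move=> nA; apply: cvg_within; apply: cl; by rewrite scale0r add0r.
have n1 := cl0 _ (open_nbhs_nbhs (conj oU Uv)).
have n2 := cl0 _ (open_nbhs_nbhs (conj (@open_Vopen K n) (Vstar_Vopen Vv))).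
have cs : {for v, continuous s}.
  by case: sP => _ /(_ 0%N) h _; apply: h.
have n3 : \forall t \near (0 : K^o)^', B (s (t *: X + v)).
  by apply: (cl0 (fun u => B (s u))); apply: cs; rewrite sa.
have n4 := gram_near_line Vv.
have [t [[h1 h2] [h3 h4]]] := filter_ex (filterI (filterI n1 n2) (filterI n3 n4)).
have Vt : Vstar (t *: X + v) by apply: Vstar_line.
have [_ _ /(_ _ h1 Vt)[lt pt]] := sP.
exists (s (t *: X + v)); split=> //; split=> //; split; first exact: lt.1.
by rewrite pt; apply: h4; apply: Vstar_bdom.
Qed.

Lemma generic_nondegenerate c : sqrt_near1 (K := K) ->
  generic_in (leaf c) (fun a => nondegenerate_on (Omega a) (leaf_tangent a)).
Proof.
move=> hs; exists regular; split; [exact: open_regular|exact: regular_dense|].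
by move=> a la [_ ug]; apply: (leaf_nondegenerate hs la ug).
Qed.

Lemma generic_rank c : sqrt_near1 (K := K) ->
  generic_in (leaf c)
    (fun a => form_rank (Omega a) (leaf_tangent a) = (n.+1 ^ 2 - n.+1)%N).
Proof.
move=> hs; exists regular; split; [exact: open_regular|exact: regular_dense|].
move=> a la [ga ug]; rewrite -(dim_leaf_tangent ga); apply: nondegenerate_rank.
- exact: Omega_linl.
- exact: OmegaC.
- exact: (leaf_nondegenerate hs la ug).
Qed.

End Generic.

Section SquareRoots.
Context (R : realType).

Lemma sqrt_near1_real : sqrt_near1 (K := R).
Proof.
move=> z hz; exists (Num.sqrt z); apply: sqr_sqrtr.
by move: hz; rewrite ltr_distl => /andP[h _]; lra.
Qed.

Lemma sqrt_near1_complex : sqrt_near1 (K := R[i]).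
Proof. by move=> z _; exists (sqrtC z); apply: sqrtCK. Qed.

End SquareRoots.

(** * The theorem *)

Theorem theorem5p1 (R : realType) (K : numFieldType)
    (hK : K = (R : numFieldType) \/ K = (R[i] : numFieldType)) (n : nat) :
  (* the factorizations are well defined *)
  [/\ forall a : 'M[K]_n.+1, GLstar a -> exists! p, plus_factors a p,
      forall a : 'M[K]_n.+1, GLstar a -> exists! p, minus_factors a p &
      forall v : 'M[K]_n.+1 * 'M[K]_n.+1, Vstar v -> exists! t, b_factors v t] /\
  (* the functions phi_j define a foliation of GL_* of codimension n.+1, and
     Omega is a smooth 2-form there *)
  [/\ open (@GLstar K n),
      forall j, smooth (@GLstar K n) (phi j),
      forall a : 'M[K]_n.+1, GLstar a ->
        forall u : 'I_n.+1 -> K, exists X, forall j, 'd (phi j) a X = u j &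
      forall X Y : 'M[K]_n.+1,
        smooth (@GLstar K n) (fun a => Omega a X Y : K^o)] /\
  (* the leaves are parametrized by V_* *)
  [/\ smooth (@GLstar K n) param,
      forall a : 'M[K]_n.+1, GLstar a -> Vstar (param a),
      forall (c : 'I_n.+1 -> K) (a : 'M[K]_n.+1), leaf c a ->
        exists U s, [/\ leaf_section c U s, U (param a), s (param a) = a &
          \forall a' \near a, leaf c a' -> U (param a') /\ s (param a') = a'],
      forall (c : 'I_n.+1 -> K) (v : 'M[K]_n.+1 * 'M[K]_n.+1),
        (forall j, c j != 0) -> Vstar v ->
        (exists2 a, leaf c a & param a = v) <->
        (forall j : 'I_n.+1, exists r : K, r ^+ 2 =
          c j * c ord_max * \prod_(k < n.+1 | (j < k)%N) delta v k k) &
      forall (c : 'I_n.+1 -> K) (a a' : 'M[K]_n.+1), leaf c a -> leaf c a' ->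
        param a = param a' <->
        exists e : 'rV[K]_n.+1, (forall k, e 0 k ^+ 2 = 1) /\
          a' = diag_mx e *m a] /\
  (* the pullback of Omega to each leaf is closed, and generically
     nondegenerate of rank (n.+1)^2 - n.+1 *)
  [/\ forall (c : 'I_n.+1 -> K) U s, leaf_section c U s ->
        forall v X Y Z, U v -> Vstar v ->
          Vtangent X -> Vtangent Y -> Vtangent Z ->
          extd (pullback s Omega) v X Y Z = 0,
      forall c : 'I_n.+1 -> K, generic_in (leaf c)
        (fun a => nondegenerate_on (Omega a) (leaf_tangent a)) &
      forall c : 'I_n.+1 -> K, generic_in (leaf c)
        (fun a => form_rank (Omega a) (leaf_tangent a) = (n.+1 ^ 2 - n.+1)%N)] /\
  (* its pullback to V_* is OmegaV, whatever the leaf *)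
  (forall (c : 'I_n.+1 -> K) U s, leaf_section c U s ->
     forall v X Y, U v -> Vstar v -> Vtangent X -> Vtangent Y ->
       pullback s Omega v X Y = OmegaV v X Y).

Proof.
have hs : sqrt_near1 (K := K).
  by case: hK => ->; [apply: sqrt_near1_real|apply: sqrt_near1_complex].
split.
  split=> [a ga|a ga|v Vv].
  - exists (a_plus a, v_plus a); split; first exact: plus_factorsP.
    by move=> p; apply: plus_factors_uniq; apply: plus_factorsP.
  - exists (a_minus a, v_minus a); split; first exact: minus_factorsP.
    by move=> p; apply: minus_factors_uniq; apply: minus_factorsP.
  - exists (b_plus v, b_minus v, delta v); split; first exact/b_factorsP/Vstar_LU.
    by move=> t; apply: b_factors_uniq; [apply: wof_param_unit|apply/b_factorsP/Vstar_LU].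
split.
  split; [exact: open_GLstar|exact: smooth_phi| |exact: smooth_Omega].
  by move=> a ga u; apply: phi_submersion.
split.
  split; [exact: smooth_param|exact: param_Vstar| | |].
  - by move=> c a; apply: leaf_section_ex.
  - by move=> c v c0 Vv; apply: leaf_existence.
  - by move=> c a a'; apply: leaf_param_eq.
split.
  split=> [c U s sP v X Y Z Uv Vv TX TY TZ|c|c].
  - exact: (closed_pullback sP Uv Vv TX TY TZ).
  - exact: generic_nondegenerate.
  - exact: generic_rank.
move=> c U s sP v X Y Uv Vv TX TY; exact: (pullback_OmegaV sP Uv Vv TX TY).
Qed.
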